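(* Let $\mathcal{H}$ be a real, separable, infinite-dimensional Hilbert space with orthonormal basis $\{q_1,q_2,\ldots\}$, and let $\mathcal{A}:\mathcal{H}\to\mathcal{H}$ be a positive trace-class operator. Fix a positive integer $m$ divisible by $3$. Let $\hat{T}(\mathcal{A})$ denote the output of infHutch++ and, for $n\ge 1$, let $\hat{T}_n(\mathcal{A})$ denote the output of truncated infHutch++ using $q_1,\ldots,q_n$ (both defined in the context), each with the parameter $m$. Then, as $n\to\infty$, $\hat{T}_n(\mathcal{A})$ converges in distribution to $\hat{T}(\mathcal{A})$, and $$\mathbb{E}[\hat{T}_n(\mathcal{A})]\longrightarrow\mathrm{tr}(\mathcal{A}).$$
   Context: An operator $\mathcal{A}:\mathcal{H}\to\mathcal{H}$ is called positive trace-class if it is bounded, self-adjoint, satisfies $\langle\mathcal{A}x,x\rangle\ge 0$ for all $x\in\mathcal{H}$, and has finite trace $\mathrm{tr}(\mathcal{A})=\sum_{i=1}^\infty\langle\mathcal{A}e_i,e_i\rangle$, which is independent of the orthonormal basis $\{e_1,e_2,\ldots\}$ of $\mathcal{H}$. For a positive trace-class operator $\mathcal{B}$, $N(0,\mathcal{B})$ denotes the centered Gaussian distribution on $\mathcal{H}$ with covariance operator $\mathcal{B}$: if $\mathcal{B}=\sum_i\sigma_i\langle u_i,\cdot\rangle u_i$ is the spectral decomposition with nonzero eigenvalues $\sigma_1\ge\sigma_2\ge\cdots>0$ and orthonormal eigenvectors $u_i$, it is the distribution of the almost surely convergent series $x=\sum_i\omega_i\sqrt{\sigma_i}\,u_i$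 with i.i.d. standard real Gaussian $\omega_i$ (equivalently, $\langle x,h\rangle$ is a real Gaussian variable with mean $0$ and variance $\langle\mathcal{B}h,h\rangle$ for every $h\in\mathcal{H}$). For a finite orthonormal system $Q=[v_1|\cdots|v_d]$ in $\mathcal{H}$, viewed as an operator $Q:\mathbb{R}^d\to\mathcal{H}$, $QQ^*$ is the orthogonal projector onto $\mathrm{span}\{v_1,\ldots,v_d\}$ and $\mathrm{tr}(Q^*\mathcal{A}Q)=\sum_{j=1}^d\langle\mathcal{A}v_j,v_j\rangle$. infHutch++ (idealized). Draw $m/3$ independent samples $s_1,\ldots,s_{m/3}\sim N(0,\mathcal{A}^2)$; let $Q$ be an orthonormal basis of $\mathrm{span}\{s_1,\ldots,s_{m/3}\}$; draw $m/3$ independent samples $g_1,\ldots,g_{m/3}\sim N(0,\mathcal{A})$, independent of the $s_i$; return $$\hat{T}(\mathcal{A})=\mathrm{tr}(Q^*\mathcal{A}Q)+\frac{3}{m}\sum_{i=1}^{m/3}\langle g_i,(I-QQ^* )g_i\rangle.$$ Truncated infHutch++ (with dimension $n$). Draw i.i.d. random elements $\hat{y}_1,\ldots,\hat{y}_{m/3}$ and, independently of these, i.i.d. random elements $\hat{x}_1,\ldots,\hat{x}_{m/3}$, all distributed as $\sum_{j=1}^n\gamma_jq_j$ with $\gamma_1,\ldots,\gamma_n$ i.i.d. standard real Gaussian. Set $\hat{s}_i=\mathcal{A}\hat{y}_i$, let $Q$ be an orthonormal basis of $\mathrm{span}\{\hat{s}_1,\ldots,\hat{s}_{m/3}\}$,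 set $\Delta_Q=(I-QQ^* )\mathcal{A}(I-QQ^* )$, and return $$\hat{T}_n(\mathcal{A})=\mathrm{tr}(Q^*\mathcal{A}Q)+\frac{3}{m}\sum_{i=1}^{m/3}\langle\Delta_Q\hat{x}_i,\hat{x}_i\rangle.$$ *)

(* Defs.v *)
(* MathComp / MathComp-Analysis *)
From mathcomp Require Import all_boot all_order all_algebra.
From mathcomp Require Import finmap.
From mathcomp Require Import all_classical all_reals all_analysis.

Set Implicit Arguments.
Unset Strict Implicit.
Unset Printing Implicit Defensive.

Import Order.TTheory GRing.Theory Num.Theory.
Import numFieldNormedType.Exports.

Local Open Scope classical_set_scope.
Local Open Scope ring_scope.

(* A real Hilbert space is a complete normed module H together with
   ip : {dot H for idfun} inducing its norm. *)
Definition norm_induced_by (R : realType) (H : completeNormedModType R)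
    (ip : {dot H for idfun}) : Prop :=
  forall x : H, `|x| = Num.sqrt (ip x x).

Definition lin_span (R : realType) (H : lmodType R) (I : finType) (v : I -> H) :
    set H :=
  [set \sum_(i : I) c i *: v i | c in [set: I -> R]].

(* Being indexed by nat, such a family exists only in a separable
   infinite-dimensional space. *)
Definition orthonormal_basis (R : realType) (H : completeNormedModType R)
    (ip : {dot H for idfun}) (e : nat -> H) : Prop :=
  (forall i j, ip (e i) (e j) = (i == j)%:R) /\
  dense (\bigcup_n lin_span (fun i : 'I_n => e i)).

Definition optrace (R : realType) (H : completeNormedModType R)
    (ip : {dot H for idfun}) (e : nat -> H) (A : H -> H) : \bar R :=
  (\sum_(0 <= i <oo) (ip (A (e i)) (e i))%:E)%E.

Record positive_trace_class (R : realType) (H : completeNormedModType R)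
    (ip : {dot H for idfun}) (A : {linear H -> H}) : Prop := {
  ptc_bounded : exists M : R, forall x, `|A x| <= M * `|x| ;
  ptc_selfadjoint : forall x y, ip (A x) y = ip x (A y) ;
  ptc_positive : forall x, 0 <= ip (A x) x ;
  ptc_trace : exists e, orthonormal_basis ip e /\ (optrace ip e A < +oo)%E }.

(* H with its Borel sigma-algebra *)
Notation borel H := (g_sigma_algebraType (@open H)).

(* Set functions carry arbitrary values outside the sigma-algebra, hence the
   restriction to measurable sets. *)
Definition same_law d (T : measurableType d) (R : realType)
    (mu nu : set T -> \bar R) : Prop :=
  forall S, measurable S -> mu S = nu S.

Definition mutually_independent d (O : measurableType d) (R : realType)
    (P : probability O R) d' (T : measurableType d') (I : choiceType)
    (X : I -> {RV P >-> T}) : Prop :=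
  forall (J : {fset I}) (S : I -> set T), (forall i, measurable (S i)) ->
    P (\bigcap_(i in [set` J]) (X i @^-1` S i)) =
    (\prod_(i <- J) P (X i @^-1` S i))%E.

Definition iid_std_normal d (O : measurableType d) (R : realType)
    (P : probability O R) (I : choiceType) (w : I -> {RV P >-> R}) : Prop :=
  mutually_independent w /\
  forall i, same_law (distribution P (w i)) (normal_prob 0 1).

(* When B has finite rank the eigenvalues are padded with zeros; the vectors
   u i with s i = 0 play no role and are unconstrained. *)
Record spectral_decomposition (R : realType) (H : completeNormedModType R)
    (ip : {dot H for idfun}) (B : H -> H) (s : nat -> R) (u : nat -> H) :
    Prop := {
  sd_ge0 : forall i, 0 <= s i ;
  sd_noninc : forall i j, (i <= j)%N -> s j <= s i ;
  sd_orthonormal : forall i j, s i != 0 -> s j != 0 ->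
    ip (u i) (u j) = (i == j)%:R ;
  sd_sum : forall x,
    (\sum_(i < N) (s i * ip (u i) x) *: u i) @[N --> \oo] --> B x }.

(* X ~ N(0, B): the law of X is that of a random element Y, possibly living on
   another probability space, which is almost surely the sum of the
   Karhunen-Loeve series of B. *)
Definition gaussian_law (R : realType) (H : completeNormedModType R)
    (ip : {dot H for idfun}) (B : H -> H) d (O : measurableType d)
    (P : probability O R) (X : {RV P >-> borel H}) : Prop :=
  exists (s : nat -> R) (u : nat -> H),
    spectral_decomposition ip B s u /\
    exists d' (O' : measurableType d') (P' : probability O' R)
           (w : nat -> {RV P' >-> R}) (Y : {RV P' >-> borel H}),
      [/\ iid_std_normal w,
          {ae P', forall t,
            (\sum_(i < N) (w i t * Num.sqrt (s i)) *: u i : H) @[N --> \oo]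
              --> (Y t : H)} &
          same_law (distribution P X) (distribution P' Y)].

(* X is distributed as \sum_(j < n) gamma_j *: q j with gamma_j i.i.d. N(0,1) *)
Definition truncated_law (R : realType) (H : completeNormedModType R)
    (q : nat -> H) (n : nat) d (O : measurableType d)
    (P : probability O R) (X : {RV P >-> borel H}) : Prop :=
  exists d' (O' : measurableType d') (P' : probability O' R)
         (gamma : 'I_n -> {RV P' >-> R}) (Y : {RV P' >-> borel H}),
    [/\ iid_std_normal gamma,
        forall t, (Y t : H) = \sum_(j < n) gamma j t *: q j &
        same_law (distribution P X) (distribution P' Y)].

Definition join_families (I J T : Type) (f : I -> T) (g : J -> T) (k : I + J) :
    T :=
  match k with inl i => f i | inr j => g j end.

Definition orthonormal_basis_of_span (R : realType)
    (H : completeNormedModType R) (ip : {dot H for idfun}) (k : nat)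
    (Q : seq H) (v : 'I_k -> H) : Prop :=
  orthonormal ip Q /\ lin_span (fun i : 'I_(size Q) => Q`_i) = lin_span v.

(* The image of x under I - Q Q', with Q' the adjoint of Q *)
Definition residual (R : realType) (H : completeNormedModType R)
    (ip : {dot H for idfun}) (Q : seq H) (x : H) : H :=
  x - \sum_(v <- Q) ip v x *: v.

(* The trace of Q' A Q on R^(size Q) *)
Definition compressed_trace (R : realType) (H : completeNormedModType R)
    (ip : {dot H for idfun}) (A : H -> H) (Q : seq H) : R :=
  \sum_(v <- Q) ip (A v) v.

(* That : O -> R is an output of infHutch++; Q t is any orthonormal basis of
   the span of the samples, possibly of fewer than m / 3 vectors. *)
Definition infHutchpp (R : realType) (H : completeNormedModType R)
    (ip : {dot H for idfun}) (A : {linear H -> H}) (m : nat)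
    d (O : measurableType d) (P : probability O R) (That : O -> R) : Prop :=
  exists (s g : 'I_(m %/ 3) -> {RV P >-> borel H}) (Q : O -> seq H),
    [/\ forall i, gaussian_law ip (A \o A) (s i),
        forall i, gaussian_law ip A (g i),
        mutually_independent (join_families s g),
        forall t, orthonormal_basis_of_span ip (Q t) (fun i => s i t : H) &
        forall t, That t = compressed_trace ip A (Q t) +
          3 / m%:R *
          \sum_(i < m %/ 3) ip (g i t : H) (residual ip (Q t) (g i t))].

Definition truncated_infHutchpp (R : realType) (H : completeNormedModType R)
    (ip : {dot H for idfun}) (q : nat -> H) (A : {linear H -> H}) (m n : nat)
    d (O : measurableType d) (P : probability O R) (That : O -> R) : Prop :=
  exists (y x : 'I_(m %/ 3) -> {RV P >-> borel H}) (Q : O -> seq H),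
    [/\ forall i, truncated_law q n (y i),
        forall i, truncated_law q n (x i),
        mutually_independent (join_families y x),
        forall t, orthonormal_basis_of_span ip (Q t) (fun i => A (y i t)) &
        forall t, That t = compressed_trace ip A (Q t) +
          3 / m%:R *
          \sum_(i < m %/ 3)
            ip (residual ip (Q t) (A (residual ip (Q t) (x i t)))) (x i t : H)].

(* Convergence in distribution of real random variables, the n-th one living
   on its own probability space. *)
Definition cvg_in_distribution (R : realType) (d : nat -> measure_display)
    (O : forall n, measurableType (d n)) (P : forall n, probability (O n) R)
    (X : forall n, O n -> R) d' (O' : measurableType d')
    (P' : probability O' R) (Y : O' -> R) : Prop :=
  [/\ forall n, measurable_fun setT (X n),
      measurable_fun setT Y &
      forall f : R -> R, continuous f -> (exists M : R, forall x, `|f x| <= M) ->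
        'E_(P n)[f \o X n]%E @[n --> \oo] --> 'E_P'[f \o Y]%E].

(* Main.v *)
From HB Require Import structures.
Require Import Defs.
From mathcomp Require Import all_boot all_order all_algebra.
From mathcomp Require Import finmap.
From mathcomp Require Import all_classical all_reals all_analysis.
From mathcomp Require Import measurable_realfun ring lra zify.
Import Order.TTheory GRing.Theory Num.Theory.
Import numFieldNormedType.Exports.
Set Implicit Arguments.
Unset Strict Implicit.
Unset Printing Implicit Defensive.
Local Open Scope classical_set_scope.
Local Open Scope ring_scope.

(* Write T_n for the output of the truncated estimator, and let g_i ~ N(0, A) be
   independent of its sketch. Since exp(-l <A u, u>) is the mean of
   cos(sqrt(2l) <g, u>), exchanging the roles of the normal vectors x_i and g_i
   shows that T_n has the same Laplace transform, hence the same law, as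
   tr(Q' A Q) + (3/m) sum_i sum_(j < n) <(I - Q Q') g_i, q_j>^2.
   In this form the sketch A (sum_(j < n) w_ij q_j), built for all n from the same
   normal variables w_ij, converges in mean square to a family of N(0, A^2)
   vectors, hence almost surely along fast subsequences. Generically Gram-Schmidt
   is continuous at the limit, since its residuals vanish only beyond the rank of
   A, so the estimators converge almost surely along these subsequences, to a
   variable with the law of infHutch++. Dominated convergence gives both claims;
   the limiting mean is tr(A) since a frame captures from E |g|^2 = tr(A) exactly
   the compressed trace. *)

(** The outputs for different n live on unrelated probability spaces, so only their laws can be
    compared. All of them are transported to one product of two spaces, on which the normal
    variables are those that the hypothesis on the g_i already supplies. Exchanging the x_i for the
    g_i is forced: x_i has mean square norm n and has no limit in H, whereas g_i stays fixed and the
    truncation survives only in a Bessel sum below |g_i|^2, which is integrable and later dominates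
    the means. Laws are handled through real integrals of cos(u + b) with a free phase b, which
    carry the full characteristic function. They determine a law because Gaussian averaging turns
    them into Laplace transforms of squares, and tails of nonnegative variables are recovered from
    Laplace transforms by explicit polynomials in exp(-u). Almost sure convergence is available only
    along subsequences, but the integrals are plain real sequences: one that stayed away from its
    limit would have a fast subsequence that stays away too. *)

Lemma integrable_scalel {R : realType} d (T : measurableType d)
    (mu : {measure set T -> \bar R}) (a : R) (f : T -> R) :
  mu.-integrable setT (EFin \o f) -> mu.-integrable setT (EFin \o (fun x => a * f x)).
Proof.
move=> fi; rewrite (_ : _ \o _ = (fun x => a%:E * (EFin \o f) x)%E)//.
exact: integrableZl.
Qed.

(** * Bounded integrands and product probabilities *)

Section bounded_integrals.
Context {R : realType} d (T : measurableType d) (P : probability T R).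

Lemma bounded_integrable (f : T -> R) (M : R) :
  measurable_fun setT f -> (forall x, `|f x| <= M) ->
  P.-integrable setT (EFin \o f).
Proof.
move=> mf fM; apply: (@le_integrable _ _ _ P setT _ _ (cst M%:E)) => //.
- exact/measurable_EFinP.
- by move=> x _ /=; rewrite lee_fin (le_trans (fM x))// ler_norm.
- exact: finite_measure_integrable_cst.
Qed.

Lemma EFin_Rintegral (f : T -> R) : P.-integrable setT (EFin \o f) ->
  (\int[P]_x f x)%:E = (\int[P]_x (f x)%:E)%E.
Proof. by move=> fi; rewrite fineK//; exact: integrable_fin_num. Qed.

Lemma Rintegral_dct (f_ : nat -> T -> R) (f : T -> R) (M : R) :
  (forall n, measurable_fun setT (f_ n)) -> measurable_fun setT f ->
  (forall n x, `|f_ n x| <= M) ->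
  {ae P, forall x, f_ ^~ x @ \oo --> f x} ->
  (\int[P]_x f_ n x) @[n --> \oo] --> \int[P]_x f x.
Proof.
move=> mf_ mf fM ff.
have [] := @dominated_convergence _ _ _ P setT measurableT
  (fun n x => (f_ n x)%:E) (fun x => (f x)%:E) (fun=> M%:E).
- by move=> n; exact/measurable_EFinP.
- exact/measurable_EFinP.
- apply: filterS ff => x fx _; apply: cvg_EFin => //; exact: nearW.
- exact: (finite_measure_integrable_cst P M measurableT).
- by apply: aeW => x n _; rewrite /= lee_fin.
move=> fi _ cf; apply: fine_cvg.
by rewrite EFin_Rintegral.
Qed.

End bounded_integrals.

Section product_probability.
Context {R : realType} d1 d2 (T1 : measurableType d1) (T2 : measurableType d2).
Variables (P1 : probability T1 R) (P2 : probability T2 R).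

(** A name for the product measure, to which the structure of a probability is attached below. *)
Definition prodP : set (T1 * T2) -> \bar R := (P1 \x P2)%E.

HB.instance Definition _ := Measure.on prodP.

Let prodP_setT : prodP setT = 1%E.
Proof.
rewrite -setXTT /prodP product_measure1E//.
by rewrite [X in (X * _)%E]probability_setT [X in (_ * X)%E]probability_setT mule1.
Qed.

HB.instance Definition _ :=
  Measure_isProbability.Build _ _ _ prodP prodP_setT.

Variables (f : T1 * T2 -> R) (M : R).
Hypotheses (mf : measurable_fun setT f) (fM : forall x, `|f x| <= M).

Let fi : (P1 \x P2)%E.-integrable setT (EFin \o f).
Proof. exact: (bounded_integrable prodP mf fM). Qed.

Let mf1 y : measurable_fun setT (fun x => f (x, y)).
Proof. by apply: (measurableT_comp mf); exact: measurable_fun_pair. Qed.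

Let mf2 x : measurable_fun setT (fun y => f (x, y)).
Proof. by apply: (measurableT_comp mf); exact: measurable_fun_pair. Qed.

Let fi1 y : P1.-integrable setT (EFin \o (fun x => f (x, y))).
Proof. exact: bounded_integrable. Qed.

Let fi2 x : P2.-integrable setT (EFin \o (fun y => f (x, y))).
Proof. exact: bounded_integrable. Qed.

Lemma Rintegral_fubini1 : \int[prodP]_z f z = \int[P1]_x \int[P2]_y f (x, y).
Proof.
congr fine; rewrite -(@integral12_prod_meas1 _ _ _ _ _ P1 P2 _ fi).
by apply: eq_integral => x _; rewrite /fubini_F EFin_Rintegral.
Qed.

Lemma Rintegral_fubini2 : \int[prodP]_z f z = \int[P2]_y \int[P1]_x f (x, y).
Proof.
congr fine; rewrite -(@integral21_prod_meas1 _ _ _ _ _ P1 P2 _ fi).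
by apply: eq_integral => y _; rewrite /fubini_G EFin_Rintegral.
Qed.

End product_probability.

(** * Characteristic functions of independent normal variables *)

Section normal_cos.
Context {R : realType}.
Notation mu := (@lebesgue_measure R).

Definition std_pdf (x : R) : R := normal_peak 1 * expR (- (x ^+ 2 / 2)).

Lemma std_pdfE : std_pdf = normal_pdf 0 1.
Proof.
apply/funext => x; rewrite normal_pdfE ?oner_eq0// /std_pdf /normal_fun.
by rewrite subr0 expr1n mulNr.
Qed.

Lemma std_pdf_ge0 x : 0 <= std_pdf x.
Proof. by rewrite std_pdfE normal_pdf_ge0. Qed.

Lemma measurable_std_pdf : measurable_fun setT std_pdf.
Proof. by rewrite std_pdfE; exact: measurable_normal_pdf. Qed.

Lemma integrable_std_pdf : mu.-integrable setT (EFin \o std_pdf).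
Proof. by rewrite std_pdfE; exact: integrable_normal_pdf. Qed.

Lemma is_derive_std_pdf (x : R) : is_derive x 1 std_pdf (- x * std_pdf x).
Proof.
rewrite /std_pdf.
by apply: is_derive_eq; rewrite /GRing.scale /=; field.
Qed.

(** Since |x| <= 1 + x^2/4 <= exp(x^2/4), the integrand is at most a multiple of the normal density
    of variance 2; [c] is the ratio of the two peaks. *)
Lemma integrable_norm_std_pdf :
  mu.-integrable setT (EFin \o (fun x => `|x| * std_pdf x)).
Proof.
pose c := normal_peak 1 / normal_peak (Num.sqrt 2) : R.
have s2 : Num.sqrt 2 != 0 :> R by rewrite gt_eqF// sqrtr_gt0.
apply: (@le_integrable _ _ _ mu setT measurableT _
  (fun x => c%:E * (normal_pdf 0 (Num.sqrt 2) x)%:E)%E).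
- apply/measurable_EFinP/measurable_funM; last exact: measurable_std_pdf.
  exact: normr_measurable.
- move=> x _ /=; rewrite lee_fin normrM normr_id (ger0_norm (std_pdf_ge0 _)).
  apply: le_trans (ler_norm _).
  rewrite normal_pdfE// /std_pdf /c [leRHS]mulrA divfK ?gt_eqF ?normal_peak_gt0//.
  rewrite mulrCA ler_wpM2l ?normal_peak_ge0// /normal_fun subr0 sqr_sqrtr//.
  rewrite (_ : - (x ^+ 2 / 2) = - x ^+ 2 / (2 *+ 2) - (x ^+ 2 / (2 * 2))); last by rewrite -mulr_natr; field.
  rewrite expRD mulrCA -[leRHS]mulr1 ler_wpM2l ?expR_ge0//.
  rewrite expRN ler_pdivrMr ?expR_gt0// mul1r.
  apply: le_trans (expR_ge1Dx _).
  have := sqr_ge0 (`|x| / 2 - 1); have := real_normK (num_real x).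
  by nra.
- apply: integrableZl => //; exact: integrable_normal_pdf.
Qed.

Lemma continuous_std_pdf : continuous std_pdf.
Proof. by rewrite std_pdfE; apply: continuous_normal_pdf; rewrite oner_eq0. Qed.

Lemma std_pdf_le (x : R) : std_pdf x <= normal_peak 1 * (1 + x ^+ 2 / 2)^-1.
Proof.
rewrite /std_pdf ler_wpM2l ?normal_peak_ge0// expRN lef_pV2 ?posrE ?expR_gt0//.
  exact: expR_ge1Dx.
by rewrite ltr_pwDl// divr_ge0 ?sqr_ge0.
Qed.

Lemma std_pdf_cvg0 : std_pdf n%:R @[n --> \oo] --> (0 : R).
Proof.
apply: (@squeeze_cvgr _ _ _ _ (fun=> 0) (fun n => normal_peak 1 * (2 * n.+1%:R^-1))).
- apply: nearW => n; rewrite std_pdf_ge0/= (le_trans (std_pdf_le _))//.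
  rewrite ler_wpM2l ?normal_peak_ge0//.
  have n1 : 0 < n.+1%:R :> R by [].
  rewrite -div1r ler_pdivrMr ?ltr_pwDl ?divr_ge0 ?sqr_ge0// mulrAC ler_pdivlMr//.
  by rewrite -natr1; have : 0 <= n%:R :> R by []; nra.
- exact: cvg_cst.
- rewrite [X in _ --> X](_ : 0 = normal_peak 1 * (2 * 0)); last by rewrite !mulr0.
  apply: cvgMr; apply: cvgMr; exact: cvg_harmonic.
Qed.

Lemma std_pdfN (x : R) : std_pdf (- x) = std_pdf x.
Proof. by rewrite /std_pdf sqrrN. Qed.

(** The derivative of [sin (a * x + b) * std_pdf x]. *)
Let dF a b (x : R) := a * (cos (a * x + b) * std_pdf x) - x * sin (a * x + b) * std_pdf x.

Lemma measurable_cos_affine (a b : R) : measurable_fun setT (fun x : R => cos (a * x + b)).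
Proof.
apply: measurableT_comp => /=; first by apply: continuous_measurable_fun; exact: continuous_cos.
by apply: measurable_funD => //; exact: measurable_funM.
Qed.

Lemma measurable_sin_affine (a b : R) : measurable_fun setT (fun x : R => sin (a * x + b)).
Proof.
apply: measurableT_comp => /=; first by apply: continuous_measurable_fun; exact: continuous_sin.
by apply: measurable_funD => //; exact: measurable_funM.
Qed.

Lemma integrable_cos_pdf a b :
  mu.-integrable setT (EFin \o (fun x => cos (a * x + b) * std_pdf x)).
Proof.
apply: le_integrable integrable_std_pdf => //.
- apply/measurable_EFinP/measurable_funM; last exact: measurable_std_pdf.
  exact: measurable_cos_affine.
- move=> x _ /=; rewrite lee_fin normrM ler_piMl// ler_norml.
  by rewrite cos_geN1 cos_le1.
Qed.

Lemma integrable_sin_pdf a b :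
  mu.-integrable setT (EFin \o (fun x => x * sin (a * x + b) * std_pdf x)).
Proof.
apply: le_integrable integrable_norm_std_pdf => //.
- apply/measurable_EFinP/measurable_funM; last exact: measurable_std_pdf.
  by apply: measurable_funM => //; exact: measurable_sin_affine.
- move=> x _ /=; rewrite lee_fin !normrM normr_id ler_wpM2r// ler_piMr// ler_norml.
  by rewrite sin_geN1 sin_le1.
Qed.

(** Integration by parts: the integral of [dF a b] over growing symmetric intervals is a boundary
    term, which vanishes in the limit because [std_pdf] does. *)
Lemma Rintegral_sin_pdf a b : \int[mu]_x (x * sin (a * x + b) * std_pdf x) =
  a * \int[mu]_x (cos (a * x + b) * std_pdf x).
Proof.
pose F x := sin (a * x + b) * std_pdf x.
have DF (x : R) : is_derive x 1 F (dF a b x).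
  have := is_derive_std_pdf x => ?.
  rewrite /F /dF; apply: is_derive_eq; rewrite /GRing.scale /=.
  by ring.
have icos := integrable_scalel a (integrable_cos_pdf a b).
have isin := integrable_sin_pdf a b.
have idF : mu.-integrable setT (EFin \o dF a b).
  by rewrite /dF /comp; under eq_fun do rewrite EFinB; exact: integrableB.
suff : \int[mu]_x dF a b x = 0.
  rewrite /dF RintegralB// => /eqP; rewrite subr_eq0 => /eqP <-.
  by rewrite RintegralZl//; exact: integrable_cos_pdf.
have cF : continuous F.
  by move=> x; apply: differentiable_continuous; apply/derivable1_diffP; have [] := DF x.
have cdF : continuous (dF a b).
  have cl : continuous (fun x => a * x + b).
    by move=> x; apply: cvgD; [apply: cvgMr; exact: cvg_id|exact: cvg_cst].
  move=> x; apply: cvgB; last first.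
    apply: cvgM; last exact: continuous_std_pdf.
    apply: cvgM; first exact: cvg_id.
    by apply: continuous_comp; [exact: cl|exact: continuous_sin].
  apply: cvgMr; apply: cvgM; last exact: continuous_std_pdf.
  by apply: continuous_comp; [exact: cl|exact: continuous_cos].
pose I (n : nat) : set R := `[- n.+1%:R, n.+1%:R]%classic.
have mI n : measurable (I n) by exact: measurable_itv.
have FTC n : \int[mu]_(x in I n) (dF a b x) = F n.+1%:R - F (- n.+1%:R).
  rewrite /Rintegral (@continuous_FTC2 _ _ F)//.
  - by rewrite gtrN.
  - exact: continuous_subspaceT.
  - split.
    + by move=> x _; have [] := DF x.
    + by apply: cvg_at_right_filter; exact: cF.
    + by apply: cvg_at_left_filter; exact: cF.
  - by move=> x _; rewrite derive1E; have [_ ->] := DF x.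
have c0 : \int[mu]_(x in I n) (dF a b x) @[n --> \oo] --> (0 : R).
  under eq_fun do rewrite FTC.
  have p0 : 2 * std_pdf n.+1%:R @[n --> \oo] --> (0 : R).
    rewrite -[X in _ --> X](mulr0 2); apply: cvgM; first exact: cvg_cst.
    by rewrite (cvg_shiftS (fun n => std_pdf n%:R)); exact: std_pdf_cvg0.
  have np0 : - (2 * std_pdf n.+1%:R) @[n --> \oo] --> (0 : R).
    by rewrite -oppr0; exact: cvgN.
  apply: (squeeze_cvgr _ np0 p0); apply: nearW => n.
  have Fle x : `|F x| <= std_pdf x.
    rewrite normrM (ger0_norm (std_pdf_ge0 _)) ler_piMl ?std_pdf_ge0//.
    by rewrite ler_norml sin_geN1 sin_le1.
  have := Fle n.+1%:R; have := Fle (- n.+1%:R); rewrite std_pdfN !ler_norml.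
  by move=> /andP[? ?] /andP[? ?]; apply/andP; split; lra.
have c1 : \int[mu]_(x in I n) (dF a b x) @[n --> \oo] --> \int[mu]_x dF a b x.
  have [] := @dominated_convergence _ _ _ mu setT measurableT
    (fun n x => ((dF a b \_ (I n)) x)%:E) (EFin \o dF a b) (abse \o (EFin \o dF a b)).
  - move=> n; apply/measurable_EFinP.
    apply/(measurable_restrictT _ (mI n)).
    by apply: measurable_funTS; apply: continuous_measurable_fun.
  - by apply/measurable_EFinP; apply: continuous_measurable_fun.
  - apply: aeW => x _; apply: cvg_EFin; first exact: nearW.
    apply: cvg_near_cst; near=> n => /=.
    rewrite patchE mem_set// /I /= in_itv/= -ler_norml.
    apply: (@le_trans _ _ n%:R); last by rewrite ler_nat.
    by near: n; exact: nbhs_infty_ger.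
  - exact: integrable_norm.
  - apply: aeW => x n _ /=; rewrite lee_fin patchE; case: ifP => // _.
    by rewrite normr0.
  move=> _ _ h; under eq_fun do rewrite Rintegral_mkcond.
  apply: fine_cvg.
  rewrite fineK; last exact: integrable_fin_num.
  exact: h.
exact: cvg_unique c1 c0.
Unshelve. all: end_near. Qed.

(** As a function of a, the integral solves phi' = - a phi, by differentiation under the integral
    sign and [Rintegral_sin_pdf]. Hence phi(a) exp(a^2/2) is constant, equal to its value cos b at
    0. *)
Lemma Rintegral_cos_pdf a b : \int[mu]_x (cos (a * x + b) * std_pdf x) =
  expR (- (a ^+ 2 / 2)) * cos b.
Proof.
pose phi a := \int[mu]_x (cos (a * x + b) * std_pdf x).
have Dphi (u : R) : is_derive u 1 phi (- u * phi u).
  have D1 (y v : R) :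
      is_derive v 1 (fun v => cos (v * y + b) * std_pdf y) (- (y * sin (v * y + b) * std_pdf y)).
    by apply: is_derive_eq; rewrite /GRing.scale /=; ring.
  have E (y v : R) : partial1of2 (fun v y => cos (v * y + b) * std_pdf y) v y =
      - (y * sin (v * y + b) * std_pdf y).
    by rewrite /partial1of2 derive1E; have [_ ->] := D1 y v.
  have uI : `]u - 1, u + 1[%classic u by rewrite /= in_itv/=; apply/andP; split; lra.
  have H1 v : `]u - 1, u + 1[%classic v -> mu.-integrable setT
      (EFin \o (fun y => cos (v * y + b) * std_pdf y)).
    by move=> _; exact: integrable_cos_pdf.
  have H2 (v y : R) : `]u - 1, u + 1[%classic v -> [set: R] y ->
      derivable (fun v : R => cos (v * y + b) * std_pdf y) v 1.
    by move=> _ _; have [] := D1 y v.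
  have H3 (y : R) : 0 <= `|y| * std_pdf y by rewrite mulr_ge0// std_pdf_ge0.
  have H4 (v y : R) : `]u - 1, u + 1[%classic v -> [set: R] y ->
      `|partial1of2 (fun v y => cos (v * y + b) * std_pdf y) v y| <= `|y| * std_pdf y.
    move=> _ _; rewrite E normrN 2!normrM (ger0_norm (std_pdf_ge0 _)).
    rewrite ler_wpM2r ?std_pdf_ge0// ler_piMr// ler_norml.
    by rewrite sin_geN1 sin_le1.
  have := derivable_under_integral measurableT uI H1 H2 H3 integrable_norm_std_pdf H4.
  have := differentiation_under_integral measurableT uI H1 H2 H3 integrable_norm_std_pdf H4.
  rewrite derive1E => e d; apply: DeriveDef => //.
  rewrite [LHS]e; under eq_Rintegral do rewrite E -mulN1r.
  rewrite RintegralZl//; last exact: integrable_sin_pdf.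
  by rewrite Rintegral_sin_pdf mulN1r mulNr.
pose psi u := phi u * expR (u ^+ 2 / 2).
have Dpsi (u : R) : is_derive u 1 psi 0.
  have := Dphi u => ?.
  by apply: is_derive_eq; rewrite /GRing.scale /=; field.
have : psi a = psi 0 by exact: is_derive_0_is_cst.
rewrite /psi expr0n/= mul0r expR0 mulr1 => e.
rewrite expRN [RHS]mulrC; apply: (canRL (mulfK _)); first by rewrite gt_eqF// expR_gt0.
rewrite [LHS]e /phi.
under eq_Rintegral do rewrite mul0r add0r.
rewrite RintegralZl//; last exact: integrable_std_pdf.
by rewrite std_pdfE /Rintegral integral_normal_pdf mulr1.
Qed.

End normal_cos.

(** * Change of variables with a density *)

Section weighted_pushforward.
Import HBNNSimple.
Local Open Scope ereal_scope.
Context {R : realType} d1 d2 (O : measurableType d1) (T : measurableType d2).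
Variables (m : {measure set O -> \bar R}) (nu : {measure set T -> \bar R}).
Variables (X : O -> T) (eta : O -> R).
Hypotheses (mX : measurable_fun setT X) (meta : measurable_fun setT eta).
Hypothesis eta0 : forall t, (0 <= eta t)%R.
Hypothesis nuE : forall S, measurable S ->
  \int[m]_(t in X @^-1` S) (eta t)%:E = nu S.

(** Here [nu] is the image under [X] of the measure with density [eta]. One statement serves
    densities ([X] the identity), laws ([eta] equal to 1) and independent weights. *)
Lemma ge0_integral_weighted_pushforward (h : T -> \bar R) :
  measurable_fun setT h -> (forall y, 0 <= h y) ->
  \int[m]_t (h (X t) * (eta t)%:E) = \int[nu]_y h y.
Proof.
move=> mh h0.
pose g := nnsfun_approx measurableT mh.
have hE y : h y = lim ((g n y)%:E @[n --> \oo]).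
  by apply/esym/cvg_lim => //; apply: cvg_nnsfun_approx.
have -> : \int[nu]_y h y = lim (\int[nu]_y (g n y)%:E @[n --> \oo]).
  under eq_integral do rewrite hE.
  apply: monotone_convergence => //.
  - by move=> n; exact/measurable_EFinP.
  - by move=> n x _ /=; rewrite lee_fin.
  - by move=> x _ a b ab; rewrite lee_fin; exact/lefP/nd_nnsfun_approx.
have mgX n : measurable_fun setT (fun t => g n (X t)).
  by apply: measurableT_comp.
have -> : \int[m]_t (h (X t) * (eta t)%:E) =
    lim (\int[m]_t ((g n (X t))%:E * (eta t)%:E) @[n --> \oo]).
  have hgE t : h (X t) * (eta t)%:E = lim ((g n (X t))%:E * (eta t)%:E @[n --> \oo]).
    by apply/esym/cvg_lim => //; apply: cvgeZr => //; apply: cvg_nnsfun_approx.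
  under eq_integral do rewrite hgE.
  apply: monotone_convergence => //.
  - by move=> n; apply: emeasurable_funM; exact/measurable_EFinP.
  - by move=> n x _ /=; rewrite mule_ge0 ?lee_fin.
  - move=> x _ a b ab; rewrite lee_wpmul2r ?lee_fin//.
    exact/lefP/nd_nnsfun_approx.
suff suf n : \int[m]_t ((g n (X t))%:E * (eta t)%:E) = \int[nu]_y (g n y)%:E.
  by under eq_fun do rewrite suf.
transitivity (\int[nu]_y
   (\sum_(r \in range (g n)) (r * \1_(g n @^-1` [set r]) y)%:E)); last first.
  by apply: eq_integral => y _; rewrite /= [in RHS]fimfunE -fsumEFin.
have mind r : measurable_fun setT (fun y => (r * \1_(g n @^-1` [set r]) y)%:E).
  by apply/measurable_EFinP; exact: measurable_funM.
rewrite ge0_integral_fsum//; last by move=> r y _; exact: nnfun_muleindic_ge0.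
transitivity (\int[m]_t (\sum_(r \in range (g n))
    (r * \1_(g n @^-1` [set r]) (X t))%:E * (eta t)%:E)).
  apply: eq_integral => t _.
  rewrite -ge0_mule_fsuml => [|r]; last exact: nnfun_muleindic_ge0.
  by rewrite fsumEFin // -(fimfunE _ (X t)).
rewrite ge0_integral_fsum//; last 2 first.
  - move=> r; apply: emeasurable_funM; last exact/measurable_EFinP.
    exact: (measurableT_comp (mind r) mX).
  - by move=> r t _; apply: mule_ge0; [exact: nnfun_muleindic_ge0|rewrite lee_fin].
apply: eq_fsbigr => r rg.
have r0 : (0 <= r)%R by move: rg => /set_mem [y _ <-].
under [RHS]eq_integral do rewrite EFinM.
rewrite integralZl_indic_nnsfun => //.
under eq_integral do rewrite EFinM -muleA.
rewrite ge0_integralZl//.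
- rewrite integral_indic// setIT -nuE//; congr (_ * _).
  rewrite [RHS]integral_mkcond; apply: eq_integral => t _.
  rewrite epatch_indic muleC; congr (_ * _).
- apply: emeasurable_funM; last exact/measurable_EFinP.
  apply/measurable_EFinP; exact: measurableT_comp.
- by move=> t _; rewrite mule_ge0 ?lee_fin.
Qed.

End weighted_pushforward.

Section bounded_weighted_pushforward.
Context {R : realType} d1 d2 (O : measurableType d1) (T : measurableType d2).
Variables (m : {measure set O -> \bar R}) (nu : {finite_measure set T -> \bar R}).
Variables (X : O -> T) (eta : O -> R).
Hypotheses (mX : measurable_fun setT X).
Hypothesis ieta : m.-integrable setT (EFin \o eta).
Hypothesis eta0 : forall t, 0 <= eta t.
Hypothesis nuE : forall S, measurable S ->
  (\int[m]_(t in X @^-1` S) (eta t)%:E)%E = nu S.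

Lemma Rintegral_weighted_pushforward (h : T -> R) (M : R) :
  measurable_fun setT h -> (forall y, `|h y| <= M) ->
  \int[m]_t (h (X t) * eta t) = \int[nu]_y h y.
Proof.
move=> mh hM.
have meta : measurable_fun setT eta.
  by apply/measurable_EFinP; exact: measurable_int ieta.
have H (k : T -> R) : measurable_fun setT k -> (forall y, 0 <= k y) ->
    \int[m]_t (k (X t) * eta t) = \int[nu]_y k y.
  move=> mk k0; congr fine.
  rewrite -(ge0_integral_weighted_pushforward mX meta eta0 nuE)//.
    exact/measurable_EFinP. 
have M0 : 0 <= M by apply: le_trans (hM point).
have hM0 y : 0 <= h y + M by rewrite -lerBlDr sub0r; have := hM y; rewrite ler_norml => /andP[].
(* The nonnegative case is applied to h + M, and the contribution of the constant M cancels. *)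
have := H (fun y => h y + M) (measurable_funD mh (measurable_cst _)) hM0.
have inuh : nu.-integrable setT (EFin \o h).
  apply: measurable_bounded_integrable => //; first by rewrite ltey_eq fin_num_measure.
  by exists M; split; [exact: num_real|] => x Mx y _; apply: le_trans (hM y) (ltW Mx).
have inuM : nu.-integrable setT (EFin \o cst M) by exact: finite_measure_integrable_cst.
rewrite RintegralD//.
under eq_Rintegral do rewrite mulrDl.
have iM : m.-integrable setT (EFin \o (fun t => M * eta t)).
  by rewrite /comp; under eq_fun do rewrite EFinM; exact: integrableZl.
rewrite RintegralD//; last first.
  apply: (@le_integrable _ _ _ m setT measurableT _ (EFin \o (fun t => M * eta t))) => //.
    apply/measurable_EFinP; apply: measurable_funM => //.
    exact: (measurableT_comp mh mX).
  move=> t _ /=; rewrite lee_fin !normrM ler_wpM2r// (le_trans (hM _))//.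
  by rewrite ler_norm.
have -> : \int[m]_t (M * eta t) = \int[nu]_y (cst M y) by rewrite -(H (cst M)).
by move/addIr.
Qed.

End bounded_weighted_pushforward.

Section normal_rv.
Context {R : realType} d (O : measurableType d) (P : probability O R).

Lemma Rintegral_cos_normal (U : {RV P >-> R}) (a b : R) :
  same_law (distribution P U) (normal_prob 0 1) ->
  \int[P]_t cos (a * U t + b) = expR (- (a ^+ 2 / 2)) * cos b.
Proof.
move=> UN.
have cos_le (x : R) : `|cos x| <= 1 by rewrite ler_norml cos_geN1 cos_le1.
rewrite -(Rintegral_cos_pdf a b).
rewrite (@Rintegral_weighted_pushforward _ _ _ _ _ lebesgue_measure
  (normal_prob 0 1) id std_pdf _ _ _ _ (fun x => cos (a * x + b)) 1)//.
- have := @Rintegral_weighted_pushforward _ _ _ _ _ P (normal_prob 0 1) U (cst 1)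
    _ _ _ _ (fun x => cos (a * x + b)) 1.
  move=> <-//.
  + by apply: eq_Rintegral => t _; rewrite mulr1.
  + exact: (@measurable_funP _ _ _ _ setT U).
  + exact: (finite_measure_integrable_cst P 1 measurableT).
  + by move=> S mS; rewrite /= integral_cst ?mul1e -?UN// -[X in measurable X]setTI; exact: (@measurable_funP _ _ _ _ setT U).
  + exact: measurable_cos_affine.
- exact: integrable_std_pdf.
- exact: std_pdf_ge0.
- by move=> S mS; rewrite std_pdfE.
- exact: measurable_cos_affine.
Qed.

End normal_rv.

Section independence.
Context {R : realType} d (O : measurableType d) (P : probability O R).
Context d' (T : measurableType d').

(** The last hypothesis says that the conditional mean of [eta] given [X] is the constant [kappa];
    the conclusion extends it from events to bounded functions of [X]. *)
Lemma Rintegral_indep_weight (X : O -> T) (eta : O -> R) (M kappa : R) :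
  measurable_fun setT X -> measurable_fun setT eta ->
  (forall t, 0 <= eta t <= M) -> 0 <= kappa ->
  (forall S, measurable S ->
     (\int[P]_(t in X @^-1` S) (eta t)%:E)%E = (kappa%:E * P (X @^-1` S))%E) ->
  forall (h : T -> R) (B : R), measurable_fun setT h -> (forall y, `|h y| <= B) ->
  \int[P]_t (h (X t) * eta t) = kappa * \int[P]_t h (X t).
Proof.
move=> mX meta etaM k0 H h B mh hB.
have eta0 t : 0 <= eta t by have /andP[] := etaM t.
have ik (k : T -> R) C : measurable_fun setT k -> (forall y, `|k y| <= C) ->
    P.-integrable setT (EFin \o (k \o X)).
  by move=> mk kC; apply: (@bounded_integrable _ _ _ P _ C); [exact: (measurableT_comp mk mX)|move=> t; exact: kC].
have ie : P.-integrable setT (EFin \o eta).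
  by apply: (@bounded_integrable _ _ _ P _ M) => // t; rewrite ger0_norm//; have /andP[] := etaM t.
have k1 : 0 < kappa + 1 by rewrite ltr_wpDl.
(* The weighted image of P under [X] with weight [eta1] is exactly the law of [X]. Adding 1 before
   normalising avoids a division by [kappa], which may be 0. *)
pose eta1 t := (kappa + 1)^-1 * (eta t + 1).
have ie1 : P.-integrable setT (EFin \o eta1).
  apply: (@bounded_integrable _ _ _ P _ ((kappa + 1)^-1 * (M + 1))).
    by apply: measurable_funM => //; exact: measurable_funD.
  move=> t; rewrite normrM gtr0_norm ?invr_gt0// ler_wpM2l ?invr_ge0 ?(ltW k1)//.
  by rewrite ger0_norm ?addr_ge0// lerD2r; have /andP[] := etaM t.
have mXS S : measurable S -> measurable (X @^-1` S).
  by move=> mS; rewrite -[X in measurable X]setTI; exact: mX.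
have := @Rintegral_weighted_pushforward _ _ _ _ _ P
  (distribution P (mfun_Sub (mem_set mX))) X eta1 mX ie1 _ _ h B mh hB.
have -> : \int[distribution P (mfun_Sub (mem_set mX))]_y h y = \int[P]_t h (X t).
  congr fine; rewrite integral_pushforward//; first exact/measurable_EFinP.
  exact: ik hB.
have ihe : P.-integrable setT (EFin \o (fun t => h (X t) * eta t)).
  apply: (@bounded_integrable _ _ _ P _ (B * M)).
    by apply: measurable_funM => //; exact: (measurableT_comp mh mX).
  by move=> t; rewrite normrM ler_pM// ger0_norm//; have /andP[] := etaM t.
have -> : \int[P]_t (h (X t) * eta1 t) =
    (kappa + 1)^-1 * (\int[P]_t (h (X t) * eta t) + \int[P]_t h (X t)).
  rewrite -RintegralD//; last exact: ik hB.
  rewrite -RintegralZl//; last first.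
    rewrite /comp; under eq_fun do rewrite EFinD; apply: integrableD => //; exact: ik hB.
  by apply: eq_Rintegral => t _; rewrite /eta1; ring.
move=> E.
suff E1 : (kappa + 1)^-1 * (\int[P]_t (h (X t) * eta t) + \int[P]_t h (X t)) =
    \int[P]_t h (X t).
  have := congr1 ( *%R (kappa + 1)) E1; rewrite mulVKf ?gt_eqF// mulrDl mul1r.
  by move/addIr.
apply: E.
- by move=> t; rewrite mulr_ge0 ?invr_ge0 ?(ltW k1)// addr_ge0.
- move=> S mS; rewrite /eta1.
  under eq_integral do rewrite EFinM EFinD.
  rewrite ge0_integralZl//; [|exact: mXS|..]; last first.
  - by rewrite lee_fin invr_ge0 ltW.
  - by move=> t _; rewrite lee_fin addr_ge0.
  - by apply/measurable_EFinP; apply: measurable_funTS; exact: measurable_funD.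
  rewrite ge0_integralD//; [|exact: mXS|..].
  + rewrite H// integral_cst ?mul1e; last exact: mXS.
    rewrite -[X in (_ + X)%E]mul1e -ge0_muleDl ?lee_fin// muleA -EFinD -EFinM mulVf ?gt_eqF// mul1e.
    by [].
  + by move=> t _; rewrite lee_fin.
  + by apply/measurable_EFinP; apply: measurable_funTS.
Qed.

End independence.

(** * Cosine transform of a sum of independent terms *)

Section cos_of_independent_sum.
Context {R : realType} d (O : measurableType d) (P : probability O R).
Context d' (T : measurableType d') (I : choiceType).
Variables (X : I -> {RV P >-> T}) (phi : I -> T -> R) (e : I -> R).
Hypothesis indX : mutually_independent X.
Hypothesis mphi : forall i, measurable_fun setT (phi i).
Hypothesis cosX : forall i b, \int[P]_t cos (phi i (X i t) + b) = e i * cos b.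

Lemma mutually_independent_seq (s : seq I) (S : I -> set T) : uniq s ->
  (forall i, measurable (S i)) ->
  P (\bigcap_(i in [set` s]) (X i @^-1` S i)) = (\prod_(i <- s) P (X i @^-1` S i))%E.
Proof.
move=> us mS; have := indX [fset i in s]%fset mS.
rewrite (_ : [set` [fset i in s]%fset] = [set` s]); last first.
  by apply/seteqP; split => i /=; rewrite !inE.
move=> ->; apply: perm_big; apply: uniq_perm => //.
by move=> i; rewrite !inE.
Qed.

Let E (s : seq I) (S : I -> set T) : set O := \bigcap_(i in [set` s]) (X i @^-1` S i).

Let mE s S : (forall i, measurable (S i)) -> measurable (E s S).
Proof.
move=> mS; apply: fin_bigcap_measurable; first exact: finite_seq.
by move=> i _; rewrite -[X in measurable X]setTI; exact: (@measurable_funP _ _ _ _ setT (X i)).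
Qed.

Let V (l : seq I) (b : R) t : R := \sum_(i <- l) phi i (X i t) + b.

Let mV l b : measurable_fun setT (V l b).
Proof.
apply: measurable_funD => //; apply: measurable_sum => i.
exact: (measurableT_comp (mphi i) (@measurable_funP _ _ _ _ setT (X i))).
Qed.

Let mcosV l b : measurable_fun setT (fun t => cos (V l b t)).
Proof.
apply: (measurableT_comp _ (mV l b)).
by apply: continuous_measurable_fun; exact: continuous_cos.
Qed.

Let cos_le (x : R) : `|cos x| <= 1.
Proof. by rewrite ler_norml cos_geN1 cos_le1. Qed.

Let sin_le (x : R) : `|sin x| <= 1.
Proof. by rewrite ler_norml sin_geN1 sin_le1. Qed.

(** The event on the indices in [s] strengthens the induction on [l]. To split off the term of index
    c, the remaining factor must have a constant conditional mean given [X c], which means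
    integrating it over events on [X c]; such an event is absorbed into [s] ([EcS]). *)
Let claim (l s : seq I) (S : I -> set T) (b : R) : uniq (l ++ s) ->
  (forall i, measurable (S i)) ->
  \int[P]_t (\1_(E s S) t * cos (V l b t)) =
  fine (P (E s S)) * (\prod_(i <- l) e i) * cos b.
Proof.
elim: l s S b => [|c l IH] s S b.
  rewrite cat0s => us mS; rewrite big_nil mulr1 /V.
  under eq_Rintegral do rewrite big_nil add0r.
  rewrite RintegralZr//; last first.
    apply: (@bounded_integrable _ _ _ P _ 1).
      exact: measurable_indic (mE s mS).
    by move=> t; rewrite indicE; case: (_ \in _); rewrite ?normr0 ?normr1.
  by congr (_ * _); rewrite /Rintegral integral_indic ?setIT//; exact: mE.
move=> us mS.
have ucs : uniq (l ++ c :: s) by move: us; rewrite -cat_rcons -cats1 -catA uniq_catCA.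
have us' : uniq (c :: s) by move: ucs; rewrite cat_uniq => /and3P[].
have uls : uniq (l ++ s) by move: us => /= /andP[].
have mPE s' S' : (forall i, measurable (S' i)) -> P (E s' S') \is a fin_num.
  by move=> mS'; apply: fin_num_measure; exact: mE.
pose pr := \prod_(i <- l) e i.
pose ES t : R := \1_(E s S) t.
have ES01 t : 0 <= ES t <= 1.
  by rewrite /ES indicE; case: (_ \in _); rewrite ?lexx ?ler01.
have mES : measurable_fun setT ES by exact: measurable_indic (mE s mS).
have mXc : measurable_fun setT (X c) by exact: (@measurable_funP _ _ _ _ setT (X c)).
have EcS U : measurable U -> exists S', [/\ (forall i, measurable (S' i)),
    forall t, \1_(E (c :: s) S') t = \1_(X c @^-1` U) t * ES t :> R &
    P (E (c :: s) S') = (P (X c @^-1` U) * P (E s S))%E].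
  move=> mU; pose S' i := if i == c then U else S i.
  have S's i : i \in s -> S' i = S i.
    by move=> is_; rewrite /S'; case: eqP => // ic; move: us' is_; rewrite /= ic => /andP[/negP].
  have mS' i : measurable (S' i) by rewrite /S'; case: ifP.
  have EE : E (c :: s) S' = X c @^-1` U `&` E s S.
    apply/seteqP; split => t /=.
      move=> H; split; first by have := H c; rewrite /= /S' eqxx; apply; rewrite inE eqxx.
      by move=> i /= is_; rewrite -(S's i is_); apply: H; rewrite /= inE is_ orbT.
    move=> [H1 H2] i /=; rewrite inE => /predU1P[->|is_]; first by rewrite /S' eqxx.
    by rewrite /= (S's i is_); exact: H2.
  exists S'; split => //.
    by move=> t; rewrite EE indicI.
  rewrite /E !mutually_independent_seq//; last by case/andP: us'.
  rewrite big_cons {1}/S' eqxx; congr (_ * _)%E.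
  by rewrite big_seq [RHS]big_seq; apply: eq_bigr => i is_; rewrite S's.
have iE s' S' : (forall i, measurable (S' i)) -> P.-integrable setT (EFin \o (\1_(E s' S') : O -> R)).
  move=> mS'; apply: (@bounded_integrable _ _ _ P _ 1); first exact: measurable_indic (mE s' mS').
  by move=> t; rewrite indicE; case: (_ \in _); rewrite ?normr0 ?normr1.
have iEc s' S' b' : (forall i, measurable (S' i)) ->
    P.-integrable setT (EFin \o (fun t => \1_(E s' S') t * cos (V l b' t))).
  move=> mS'; apply: (@bounded_integrable _ _ _ P _ 1).
    by apply: measurable_funM => //; exact: measurable_indic (mE s' mS').
  move=> t; rewrite normrM mulr_ile1// indicE.
  by case: (_ \in _); rewrite ?normr0 ?normr1.
have IE s' S' : (forall i, measurable (S' i)) ->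
    \int[P]_t (\1_(E s' S') t) = fine (P (E s' S')).
  by move=> mS'; rewrite /Rintegral integral_indic ?setIT//; exact: mE.
have ES1 U (eta : O -> R) : measurable U -> P.-integrable setT (EFin \o eta) ->
    (\int[P]_(t in X c @^-1` U) (eta t)%:E)%E = (\int[P]_t (\1_(X c @^-1` U) t * eta t))%:E.
  move=> mU ie.
  have mXU : measurable (X c @^-1` U) by rewrite -[X in measurable X]setTI; exact: mXc.
  rewrite integral_mkcond EFin_Rintegral; last first.
    apply: (@le_integrable _ _ _ P setT measurableT _ (EFin \o eta)) => //.
      apply/measurable_EFinP; apply: measurable_funM; first exact: measurable_indic.
      by apply/measurable_EFinP; exact: measurable_int ie.
    move=> t _ /=; rewrite lee_fin normrM ler_piMl// indicE.
    by case: (_ \in _); rewrite ?normr0 ?normr1.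
  apply: eq_integral => t _; rewrite patchE indicE.
  by case: (_ \in _); rewrite ?mul1r ?mul0r.
(* [Rintegral_indep_weight] wants a nonnegative weight, so the signed weight ES * cos V is written
   as the difference of ES + ES * cos V and ES. *)
have key b' (h : R -> R) : measurable_fun setT h -> (forall y, `|h y| <= 1) ->
    \int[P]_t (h (phi c (X c t)) * (ES t * cos (V l b' t))) =
    fine (P (E s S)) * pr * cos b' * \int[P]_t h (phi c (X c t)).
  move=> mh hB.
  have mhp : measurable_fun setT (h \o phi c) by exact: measurableT_comp.
  pose k1 := fine (P (E s S)) * (1 + pr * cos b').
  pose eta1 t := ES t + ES t * cos (V l b' t).
  have ieta1 : P.-integrable setT (EFin \o eta1).
    by rewrite /comp /eta1; under eq_fun do rewrite EFinD; apply: integrableD => //; [exact: iE|exact: iEc].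
  have eta1_ge0 t : 0 <= eta1 t <= 2.
    rewrite /eta1; have /andP[h0 h1] := ES01 t; have := cos_le (V l b' t).
    by rewrite ler_norml => /andP[? ?]; apply/andP; split; nra.
  have Ieta1 : \int[P]_t eta1 t = k1.
    rewrite /eta1 RintegralD//; [|exact: iE|exact: iEc].
    by rewrite (IH _ _ b' uls mS) IE// /k1 /pr; ring.
  have H1 : \int[P]_t (h (phi c (X c t)) * eta1 t) = k1 * \int[P]_t h (phi c (X c t)).
    apply: (@Rintegral_indep_weight _ _ _ P _ T (X c) eta1 2 k1 mXc _ eta1_ge0 _ _ (h \o phi c) 1 mhp (fun y => hB (phi c y))) => //.
    - by apply/measurable_EFinP; exact: measurable_int ieta1.
    - by rewrite -Ieta1; apply: Rintegral_ge0 => t _; have /andP[] := eta1_ge0 t.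
    move=> U mU; rewrite ES1//; have [S' [mS' E1 E2]] := EcS U mU.
    have PU : P (X c @^-1` U) \is a fin_num.
      by apply: fin_num_measure; rewrite -[X in measurable X]setTI; exact: mXc.
    rewrite -(fineK PU) -EFinM; congr EFin.
    transitivity (\int[P]_t (\1_(E (c :: s) S') t + \1_(E (c :: s) S') t * cos (V l b' t))).
      by apply: eq_Rintegral => t _; rewrite E1 /eta1; ring.
    rewrite RintegralD//; [|exact: iE|exact: iEc].
    by rewrite (IH _ _ b' ucs mS') IE// E2 fineM ?mPE// /k1 /pr; ring.
  have H2 : \int[P]_t (h (phi c (X c t)) * ES t) =
      fine (P (E s S)) * \int[P]_t h (phi c (X c t)).
    apply: (@Rintegral_indep_weight _ _ _ P _ T (X c) ES 1 _ mXc mES ES01 _ _ (h \o phi c) 1 mhp (fun y => hB (phi c y))) => //.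
    by rewrite fine_ge0. move=> U mU; rewrite ES1//; last exact: iE.
    have [S' [mS' E1 E2]] := EcS U mU.
    have PU : P (X c @^-1` U) \is a fin_num.
      by apply: fin_num_measure; rewrite -[X in measurable X]setTI; exact: mXc.
    rewrite -(fineK PU) -EFinM; congr EFin.
    transitivity (\int[P]_t (\1_(E (c :: s) S') t)).
      by apply: eq_Rintegral => t _; rewrite E1.
    by rewrite IE// E2 fineM ?mPE// mulrC.
  have ib (eta : O -> R) : P.-integrable setT (EFin \o eta) ->
      P.-integrable setT (EFin \o (fun t => h (phi c (X c t)) * eta t)).
    move=> ie; apply: (@le_integrable _ _ _ P setT measurableT _ (EFin \o eta)) => //.
      apply/measurable_EFinP; apply: measurable_funM; first exact: (measurableT_comp mhp mXc).
      by apply/measurable_EFinP; exact: measurable_int ie.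
    by move=> t _ /=; rewrite lee_fin normrM ler_piMl.
  transitivity (\int[P]_t (h (phi c (X c t)) * eta1 t - h (phi c (X c t)) * ES t)).
    by apply: eq_Rintegral => t _; rewrite /eta1; ring.
  by rewrite RintegralB//; [rewrite H1 H2 /k1; ring|exact: ib|apply: ib; exact: iE].
have e1 : \int[P]_t cos (phi c (X c t)) = e c.
  by rewrite -[RHS]mulr1 -cos0 -cosX; apply: eq_Rintegral => t _; rewrite addr0.
(* Phase -pi/2 in [cosX] shows that each term has sine mean 0; only the product of the cosines then
   survives in the addition formula. *)
have sinE (x : R) : sin x = cos (x + - (pi / 2)) by rewrite cosB cos_pihalf sin_pihalf; ring.
have e0 : \int[P]_t sin (phi c (X c t)) = 0.
  under eq_Rintegral do rewrite sinE.
  by rewrite cosX cosN cos_pihalf mulr0.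
transitivity (\int[P]_t (cos (phi c (X c t)) * (ES t * cos (V l b t)) -
    sin (phi c (X c t)) * (ES t * cos (V l (b - pi / 2) t)))).
  apply: eq_Rintegral => t _.
  have -> : V (c :: l) b t = phi c (X c t) + V l b t by rewrite /V big_cons addrA.
  have -> : V l (b - pi / 2) t = V l b t + - (pi / 2) by rewrite /V addrA.
  by rewrite -sinE cosD /ES; ring.
have ib (h : R -> R) b' : measurable_fun setT h -> (forall y, `|h y| <= 1) ->
    P.-integrable setT (EFin \o (fun t => h (phi c (X c t)) * (ES t * cos (V l b' t)))).
  move=> mh h1; apply: (@le_integrable _ _ _ P setT measurableT _ (EFin \o (fun t => ES t * cos (V l b' t)))) => //; last exact: iEc.
    apply/measurable_EFinP; apply: measurable_funM; last exact: measurable_funM.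
    exact: (measurableT_comp (measurableT_comp mh (mphi c)) mXc).
  by move=> t _ /=; rewrite lee_fin normrM ler_piMl.
have mcos : measurable_fun setT (@cos R) by apply: continuous_measurable_fun; exact: continuous_cos.
have msin : measurable_fun setT (@sin R) by apply: continuous_measurable_fun; exact: continuous_sin.
rewrite RintegralB//; [|exact: ib|exact: ib].
by rewrite (key b cos)// (key _ sin)// e0 e1 mulr0 subr0 big_cons /pr; ring.
Qed.

Lemma Rintegral_cos_sum (l : seq I) (b : R) : uniq l ->
  \int[P]_t cos (\sum_(i <- l) phi i (X i t) + b) = (\prod_(i <- l) e i) * cos b.
Proof.
move=> ul; have := @claim l [::] (fun=> setT) b.
rewrite cats0 => /(_ ul (fun=> measurableT)).
have -> : E [::] (fun=> setT) = setT by apply/seteqP; split.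
rewrite probability_setT/= mul1r => <-.
by apply: eq_Rintegral => t _; rewrite indicT mul1r.
Qed.

End cos_of_independent_sum.

Section Rintegral_sum.
Context {R : realType} d (T : measurableType d) (P : probability T R).

Lemma Rintegral_sum (J : Type) (s : seq J) (h : J -> T -> R) :
  (forall i, P.-integrable setT (EFin \o h i)) ->
  P.-integrable setT (EFin \o (fun t => \sum_(i <- s) h i t)) /\
  \int[P]_t (\sum_(i <- s) h i t) = \sum_(i <- s) \int[P]_t h i t.
Proof.
move=> ih; elim: s => [|i s [IH1 IH2]].
  rewrite /comp; under eq_fun do rewrite big_nil; under eq_Rintegral do rewrite big_nil.
  rewrite big_nil; split; first exact: (finite_measure_integrable_cst P 0 measurableT).
  by rewrite Rintegral_cst// mul0r.
split.
  rewrite /comp; under eq_fun do rewrite big_cons EFinD.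
  by apply: integrableD => //; exact: ih.
under eq_Rintegral do rewrite big_cons.
by rewrite RintegralD// IH2 big_cons.
Qed.

End Rintegral_sum.

Lemma measurable_expR_scale {R : realType} d (O : measurableType d) (U : O -> R) (c : R) :
  measurable_fun setT U -> measurable_fun setT (fun t => expR (- (c * U t))).
Proof.
move=> mU; under eq_fun do rewrite -mulNr.
apply: (@measurableT_comp _ _ _ _ _ _ expR) => //.
exact: measurable_funM.
Qed.

(** * Laws determined by transforms *)

Section laplace_tail.
Context {R : realType}.

Let ln2_div_ge0 (c : R) : 0 < c -> 0 <= ln 2 / c.
Proof. by move=> c0; rewrite divr_ge0 ?(ltW c0)// ltW// ln_gt0// ltr1n. Qed.

(* The scale [ln 2 / c] puts the transition at u = c, where the base is 1 - 2^-n. *)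
Lemma expR_tail_cvg (u c : R) : 0 <= u -> 0 < c ->
  (1 - expR (- (ln 2 / c * n%:R * u))) ^+ (n * 2 ^ n) @[n --> \oo] -->
  ((c < u)%R%:R : R).
Proof.
move=> u0 c0.
have ln2 : 0 < ln 2 :> R by rewrite ln_gt0// ltr1n.
pose x n := expR (- (ln 2 / c * n%:R * u)).
have x01 n : 0 <= x n <= 1.
  rewrite expR_ge0/= -[leRHS]expR0 ler_expR oppr_le0 mulr_ge0// mulr_ge0//.
  exact: ln2_div_ge0.
have x1 n : 0 <= 1 - x n by rewrite subr_ge0; have /andP[] := x01 n.
(* The exponent times the small quantity [x n] decides the limit: it tends to 0 if u > c and is at
   least n if u <= c. *)
have Mx n : (n * 2 ^ n)%:R * x n = n%:R * expR (n%:R * (ln 2 * (1 - u / c))).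
  rewrite natrM natrX -mulrA; congr (_ * _).
  rewrite -[2 in LHS](@lnK R) ?posrE// -expRM_natl -expRD; congr expR.
  by field; rewrite gt_eqF.
have pow_le n : (1 - x n) ^+ (n * 2 ^ n) <= 1.
  by rewrite exprn_ile1// lerBlDr lerDl; have /andP[] := x01 n.
have [cu|uc] := ltP c u.
  pose dl := ln 2 * (u / c - 1).
  have dl0 : 0 < dl by rewrite mulr_gt0// subr_gt0 ltr_pdivlMr// mul1r.
  have bern (y : R) k : 0 <= y <= 1 -> 1 - k%:R * y <= (1 - y) ^+ k.
    move=> /andP[y0 y1]; elim: k => [|k IH]; first by rewrite mul0r subr0.
    rewrite exprS -natr1.
    have h : (1 - y) * (1 - k%:R * y) <= (1 - y) * (1 - y) ^+ k.
      by rewrite ler_wpM2l// subr_ge0.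
    apply: le_trans h; have : 0 <= k%:R :> R by []. nra.
  have lo : 1 - 2 / dl ^+ 2 * n.+1%:R^-1 @[n --> \oo] --> (1 : R).
    rewrite -[X in _ --> X]subr0; apply: cvgB; first exact: cvg_cst.
    rewrite -[X in _ --> X](mulr0 (2 / dl ^+ 2)); apply: cvgM; first exact: cvg_cst.
    exact: cvg_harmonic.
  have hi : (fun=> 1) @ \oo --> (1 : R) by exact: cvg_cst.
  rewrite -(cvg_shiftS (fun n => (1 - x n) ^+ (n * 2 ^ n))).
  apply: (squeeze_cvgr _ lo hi); apply: nearW => n; rewrite pow_le andbT.
  apply: le_trans (bern _ _ (x01 _)); rewrite lerD2l lerN2 Mx.
  have -> : n.+1%:R * (ln 2 * (1 - u / c)) = - (n.+1%:R * dl) by rewrite /dl; ring.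
  rewrite expRN -/(_ / _) ler_pdivrMr ?expR_gt0//.
  have y0 : 0 <= n.+1%:R * dl by rewrite mulr_ge0// ltW.
  have := expR_ge1Dxn 1 y0.
  have n0 : 0 < n.+1%:R :> R by [].
  rewrite (_ : 2`!%:R = 2 :> R)// => h.
  rewrite -(ler_pM2l (_ : 0 < dl ^+ 2 * n.+1%:R / 2)); last by rewrite divr_gt0// mulr_gt0// exprn_gt0.
  rewrite [leRHS](_ : _ = expR (n.+1%:R * dl)); last by field; rewrite !gt_eqF.
  apply: le_trans h; rewrite [leLHS](_ : _ = (n.+1%:R * dl) ^+ 2 / 2); last by field.
  by rewrite lerDr.
(* The factor n in the exponent matters at u = c: the power is at most exp(-n) for every u <= c, so
   the limit is the indicator of the strict inequality. *)
have hi : n.+1%:R^-1 @[n --> \oo] --> (0 : R) by exact: cvg_harmonic.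
have lo : (fun=> 0) @ \oo --> (0 : R) by exact: cvg_cst.
apply: (squeeze_cvgr _ lo hi); apply: nearW => n; rewrite exprn_ge0 ?x1//=.
have : (1 - x n) ^+ (n * 2 ^ n) <= expR (- x n) ^+ (n * 2 ^ n).
  by rewrite lerXn2r ?nnegrE ?expR_ge0//; exact: expR_ge1Dx.
move/le_trans; apply; rewrite -expRM_natl mulrN Mx expRN lef_pV2 ?posrE ?expR_gt0//.
rewrite -natr1 addrC; apply: le_trans (expR_ge1Dx _); rewrite lerD2l ler_peMr//.
rewrite -[leLHS]expR0 ler_expR; apply: mulr_ge0 => //; apply: mulr_ge0; first exact: ltW.
by rewrite subr_ge0 ler_pdivrMr// mul1r.
Qed.

(** A polynomial in exp(-mu U) integrates to a combination of values of the Laplace transform. The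
    approximations of tail indicators in [expR_tail_cvg] are of this form. *)
Let powint d (O : measurableType d) (P : probability O R) (U eta : O -> R) :
  measurable_fun setT U -> (forall t, 0 <= U t) ->
  measurable_fun setT eta -> (forall t, 0 <= eta t <= 1) ->
  forall mu : R, 0 <= mu -> forall p : {poly R},
  \int[P]_t (p.[expR (- (mu * U t))] * eta t) =
  \sum_(i < size p) p`_i * \int[P]_t (expR (- (i%:R * mu * U t)) * eta t).
Proof.
move=> mU U0 meta eta01 mu mu0 p.
have ii (i : nat) : P.-integrable setT (EFin \o (fun t => expR (- (i%:R * mu * U t)) * eta t)).
  apply: (@bounded_integrable _ _ _ P _ 1).
    by apply: measurable_funM => //; exact: measurable_expR_scale.
  move=> t; rewrite normrM mulr_ile1// ger0_norm ?expR_ge0//.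
  - by rewrite -[leRHS]expR0 ler_expR oppr_le0 !mulr_ge0.
  - by have /andP[] := eta01 t.
  - by have /andP[] := eta01 t.
transitivity (\int[P]_t \sum_(i < size p) (p`_i * (expR (- (i%:R * mu * U t)) * eta t))).
  apply: eq_Rintegral => t _; rewrite horner_coef mulr_suml; apply: eq_bigr => i _.
  by rewrite -expRM_natl mulrN !mulrA.
have ii' (i : 'I_(size p)) : P.-integrable setT
    (EFin \o (fun t => p`_i * (expR (- (i%:R * mu * U t)) * eta t))).
  exact: integrable_scalel.
rewrite (Rintegral_sum _ ii').2; apply: eq_bigr => i _.
by rewrite RintegralZl.
Qed.

Context d (O : measurableType d) (P : probability O R) (U eta : O -> R).
Context d' (O' : measurableType d') (P' : probability O' R) (U' eta' : O' -> R).
Hypotheses (mU : measurable_fun setT U) (U0 : forall t, 0 <= U t).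
Hypotheses (meta : measurable_fun setT eta) (eta01 : forall t, 0 <= eta t <= 1).
Hypotheses (mU' : measurable_fun setT U') (U'0 : forall t, 0 <= U' t).
Hypotheses (meta' : measurable_fun setT eta') (eta'01 : forall t, 0 <= eta' t <= 1).
Hypothesis laplaceE : forall lambda : R, 0 <= lambda ->
  \int[P]_t (expR (- (lambda * U t)) * eta t) =
  \int[P']_t (expR (- (lambda * U' t)) * eta' t).

Let tail_cvg d0 (O0 : measurableType d0) (P0 : probability O0 R) (V h : O0 -> R) (c : R) :
  measurable_fun setT V -> (forall t, 0 <= V t) ->
  measurable_fun setT h -> (forall t, 0 <= h t <= 1) -> 0 < c ->
  \int[P0]_t ((1 - expR (- (ln 2 / c * n%:R * V t))) ^+ (n * 2 ^ n) * h t) @[n --> \oo] -->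
  \int[P0]_t ((c < V t)%R%:R * h t).
Proof.
move=> mV V0 mh h01 c0; apply: (@Rintegral_dct _ _ _ P0 _ _ 1).
- move=> n; apply: measurable_funM => //; apply: measurable_funX.
  by apply: measurable_funB => //; exact: measurable_expR_scale.
- apply: measurable_funM => //.
  rewrite (_ : (fun t => _) = \1_(V @^-1` `]c, +oo[)).
    by apply: measurable_indic; rewrite -[X in measurable X]setTI; exact: mV.
  apply/funext => t; rewrite indicE.
  suff -> : (t \in V @^-1` `]c, +oo[) = (c < V t) by [].
  by apply/idP/idP; rewrite inE /= in_itv/= andbT.
- move=> n t; rewrite normrM mulr_ile1//; last first.
    by rewrite ger0_norm; have /andP[] := h01 t.
  have x01 : 0 <= expR (- (ln 2 / c * n%:R * V t)) <= 1.
    rewrite expR_ge0/= -[leRHS]expR0 ler_expR oppr_le0 mulr_ge0// mulr_ge0//.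
    exact: ln2_div_ge0.
  by rewrite ger0_norm ?exprn_ge0 ?exprn_ile1//; have /andP[] := x01; lra.
- apply: aeW => t; apply: cvgM; last exact: cvg_cst.
  exact: expR_tail_cvg.
Qed.

(** Tails are limits of means that the Laplace transform determines. The weights allow this
    inversion to be applied to one coordinate after another, the others being kept in [eta] and
    [eta']. *)
Lemma laplace_tail_weighted (c : R) : 0 < c ->
  \int[P]_t ((c < U t)%R%:R * eta t) = \int[P']_t ((c < U' t)%R%:R * eta' t).
Proof.
move=> c0; have := @tail_cvg _ _ P _ _ _ mU U0 meta eta01 c0.
have := @tail_cvg _ _ P' _ _ _ mU' U'0 meta' eta'01 c0.
have E n : \int[P]_t ((1 - expR (- (ln 2 / c * n%:R * U t))) ^+ (n * 2 ^ n) * eta t) =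
    \int[P']_t ((1 - expR (- (ln 2 / c * n%:R * U' t))) ^+ (n * 2 ^ n) * eta' t).
  have mu0 : 0 <= ln 2 / c * n%:R.
    by rewrite mulr_ge0// ln2_div_ge0.
  have pE (x : R) : ((1 - 'X : {poly R}) ^+ (n * 2 ^ n)).[x] = (1 - x) ^+ (n * 2 ^ n).
    by rewrite horner_exp hornerD hornerN hornerX -[1]polyC1 hornerC.
  under eq_Rintegral do rewrite -pE.
  under [RHS]eq_Rintegral do rewrite -pE.
  rewrite (@powint _ _ P _ _ mU U0)// (@powint _ _ P' _ _ mU' U'0)//.
  by apply: eq_bigr => i _; rewrite laplaceE// mulr_ge0.
under eq_fun do rewrite -E.
by move=> h1 h2; apply: cvg_unique h2 h1.
Qed.

End laplace_tail.

(** * Cosine transforms of linear combinations determine the joint law *)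

Section cos_uniqueness.
Context {R : realType} (D : pointedType) (I : eqType) (i0 : I) (xi : I -> D -> R).

(** The generating events are tails of the squares (xi - a)^2, nonnegative variables to which
    [laplace_tail_weighted] applies; the centres a make them generate all half-lines. *)
Definition cyl : set (set D) := [set C | exists l : seq (I * R * R),
  all (fun r => 0 < r.2) l /\
  C = [set x | all (fun r => r.2 < (xi r.1.1 x - r.1.2) ^+ 2) l]].

Notation cylT := (g_sigma_algebraType cyl).

Lemma setI_closed_cyl : setI_closed cyl.
Proof.
move=> _ _ [l [lp ->]] [l' [l'p ->]]; exists (l ++ l'); split.
  by rewrite all_cat lp.
by apply/seteqP; split => x /=; rewrite all_cat => /andP.
Qed.

Lemma measurable_xi i : measurable_fun setT (xi i : cylT -> R).
Proof.
apply: (measurability _ (RGenOInfty.measurableE R)).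
move=> _ [_ [x ->] <-]; rewrite setTI.
(* With centre x - (p+1) and radius p+1, the p-th event says that xi > x or xi < x - 2(p+1); the
   second alternative cannot hold for all p. *)
rewrite (_ : _ @^-1` _ = \bigcap_p [set y : D |
    all (fun r => r.2 < (xi r.1.1 y - r.1.2) ^+ 2) [:: (i, x - p.+1%:R, p.+1%:R ^+ 2)]]).
  apply: bigcap_measurable => // p _; apply: sub_sigma_algebra.
  exists [:: (i, x - p.+1%:R, p.+1%:R ^+ 2)]; split => //=.
  by rewrite andbT exprn_gt0.
apply/seteqP; split => y /=; rewrite in_itv/= andbT => xy.
  move=> p _ /=; rewrite andbT.
  have : 0 < p.+1%:R :> R by []. nra.
rewrite ltNge; apply/negP => yx.
pose p := Num.bound `|x - xi i y|.
have : x - xi i y < p%:R by apply: le_lt_trans (ler_norm _) (archi_boundP _).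
have := xy p Logic.I; rewrite /= andbT -natr1.
have : 0 <= p%:R :> R by []. nra.
Qed.

Context d (O : measurableType d) (P : probability O R) (X : O -> D).
Context d' (O' : measurableType d') (P' : probability O' R) (X' : O' -> D).
Context d'' (O'' : measurableType d'') (P'' : probability O'' R).
Variable w : nat -> {RV P'' >-> R}.
Hypothesis iidw : iid_std_normal w.
Hypotheses (mX : forall i, measurable_fun setT (xi i \o X))
  (mX' : forall i, measurable_fun setT (xi i \o X')).
Hypothesis cosE : forall (l : seq (I * R)) b,
  \int[P]_t cos (\sum_(r <- l) r.2 * xi r.1 (X t) + b) =
  \int[P']_t cos (\sum_(r <- l) r.2 * xi r.1 (X' t) + b).

Let cos_le (x : R) : `|cos x| <= 1.
Proof. by rewrite ler_norml cos_geN1 cos_le1. Qed.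

Let mcos : measurable_fun setT (@cos R).
Proof. by apply: continuous_measurable_fun; exact: continuous_cos. Qed.

(* Gaussian randomisation: exp(-l z^2) is the mean of cos(sqrt(2l) z w), w normal. *)
Let gauss_cos (c : nat -> R) (n : nat) :
  \int[P'']_s cos (\sum_(j < n) c j * w j s) = expR (- \sum_(j < n) c j ^+ 2 / 2).
Proof.
have := @Rintegral_cos_sum _ _ _ P'' _ _ _ w (fun j x => c j * x)
  (fun j => expR (- (c j ^+ 2 / 2))) iidw.1 _ _ (index_iota 0 n) 0.
rewrite cos0 mulr1 => H.
transitivity (\int[P'']_s cos (\sum_(i <- index_iota 0 n) c i * w i s + 0)).
  by apply: eq_Rintegral => s _; rewrite addr0 big_mkord.
rewrite H ?iota_uniq//.
- rewrite -expR_sum big_mkord; congr expR.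
  by rewrite -sumrN.
- by move=> j; exact: measurable_funM.
- by move=> j b; exact: (Rintegral_cos_normal _ _ (iidw.2 j)).
Qed.

Let lap (l : seq (I * R * R)) (x : D) : R :=
  \prod_(r <- l) expR (- (r.2 * (xi r.1.1 x - r.1.2) ^+ 2)).

(** Each factor of [lap] is randomised by its own normal variable and the integrals are exchanged.
    For fixed values of these variables the inner integral is one that [cosE] controls, with the
    centres gathered in the phase. *)
Let lapE d1 (O1 : measurableType d1) (P1 : probability O1 R) (Y : O1 -> D)
  (mY : forall i, measurable_fun setT (xi i \o Y)) (l : seq (I * R * R)) :
  all (fun r => 0 <= r.2) l ->
  let r_ j := nth (i0, 0, 0) l j in
  let c j := Num.sqrt (2 * (r_ j).2) in
  \int[P1]_t lap l (Y t) =
  \int[P'']_s \int[P1]_t cos (\sum_(r <- [seq ((r_ j).1.1, c j * w j s) | j <- iota 0 (size l)])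
     r.2 * xi r.1 (Y t) + (- \sum_(j < size l) c j * w j s * (r_ j).1.2)).
Proof.
move=> lp r_ c.
have -> : \int[P1]_t lap l (Y t) = \int[P1]_t \int[P'']_s
    cos (\sum_(j < size l) c j * (xi (r_ j).1.1 (Y t) - (r_ j).1.2) * w j s).
  apply: eq_Rintegral => t _.
  rewrite (gauss_cos (fun j => c j * (xi (r_ j).1.1 (Y t) - (r_ j).1.2))).
  rewrite /lap (big_nth (i0, 0, 0)) big_mkord -expR_sum -sumrN; congr expR.
  apply: eq_bigr => j _; rewrite -/(r_ j); congr (- _).
  rewrite exprMn sqr_sqrtr; first by field.
  by rewrite mulr_ge0//; move/(all_nthP (i0, 0, 0)) : lp; apply.
pose F (z : O1 * O'') := cos (\sum_(j < size l) c j * (xi (r_ j).1.1 (Y z.1) - (r_ j).1.2) * w j z.2).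
have mF : measurable_fun setT F.
  apply: measurableT_comp => //; apply: measurable_sum => j.
  apply: measurable_funM; last by apply: (measurableT_comp (@measurable_funP _ _ _ _ setT (w j))).
  apply: measurable_funM => //; apply: measurable_funB => //.
  exact: (measurableT_comp (mY _)).
have FM z : `|F z| <= 1 by exact: cos_le.
rewrite -(Rintegral_fubini1 P1 P'' mF FM) (Rintegral_fubini2 P1 P'' mF FM).
apply: eq_Rintegral => s _; apply: eq_Rintegral => t _; congr cos.
rewrite big_map.
rewrite -(big_mkord xpredT (fun j => c j * (xi (r_ j).1.1 (Y t) - (r_ j).1.2) * w j s)).
rewrite -(big_mkord xpredT (fun j => c j * w j s * (r_ j).1.2)) /index_iota subn0.
rewrite -sumrB; apply: eq_bigr => j _ /=; ring.
Qed.

Let lap_eq (l : seq (I * R * R)) : all (fun r => 0 <= r.2) l ->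
  \int[P]_t lap l (X t) = \int[P']_t lap l (X' t).
Proof.
move=> lp; rewrite (lapE P mX lp) (lapE P' mX' lp).
by apply: eq_Rintegral => s _; exact: cosE.
Qed.

Let ind (l : seq (I * R * R)) (x : D) : R :=
  \prod_(r <- l) (r.2 < (xi r.1.1 x - r.1.2) ^+ 2)%R%:R.

Let mind d1 (O1 : measurableType d1) (Y : O1 -> D)
  (mY : forall i, measurable_fun setT (xi i \o Y)) l :
  measurable_fun setT (fun t => ind l (Y t)).
Proof.
apply: measurable_prod => r _.
rewrite (_ : (fun t => _) = \1_((fun t => (xi r.1.1 (Y t) - r.1.2) ^+ 2) @^-1` `]r.2, +oo[)).
  apply: measurable_indic; rewrite -[X in measurable X]setTI.
  have : measurable_fun setT (fun t => (xi r.1.1 (Y t) - r.1.2) ^+ 2).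
    by apply: measurable_funX; apply: measurable_funB => //; exact: mY.
  by apply.
apply/funext => t; rewrite indicE.
suff -> : (t \in (fun t => (xi r.1.1 (Y t) - r.1.2) ^+ 2) @^-1` `]r.2, +oo[) =
  (r.2 < (xi r.1.1 (Y t) - r.1.2) ^+ 2) by [].
by apply/idP/idP; rewrite inE /= in_itv/= andbT.
Qed.

Let msq d1 (O1 : measurableType d1) (Y : O1 -> D)
  (mY : forall i, measurable_fun setT (xi i \o Y)) i a :
  measurable_fun setT (fun t => (xi i (Y t) - a) ^+ 2).
Proof. by apply: measurable_funX; apply: measurable_funB => //; exact: mY. Qed.

Let mlap d1 (O1 : measurableType d1) (Y : O1 -> D)
  (mY : forall i, measurable_fun setT (xi i \o Y)) l :
  measurable_fun setT (fun t => lap l (Y t)).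
Proof.
apply: measurable_prod => r _; apply: measurable_expR_scale.
exact: msq.
Qed.

Let ind01 l x : 0 <= ind l x <= 1.
Proof. by apply/andP; split; [apply: prodr_ge0|apply: prodr_ile1] => r _; case: ltP => //; rewrite ?lexx ?ler01. Qed.

Let lap01 l x : all (fun r => 0 <= r.2) l -> 0 <= lap l x <= 1.
Proof.
rewrite /lap; elim: l => [|r l IH]; first by rewrite big_nil ler01 lexx.
move=> /= /andP[r0 /IH /andP[h0 h1]]; rewrite big_cons.
rewrite mulr_ge0 ?expR_ge0//= mulr_ile1 ?expR_ge0//.
by rewrite -[leRHS]expR0 ler_expR oppr_le0 mulr_ge0// sqr_ge0.
Qed.

(** Induction on the number of indicators: one of them is recovered from its Laplace factors by
    [laplace_tail_weighted], with all other factors as weight. The Laplace factor needed for this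
    joins [l2], which is why both kinds occur in the statement. *)
Let ind_lap_eq (l1 l2 : seq (I * R * R)) :
  all (fun r => 0 < r.2) l1 -> all (fun r => 0 <= r.2) l2 ->
  \int[P]_t (ind l1 (X t) * lap l2 (X t)) =
  \int[P']_t (ind l1 (X' t) * lap l2 (X' t)).
Proof.
elim: l1 l2 => [|r l1 IH] l2.
  move=> _ lp; rewrite /ind; under eq_Rintegral do rewrite big_nil mul1r.
  by under [RHS]eq_Rintegral do rewrite big_nil mul1r; exact: lap_eq.
move=> /= /andP[r0 l1p] l2p.
have E (x : D) : ind (r :: l1) x * lap l2 x =
    (r.2 < (xi r.1.1 x - r.1.2) ^+ 2)%R%:R * (ind l1 x * lap l2 x).
  by rewrite /ind big_cons mulrA.
have il01 x : 0 <= ind l1 x * lap l2 x <= 1.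
  by have /andP[? ?] := ind01 l1 x; have /andP[? ?] := lap01 x l2p; rewrite mulr_ge0 ?mulr_ile1.
under eq_Rintegral do rewrite E.
under [RHS]eq_Rintegral do rewrite E.
apply: (@laplace_tail_weighted _ _ _ P (fun t => (xi r.1.1 (X t) - r.1.2) ^+ 2)
  (fun t => ind l1 (X t) * lap l2 (X t)) _ _ P' (fun t => (xi r.1.1 (X' t) - r.1.2) ^+ 2)
  (fun t => ind l1 (X' t) * lap l2 (X' t))) => //.
- exact: msq.
- by move=> t; exact: sqr_ge0.
- by apply: measurable_funM; [exact: mind|exact: mlap].
- exact: msq.
- by move=> t; exact: sqr_ge0.
- by apply: measurable_funM; [exact: mind|exact: mlap].
- move=> la la0.
  have E' (x : D) : expR (- (la * (xi r.1.1 x - r.1.2) ^+ 2)) * (ind l1 x * lap l2 x) =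
      ind l1 x * lap ((r.1, la) :: l2) x.
    by rewrite /lap big_cons mulrCA.
  under eq_Rintegral do rewrite E'.
  under [RHS]eq_Rintegral do rewrite E'.
  by apply: IH => //=; rewrite la0.
Qed.

Lemma measurable_cylT d1 (O1 : measurableType d1) (Y : O1 -> D) :
  (forall i, measurable_fun setT (xi i \o Y)) ->
  measurable_fun setT (Y : O1 -> cylT).
Proof.
move=> mY; apply: (@measurability _ _ _ cylT _ _ cyl) => // _ [_ [l [_ ->]] <-]; rewrite setTI.
have -> : Y @^-1` [set x | all (fun r => r.2 < (xi r.1.1 x - r.1.2) ^+ 2) l] =
    (fun t => ind l (Y t)) @^-1` [set 1].
  apply/seteqP; split => t /=; rewrite /ind.
    elim: l => [|r l IH]; first by rewrite big_nil.
    by move=> /= /andP[h /IH e]; rewrite big_cons h mul1r.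
  elim: l => [//|r l IH]; rewrite big_cons /=; case: ltP => _ /=.
    by rewrite mul1r => /IH.
  by rewrite mul0r => /eqP; rewrite eq_sym oner_eq0.
by rewrite -[X in measurable X]setTI; exact: mind.
Qed.

(** The laws of [X] and [X'] on the sigma-algebra generated by the [xi] agree on the pi-system
    [cyl], by [ind_lap_eq] with an empty list of Laplace factors. *)
Theorem ge0_integral_eq_cos (F : cylT -> \bar R) :
  measurable_fun setT F -> (forall x, (0 <= F x)%E) ->
  (\int[P]_t F (X t) = \int[P']_t F (X' t))%E.
Proof.
move=> mF F0.
pose X1 := mfun_Sub (mem_set (measurable_cylT mX)).
pose X1' := mfun_Sub (mem_set (measurable_cylT mX')).
transitivity (\int[distribution P X1]_x F x)%E.
  by rewrite ge0_integral_pushforward.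
transitivity (\int[distribution P' X1']_x F x)%E; last first.
  by rewrite ge0_integral_pushforward.
apply: eq_measure_integral => A mA _.
apply: (@measure_unique _ R cylT cyl (fun=> setT)) => //.
- exact: setI_closed_cyl.
- by move=> _; exists [::]; split => //; apply/seteqP; split.
- by apply/seteqP; split => // x _; exists 0%N.
- move=> _ [l [lp ->]].
  have E d1 (O1 : measurableType d1) (P1 : probability O1 R) (Y : O1 -> D)
    (mY : forall i, measurable_fun setT (xi i \o Y)) :
    P1 (Y @^-1` [set x | all (fun r => r.2 < (xi r.1.1 x - r.1.2) ^+ 2) l]) =
    (\int[P1]_t (ind l (Y t) * lap [::] (Y t)))%:E.
    rewrite EFin_Rintegral; last first.
      apply: (@bounded_integrable _ _ _ P1 _ 1).
        by apply: measurable_funM; [exact: mind|exact: mlap].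
      move=> t; rewrite /lap big_nil mulr1; have /andP[h0 h1] := ind01 l (Y t).
      by rewrite ger0_norm.
    have mA' : measurable (Y @^-1` [set x | all (fun r => r.2 < (xi r.1.1 x - r.1.2) ^+ 2) l]).
      rewrite -[X in measurable X]setTI; apply: (measurable_cylT mY) => //.
      by apply: sub_sigma_algebra; exists l.
    rewrite -[LHS]mul1e -integral_cst// integral_mkcond; apply: eq_integral => t _.
    rewrite patchE /lap big_nil mulr1 /ind.
    case: ifPn => [|].
      rewrite inE /=; elim: l {mA' mA lp} => [|r l IH]; first by rewrite big_nil.
      by move=> /= /andP[h /IH]; rewrite big_cons h mul1r.
    rewrite notin_setE /= => /negP; rewrite -has_predC.
    elim: l {mA' mA lp} => [//|r l IH] /=; rewrite big_cons; case: ltP => //= _.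
      by rewrite mul1r.
    by rewrite mul0r.
  transitivity (\int[P]_t (ind l (X t) * lap [::] (X t)))%:E; first apply: (E _ _ P X mX).
  transitivity (\int[P']_t (ind l (X' t) * lap [::] (X' t)))%:E; last by apply: esym; apply: (E _ _ P' X' mX').
  by congr EFin; exact: ind_lap_eq.
- by move=> _; rewrite ltey_eq fin_num_measure.
Qed.

End cos_uniqueness.

(** * Inner products: Cauchy-Schwarz and continuity *)

Section hilbert.
Context {R : realType} (H : completeNormedModType R) (ip : {dot H for idfun}).
Hypothesis Hip : norm_induced_by ip.

Lemma ipC x y : ip x y = ip y x.
Proof. by rewrite hermC expr0 mul1r. Qed.

Lemma ipDl x y z : ip (x + y) z = ip x z + ip y z.
Proof. exact: linearDl. Qed.

Lemma ipDr x y z : ip x (y + z) = ip x y + ip x z.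
Proof. exact: linearDr. Qed.

Lemma ipZl a x y : ip (a *: x) y = a * ip x y.
Proof. exact: linearZl_LR. Qed.

Lemma ipZr a x y : ip x (a *: y) = a * ip x y.
Proof. by rewrite ipC ipZl ipC. Qed.

Lemma ipBl x y z : ip (x - y) z = ip x z - ip y z.
Proof. exact: linearBl. Qed.

Lemma ipBr x y z : ip x (y - z) = ip x y - ip x z.
Proof. exact: linearBr. Qed.

Lemma ip0l x : ip 0 x = 0.
Proof. exact: linear0l. Qed.

Lemma ip0r x : ip x 0 = 0.
Proof. exact: linear0r. Qed.

Lemma ip_suml (J : Type) (s : seq J) (P : pred J) (v : J -> H) x :
  ip (\sum_(i <- s | P i) v i) x = \sum_(i <- s | P i) ip (v i) x.
Proof. exact: linear_sumlz. Qed.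

Lemma ip_sumr (J : Type) (s : seq J) (P : pred J) (v : J -> H) x :
  ip x (\sum_(i <- s | P i) v i) = \sum_(i <- s | P i) ip x (v i).
Proof. exact: linear_sumr. Qed.

Lemma ip_gt0 x : x != 0 -> 0 < ip x x.
Proof. exact: neq0_dnorm_gt0. Qed.

Lemma ip_ge0 x : 0 <= ip x x.
Proof. by have [->|/ip_gt0/ltW//] := eqVneq x 0; rewrite ip0l. Qed.

Lemma normE x : `|x| = Num.sqrt (ip x x).
Proof. exact: Hip. Qed.

Lemma ip_norm x : ip x x = `|x| ^+ 2.
Proof. by rewrite normE sqr_sqrtr// ip_ge0. Qed.

Lemma ip_inj x y : (forall z, ip x z = ip y z) -> x = y.
Proof.
move=> xy; apply/eqP; rewrite -subr_eq0; apply: contraT => /ip_gt0.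
by rewrite ipBl xy subrr ltxx.
Qed.

Lemma ip_cauchy x y : `|ip x y| <= `|x| * `|y|.
Proof.
have [->|y0] := eqVneq y 0; first by rewrite ip0r normr0 mulr_ge0.
have yy := ip_gt0 y0.
have : 0 <= ip (x - (ip x y / ip y y) *: y) (x - (ip x y / ip y y) *: y) by exact: ip_ge0.
rewrite !ipBl !ipBr !ipZl !ipZr (ipC y x) divfK ?gt_eqF// => h.
rewrite -(@ler_pXn2r _ 2)// ?nnegrE ?mulr_ge0// exprMn -!ip_norm real_normK ?num_real//.
rewrite -(@ler_pdivrMr _ (ip y y))//.
by move: h; rewrite expr2; set c := ip x y / ip y y; rewrite mulrAC -/c; lra.
Qed.

Lemma cvg_ip (F : set_system nat) (FF : Filter F) (x_ y_ : nat -> H) x y :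
  x_ n @[n --> F] --> x -> y_ n @[n --> F] --> y ->
  ip (x_ n) (y_ n) @[n --> F] --> ip x y.
Proof.
move=> xx yy; apply/subr_cvg0/norm_cvg0P.
have x0 : x_ n - x @[n --> F] --> (0 : H) by apply/subr_cvg0.
have y0 : y_ n - y @[n --> F] --> (0 : H) by apply/subr_cvg0.
have nx : `|x_ n - x| @[n --> F] --> (0 : R) by apply/norm_cvg0P.
have ny : `|y_ n - y| @[n --> F] --> (0 : R) by apply/norm_cvg0P.
have ub : `|x_ n - x| * `|y_ n| + `|x| * `|y_ n - y| @[n --> F] --> (0 : R).
  rewrite -[X in _ --> X]addr0 -[X in _ --> X + _](mul0r `|y|) -[X in _ --> _ + X](mulr0 `|x|).
  apply: cvgD; apply: cvgM => //; last exact: cvg_cst.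
  exact: cvg_norm.
apply: (squeeze_cvgr _ (cvg_cst 0) ub); apply: nearW => n; rewrite normr_ge0 /=.
have -> : ip (x_ n) (y_ n) - ip x y = ip (x_ n - x) (y_ n) + ip x (y_ n - y).
  by rewrite ipBl ipBr; ring.
by rewrite (le_trans (ler_normD _ _))// lerD// ip_cauchy.
Qed.

Lemma continuous_ipl h : continuous (fun x => ip x h).
Proof.
move=> x; apply/subr_cvg0/norm_cvg0P.
have x0 : y - x @[y --> x] --> (0 : H) by apply/subr_cvg0; exact: cvg_id.
have ub : `|y - x| * `|h| @[y --> x] --> (0 : R).
  rewrite -[X in _ --> X](mul0r `|h|); apply: cvgM; last exact: cvg_cst.
  exact/norm_cvg0P.
apply: (squeeze_cvgr _ (cvg_cst 0) ub); apply: nearW => y; rewrite normr_ge0 /=.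
by rewrite -ipBl ip_cauchy.
Qed.

(** * Orthogonal projections and Gram-Schmidt *)

Definition proj (Q : seq H) (x : H) : H := \sum_(v <- Q) ip v x *: v.

Lemma projD Q x y : proj Q (x + y) = proj Q x + proj Q y.
Proof. by rewrite /proj -big_split; apply: eq_bigr => v _; rewrite ipDr scalerDl. Qed.

Lemma projZ Q a x : proj Q (a *: x) = a *: proj Q x.
Proof. by rewrite /proj scaler_sumr; apply: eq_bigr => v _; rewrite ipZr scalerA. Qed.

Lemma proj_sum Q (J : Type) (s : seq J) (c : J -> R) (v : J -> H) :
  proj Q (\sum_(i <- s) c i *: v i) = \sum_(i <- s) c i *: proj Q (v i).
Proof.
elim: s => [|i s IH]; last by rewrite !big_cons projD projZ IH.
by rewrite !big_nil -(scale0r (0 : H)) projZ !scale0r.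
Qed.

Lemma proj_sym Q x y : ip (proj Q x) y = ip x (proj Q y).
Proof.
rewrite /proj ip_suml ip_sumr; apply: eq_bigr => v _.
by rewrite ipZl ipZr mulrC (ipC x v) (ipC v y) mulrC.
Qed.

Lemma proj_incl Q Q' x : (forall v, v \in Q -> proj Q' v = v) -> proj Q' (proj Q x) = proj Q x.
Proof.
move=> QQ'; rewrite {2}/proj proj_sum /proj.
by rewrite big_seq [RHS]big_seq; apply: eq_bigr => v vQ; rewrite -/(proj Q' v) QQ'.
Qed.

(** Write P and P' for the two maps. The hypotheses give P'P = P and PP' = P'; the adjoint of the
    first identity is PP' = P, so P = P'. The lists may contain zero vectors. *)
Lemma eq_proj Q Q' : (forall v, v \in Q -> proj Q' v = v) ->
  (forall v, v \in Q' -> proj Q v = v) -> proj Q =1 proj Q'.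
Proof.
move=> QQ' Q'Q x; apply: ip_inj => y.
rewrite proj_sym -(proj_incl y QQ') -proj_sym.
by rewrite -[in RHS](proj_incl x Q'Q) [RHS]proj_sym.
Qed.

(** Expanding v over Q' on one side and u over Q on the other, both traces equal the double sum of
    <u, v> <A v, u>. *)
Lemma eq_compressed_trace (A : {linear H -> H}) Q Q' :
  (forall v, v \in Q -> proj Q' v = v) -> (forall v, v \in Q' -> proj Q v = v) ->
  compressed_trace ip A Q = compressed_trace ip A Q'.
Proof.
move=> QQ' Q'Q; rewrite /compressed_trace.
transitivity (\sum_(v <- Q) \sum_(u <- Q') ip u v * ip (A v) u).
  rewrite big_seq [RHS]big_seq; apply: eq_bigr => v vQ.
  rewrite -[X in ip _ X](QQ' v vQ) /proj ip_sumr; apply: eq_bigr => u _.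
  by rewrite ipZr.
rewrite exchange_big /= big_seq [RHS]big_seq; apply: eq_bigr => u uQ'.
rewrite -[X in _ = ip (A X) _](Q'Q u uQ') /proj linear_sum ip_suml.
by apply: eq_bigr => v _; rewrite linearZ ipZl ipC.
Qed.

Lemma orthonormal_proj Q v : orthonormal ip Q -> v \in Q -> proj Q v = v.
Proof.
elim: Q v => [//|u Q IH] v /andP[/= /andP[u1 a1] /andP[uQ pQ]].
rewrite /= andbT in uQ.
have oQ : orthonormal ip Q by apply/andP.
rewrite inE => /predU1P[->|vQ]; rewrite /proj big_cons -/(proj Q _).
  rewrite (eqP u1) scale1r /proj big_seq big1 ?addr0// => w wQ.
  by rewrite ipC (eqP (allP uQ w wQ)) scale0r.
by rewrite (IH v oQ vQ) (eqP (allP uQ v vQ)) scale0r add0r.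
Qed.

(* A vector in the span of its predecessors yields [0], since [`|0|^-1 *: 0 = 0]. *)
Definition normalize (x : H) : H := `|x|^-1 *: x.

(** The list has length n whatever the rank, with 0 in place of dependent vectors, so that its j-th
    entry can be followed along a sequence of samples and measured as a function of them. *)
Fixpoint gs (z : nat -> H) (n : nat) : seq H :=
  if n is m.+1 then rcons (gs z m) (normalize (residual ip (gs z m) (z m))) else [::].

Definition gsv z n := normalize (residual ip (gs z n) (z n)).

Lemma gsE z n : gs z n = [seq gsv z j | j <- iota 0 n].
Proof.
by elim: n => [//|n IH]; rewrite -addn1 iotaD map_cat -IH addn1 /= cats1.
Qed.

Lemma residualE Q x : residual ip Q x = x - proj Q x.
Proof. by []. Qed.

Lemma big_gs z n (V : zmodType) (f : H -> V) :
  \sum_(v <- gs z n) f v = \sum_(j < n) f (gsv z j).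
Proof. by rewrite gsE big_map -{1}(subn0 n) -/(index_iota 0 n) big_mkord. Qed.

Lemma normalizeK x : `|x| *: normalize x = x.
Proof.
have [->|x0] := eqVneq x 0; first by rewrite /normalize !scaler0.
by rewrite scalerA divff ?scale1r// normr_eq0.
Qed.

Lemma ip_normalize x : ip (normalize x) (normalize x) = (x != 0)%:R.
Proof.
rewrite ipZl ipZr ip_norm; have [->|x0] := eqVneq x 0; first by rewrite normr0 invr0 mul0r.
by rewrite expr2 mulKf ?mulVf// normr_eq0.
Qed.

Lemma gs_ortho z i j : i != j -> ip (gsv z i) (gsv z j) = 0.
Proof.
(* Orthogonality of the first n entries is proved together with the fact that the projection keeps
   the components along them; each is needed for the next step of the other. *)
have main n : (forall i j, (i < n)%N -> (j < n)%N -> i != j -> ip (gsv z i) (gsv z j) = 0) /\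
    (forall i x, (i < n)%N -> ip (gsv z i) (proj (gs z n) x) = ip (gsv z i) x).
  elim: n => [//|n [IH1 IH2]].
  have H1 i' j' : (i' < n.+1)%N -> (j' < n.+1)%N -> i' != j' -> ip (gsv z i') (gsv z j') = 0.
    have H1' i0 : (i0 < n)%N -> ip (gsv z i0) (gsv z n) = 0.
      by move=> i0n; rewrite [gsv z n]/gsv ipZr residualE ipBr IH2// subrr mulr0.
    rewrite ltnS leq_eqVlt => /predU1P[->|i'n];
      rewrite ltnS leq_eqVlt => /predU1P[->|j'n] ij.
    - by rewrite eqxx in ij.
    - by rewrite ipC H1'.
    - exact: H1'.
    - exact: IH1.
  split => // i' x i'n.
  rewrite /proj big_gs ip_sumr (bigD1 (Ordinal i'n))//= big1 ?addr0; last first.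
    move=> j' ji; rewrite ipZr H1 ?mulr0// eq_sym.
    by apply: contra ji => /eqP e; apply/eqP/val_inj.
  rewrite ipZr [in X in _ * X]/gsv ip_normalize.
  case: eqP => [e|_]; last by rewrite mulr1.
  by rewrite /gsv /normalize e scaler0 ip0l mul0r.
by move=> ij; apply: (main (maxn i j).+1).1; rewrite // ltnS ?leq_maxl ?leq_maxr.
Qed.

Lemma gs_norm z i : ip (gsv z i) (gsv z i) = (gsv z i != 0)%:R.
Proof.
rewrite {1 2}/gsv ip_normalize; congr (nat_of_bool (~~ _))%:R.
rewrite /gsv /normalize scaler_eq0 invr_eq0 normr_eq0; by case: eqP.
Qed.

Lemma gs_norm_scale z i : ip (gsv z i) (gsv z i) *: gsv z i = gsv z i.
Proof. by rewrite gs_norm; case: eqP => [->|_]; rewrite ?scaler0 ?scale1r. Qed.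

Lemma proj_gsv z n i : (i < n)%N -> proj (gs z n) (gsv z i) = gsv z i.
Proof.
move=> iN; rewrite /proj big_gs (bigD1 (Ordinal iN))//= big1 ?addr0 ?gs_norm_scale//.
move=> j ji; rewrite gs_ortho ?scale0r//.
Qed.

Lemma mem_gs z n v : v \in gs z n -> exists2 i, (i < n)%N & v = gsv z i.
Proof.
by rewrite gsE => /mapP[i]; rewrite mem_iota add0n => /andP[_ ?] ->; exists i.
Qed.

Lemma proj_gs_mem z n v : v \in gs z n -> proj (gs z n) v = v.
Proof. by move=> /mem_gs[i iN ->]; exact: proj_gsv. Qed.

Lemma proj_gs z n i : (i < n)%N -> proj (gs z n) (z i) = z i.
Proof.
move=> iN.
have -> : z i = proj (gs z i) (z i) + `|residual ip (gs z i) (z i)| *: gsv z i.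
  by rewrite normalizeK residualE addrC subrK.
rewrite projD projZ proj_gsv//; congr (_ + _).
apply: proj_incl => v /mem_gs[j ji ->]; apply: proj_gsv.
exact: ltn_trans ji iN.
Qed.

Lemma gs_in_proj Q z n : (forall i, (i < n)%N -> proj Q (z i) = z i) ->
  forall v, v \in gs z n -> proj Q v = v.
Proof.
move=> Qz; elim: n Qz => [//|n IH] Qz v; rewrite mem_rcons inE => /predU1P[->|]; last first.
  by apply: IH => i iN; apply: Qz; exact: ltnW.
have IH' := IH (fun i iN => Qz i (ltnW iN)).
rewrite /normalize projZ residualE -scaleN1r projD projZ Qz//.
by rewrite (proj_incl _ IH').
Qed.

End hilbert.

Lemma eq_cvgn (T : topologicalType) (f g : nat -> T) (l : T) :
  f =1 g -> f @ \oo --> l -> g @ \oo --> l.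
Proof. by move=> /funext ->. Qed.

Section hilbert2.
Context {R : realType} (H : completeNormedModType R) (ip : {dot H for idfun}).
Hypothesis Hip : norm_induced_by ip.

(** Padding with zeros turns a finite family into the kind of sequence that [gs] takes. *)
Definition extend0 (k : nat) (v : 'I_k -> H) (j : nat) : H :=
  oapp v 0 (insub j).

Lemma extend0E k (v : 'I_k -> H) (j : 'I_k) : extend0 v j = v j.
Proof. by rewrite /extend0 valK. Qed.

(** With [eq_proj] and [eq_compressed_trace], this replaces an arbitrary choice of basis, about
    whose measurability nothing is assumed, by the Gram-Schmidt list. *)
Lemma basis_of_span_gs k (v : 'I_k -> H) Q : orthonormal_basis_of_span ip Q v ->
  (forall x, x \in Q -> proj ip (gs ip (extend0 v) k) x = x) /\
  (forall x, x \in gs ip (extend0 v) k -> proj ip Q x = x).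
Proof.
move=> [oQ sQ]; split => [x xQ|].
  have : lin_span (fun i : 'I_(size Q) => Q`_i) x.
    have iQ : (index x Q < size Q)%N by rewrite index_mem.
    exists (fun i => (i == Ordinal iQ)%:R) => //=.
    rewrite (bigD1 (Ordinal iQ))//= eqxx scale1r nth_index// big1 ?addr0//.
    by move=> i /negbTE ->; rewrite scale0r.
  rewrite sQ => -[c _ <-]; rewrite proj_sum; apply: eq_bigr => i _.
  by rewrite -extend0E proj_gs.
apply: gs_in_proj => i ik.
have : lin_span v (v (Ordinal ik)).
  exists (fun j => (j == Ordinal ik)%:R) => //=.
  rewrite (bigD1 (Ordinal ik))//= eqxx scale1r big1 ?addr0//.
  by move=> j /negbTE ->; rewrite scale0r.
have -> : extend0 v i = v (Ordinal ik) by rewrite -extend0E.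
rewrite -sQ => -[c _ <-]; rewrite proj_sum; apply: eq_bigr => j _.
by rewrite (orthonormal_proj oQ)// mem_nth.
Qed.

Lemma cvg_proj_gs (z_ : nat -> nat -> H) (z : nat -> H) (x_ : nat -> H) x k :
  (forall j, (j < k)%N -> gsv ip (z_ n) j @[n --> \oo] --> gsv ip z j) ->
  x_ n @[n --> \oo] --> x ->
  proj ip (gs ip (z_ n) k) (x_ n) @[n --> \oo] --> proj ip (gs ip z k) x.
Proof.
move=> zz xx; rewrite /proj big_gs.
under eq_fun do rewrite big_gs.
apply: cvg_big; first exact: add_continuous.
move=> j _; apply: cvgZ; last exact: zz.
by apply: cvg_ip => //; exact: zz.
Qed.

(** Normalisation is continuous away from 0, which settles indices with nonzero limiting residual.
    At the other indices the approximating residuals are eventually 0, hence so is the limiting one,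
    and both sides normalise to 0. *)
Lemma cvg_gsv (z_ : nat -> nat -> H) (z : nat -> H) (k : nat) :
  (forall j, (j < k)%N -> z_ n j @[n --> \oo] --> z j) ->
  (forall j, (j < k)%N -> residual ip (gs ip z j) (z j) != 0 \/
    \forall n \near \oo, residual ip (gs ip (z_ n) j) (z_ n j) = 0) ->
  forall j, (j < k)%N -> gsv ip (z_ n) j @[n --> \oo] --> gsv ip z j.
Proof.
move=> zz; elim: k zz => [//|k IH] zz zz' j.
have {}IH : forall j, (j < k)%N -> gsv ip (z_ n) j @[n --> \oo] --> gsv ip z j.
  by apply: IH => i ik; [apply: zz|apply: zz']; exact: ltnW.
rewrite ltnS leq_eqVlt => /predU1P[->|]; last exact: IH.
have rr : residual ip (gs ip (z_ n) k) (z_ n k) @[n --> \oo] --> residual ip (gs ip z k) (z k).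
  by apply: cvgB; [exact: zz|apply: cvg_proj_gs; [exact: IH|exact: zz]].
rewrite /gsv /normalize; have [r0|nr0] := zz' _ (ltnSn k).
  by apply: cvgZ => //; apply: cvgV; [rewrite normr_eq0|exact: cvg_norm].
have c0 : residual ip (gs ip (z_ n) k) (z_ n k) @[n --> \oo] --> (0 : H).
  exact: cvg_near_cst.
have -> : residual ip (gs ip z k) (z k) = 0 by exact: (cvg_unique _ rr c0).
rewrite scaler0; apply: cvg_near_cst; apply: filterS nr0 => n ->.
by rewrite scaler0.
Qed.

Variables (q : nat -> H).
Hypothesis Hq : orthonormal_basis ip q.

Definition trunc (n : nat) (x : H) : H := \sum_(j < n) ip x (q j) *: q j.

Lemma trunc_res_ortho n x (j : nat) : (j < n)%N -> ip (x - trunc n x) (q j) = 0.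
Proof.
move=> jn; rewrite ipBl /trunc ip_suml (bigD1 (Ordinal jn))//= big1 ?addr0.
  by rewrite ipZl Hq.1 eqxx mulr1 subrr.
move=> i ij; rewrite ipZl Hq.1 (_ : (i == j :> nat) = false) ?mulr0//.
by apply: contraNF ij => /eqP e; apply/eqP/val_inj.
Qed.

Lemma trunc_best n x (c : nat -> R) :
  `|x - trunc n x| <= `|x - \sum_(j < n) c j *: q j|.
Proof.
set y := \sum_(j < n) _.
rewrite -(@ler_pXn2r _ 2)// ?nnegrE// -!(ip_norm Hip).
have -> : x - y = (x - trunc n x) + (trunc n x - y) by rewrite addrA subrK.
set u := x - trunc n x; set w := _ - y.
have uw : ip u w = 0.
  rewrite /w /trunc /y -sumrB ip_sumr big1// => j _.
  by rewrite -scalerBl ipZr trunc_res_ortho ?mulr0.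
move: u w uw => u w uw; rewrite ipDl !ipDr (ipC ip w u) uw !addr0 add0r lerDl.
by rewrite ip_ge0. 
Qed.

(** Density gives a finite combination near x; padded with zeros it has length n for all large n,
    and [trunc_best] says that the truncation is at least as close. *)
Lemma trunc_cvg x : trunc n x @[n --> \oo] --> x.
Proof.
apply/cvgrPdist_lt => e e0.
have [y [+ [N _ [c _ yE]]]] := Hq.2 _ (ex_intro _ x (ballxx x e0)) (ball_open x e).
move=> h; have {h} xy : ball_ (@Num.norm _ H) x e y by rewrite ball_normE.
rewrite /ball_ /= in xy.
near=> n.
have Nn : (N <= n)%N by near: n; exact: nbhs_infty_ge.
apply: le_lt_trans xy.
pose c' j := if insub j is Some i then c i else 0.
have -> : y = \sum_(j < n) c' j *: q j.
  rewrite -yE -(big_mkord xpredT (fun j => c' j *: q j)) (big_cat_nat _ Nn)//=.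
  rewrite [X in _ + X]big_nat_cond [X in _ + X]big1 ?addr0 => [|j]; last first.
    rewrite andbT => /andP[Nj _]; rewrite /c' insubF ?scale0r//.
    by apply/negbTE; rewrite -leqNgt.
  by rewrite big_mkord; apply: eq_bigr => j _; rewrite /c' valK.
exact: trunc_best.
Unshelve. all: end_near. Qed.

Lemma parseval x y :
  \sum_(j < n) ip x (q j) * ip y (q j) @[n --> \oo] --> ip x y.
Proof.
apply: eq_cvgn (@cvg_ip _ _ _ Hip \oo _ _ _ _ _ (@trunc_cvg x) (cvg_cst y)) => n.
by rewrite /trunc ip_suml; apply: eq_bigr => j _; rewrite ipZl (ipC ip y).
Qed.

Lemma trunc_dist n x : ip (x - trunc n x) (x - trunc n x) =
  ip x x - \sum_(j < n) ip x (q j) ^+ 2.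
Proof.
rewrite ipBr [X in _ - X](_ : _ = 0) ?subr0; last first.
  rewrite {2}/trunc ip_sumr big1// => j _.
  by rewrite ipZr trunc_res_ortho ?mulr0.
rewrite ipBl /trunc ip_suml; congr (_ - _); apply: eq_bigr => j _.
by rewrite ipZl (ipC ip (q j)) expr2.
Qed.

Lemma bessel n x : \sum_(j < n) ip x (q j) ^+ 2 <= ip x x.
Proof. by rewrite -subr_ge0 -trunc_dist ip_ge0. Qed.

(** Truncations do not increase the norm, whatever their level, so the vector and the level may vary
    together. *)
Lemma cvg_trunc_sq (x_ : nat -> H) x (n_ : nat -> nat) : n_ @ \oo --> \oo ->
  x_ p @[p --> \oo] --> x ->
  \sum_(j < n_ p) ip (x_ p) (q j) ^+ 2 @[p --> \oo] --> ip x x.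
Proof.
move=> noo xx.
have tx : trunc (n_ p) (x_ p) @[p --> \oo] --> x.
  have t1 : trunc (n_ p) x @[p --> \oo] --> x.
    exact: (cvg_comp n_ (fun n => trunc n x) noo (@trunc_cvg x)).
  have x0 : `|x_ p - x| @[p --> \oo] --> (0 : R).
    by apply/norm_cvg0P/subr_cvg0.
  have t0 : trunc (n_ p) (x_ p - x) @[p --> \oo] --> (0 : H).
    apply/norm_cvg0P; apply: (squeeze_cvgr _ (cvg_cst 0) x0).
    apply: nearW => p; rewrite normr_ge0/= -(@ler_pXn2r _ 2)// ?nnegrE// -!(ip_norm Hip).
    apply: le_trans (bessel (n_ p) _).
    rewrite {1}/trunc ip_suml; apply: ler_sum => j _.
    have := trunc_res_ortho (x_ p - x) (ltn_ord j); rewrite ipBl => /eqP.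
    by rewrite subr_eq0 => /eqP e; rewrite ipZl (ipC ip (q j)) -e expr2.
  rewrite -[x]add0r; apply: eq_cvgn (cvgD t0 t1) => p; rewrite !fctE /trunc -big_split; apply: eq_bigr => j _ /=.
  by rewrite -scalerDl -ipDl subrK.
apply: eq_cvgn (@cvg_ip _ _ _ Hip \oo _ _ _ _ _ tx xx) => p.
by rewrite /trunc ip_suml; apply: eq_bigr => j _; rewrite ipZl (ipC ip (q j)) expr2.
Qed.

(* MathComp's convention [0^-1 = 0] makes this limit valid at [0] too. *)
Lemma measurable_fun_invr : measurable_fun setT (fun x : R => x^-1).
Proof.
have p0 n (x : R) : 0 < x ^+ 2 + n.+1%:R^-1 by rewrite ltr_wpDl ?sqr_ge0 ?invr_gt0.
apply: (@measurable_fun_cvg _ _ _ _ (fun n (x : R) => x * (x ^+ 2 + n.+1%:R^-1)^-1)).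
  move=> n; apply: continuous_measurable_fun => x.
  apply: cvgM; first exact: cvg_id.
  apply: cvgV; first by rewrite gt_eqF.
  by apply: cvgD; [exact: sqr_continuous|exact: cvg_cst].
move=> x _; have [->|x0] := eqVneq x 0.
  by rewrite invr0; under eq_fun do rewrite mul0r; exact: cvg_cst.
rewrite -[X in _ --> X](_ : x * (x ^+ 2 + 0)^-1 = _); last by rewrite addr0; field.
apply: cvgM; first exact: cvg_cst.
apply: cvgV; first by rewrite addr0 sqrf_eq0.
by apply: cvgD; [exact: cvg_cst|exact: cvg_harmonic].
Qed.

(** Weak measurability. It passes through linear operations and, by [parseval], still makes the
    inner product of two varying vectors measurable, which is all that Gram-Schmidt requires. *)
Definition wmeasurable d (O : measurableType d) (X : O -> H) : Prop :=
  forall h, measurable_fun setT (fun t => ip (X t) h).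

Section wmeasurable.
Context d (O : measurableType d).
Implicit Types X Y : O -> H.

Lemma wmeasurable_cst (x : H) : wmeasurable (fun _ : O => x).
Proof. by move=> h. Qed.

Lemma wmeasurableB X Y : wmeasurable X -> wmeasurable Y ->
  wmeasurable (fun t => X t - Y t).
Proof.
by move=> mX mY h; under eq_fun do rewrite ipBl; exact: measurable_funB.
Qed.

Lemma wmeasurableZ (f : O -> R) X : measurable_fun setT f -> wmeasurable X ->
  wmeasurable (fun t => f t *: X t).
Proof.
by move=> mf mX h; under eq_fun do rewrite ipZl; exact: measurable_funM.
Qed.

Lemma wmeasurable_sum (J : Type) (s : seq J) (X : J -> O -> H) :
  (forall i, wmeasurable (X i)) -> wmeasurable (fun t => \sum_(i <- s) X i t).
Proof.
by move=> mX h; under eq_fun do rewrite ip_suml; apply: measurable_sum => i; exact: mX.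
Qed.

Lemma measurable_ip X Y : wmeasurable X -> wmeasurable Y ->
  measurable_fun setT (fun t => ip (X t) (Y t)).
Proof.
move=> mX mY.
apply: (@measurable_fun_cvg _ _ _ _ (fun n t => \sum_(j < n) ip (X t) (q j) * ip (Y t) (q j))).
  by move=> n; apply: measurable_sum => j; exact: measurable_funM.
by move=> t _; exact: parseval.
Qed.

Lemma measurable_norm X : wmeasurable X -> measurable_fun setT (fun t => `|X t|).
Proof.
move=> mX; under eq_fun do rewrite (normE Hip).
apply: measurableT_comp; last exact: measurable_ip.
by apply: continuous_measurable_fun; exact: sqrt_continuous.
Qed.

Lemma wmeasurable_normalize X : wmeasurable X -> wmeasurable (fun t => normalize (X t)).
Proof.
move=> mX; apply: wmeasurableZ => //.
by apply: (measurableT_comp measurable_fun_invr); exact: measurable_norm.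
Qed.

Lemma wmeasurable_proj_gs (z : O -> nat -> H) k X :
  (forall j, (j < k)%N -> wmeasurable (fun t => gsv ip (z t) j)) -> wmeasurable X ->
  wmeasurable (fun t => proj ip (gs ip (z t) k) (X t)).
Proof.
move=> mz mX h; rewrite /proj; under eq_fun do rewrite big_gs.
move: h; apply: wmeasurable_sum => j; apply: wmeasurableZ; last exact: mz.
by apply: measurable_ip => //; exact: mz.
Qed.

Lemma wmeasurable_gsv (z : O -> nat -> H) j :
  (forall i, wmeasurable (fun t => z t i)) -> wmeasurable (fun t => gsv ip (z t) j).
Proof.
move=> mz; have [n] := ubnP j; elim: n j => [//|n IH] j jn.
apply: wmeasurable_normalize; apply: wmeasurableB => //.
apply: wmeasurable_proj_gs => // i ij; apply: IH.
exact: leq_trans ij jn.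
Qed.

End wmeasurable.
End hilbert2.

(** * Rank of the operator and vanishing residuals *)

Section range_rank.
Context {R : realType} (H : completeNormedModType R) (ip : {dot H for idfun}).
Hypothesis Hip : norm_induced_by ip.
Variable A : {linear H -> H}.

(* The rank of A exceeds i: ker A contains no orthogonal complement of i vectors. *)
Definition rank_gt (i : nat) : Prop :=
  forall e : 'I_i -> H, exists h, (forall a, ip (e a) h = 0) /\ A h != 0.

Lemma kernel_vec (r : nat) (C : 'M[R]_(r.+1, r)) :
  exists2 v : 'rV[R]_r.+1, v != 0 & v *m C = 0.
Proof.
have : kermx C != 0.
  rewrite kermx_eq0 /row_free; apply/negP => /eqP rC.
  by have := rank_leq_col C; rewrite rC ltnn.
case/rowV0Pn => v /sub_kermxP vC v0; exists v => //.
Qed.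

(** If [rank_gt r] fails, A x depends linearly on r coefficients of x. A nonzero residual at j, next
    to the r nonzero ones before, would give r+1 orthonormal vectors in the range of A, and a linear
    dependence among their coefficient vectors refutes their independence. *)
Lemma rank_gtN_residual (r : nat) (y z : nat -> H) :
  ~ rank_gt r -> (forall j, z j = A (y j)) ->
  (forall a, (a < r)%N -> residual ip (gs ip z a) (z a) != 0) ->
  forall j, (r <= j)%N -> residual ip (gs ip z j) (z j) = 0.
Proof.
move=> /existsNP[e /forallNP eA] zA nz j rj; apply/eqP; apply: contraT => nzj.
have eker h : (forall a, ip (e a) h = 0) -> A h = 0.
  by move=> eh; apply/eqP; apply: contra_notT (eA h) => ?; split.
pose f b := gsv ip (extend0 e) b.
have AE x : A x = \sum_(b < r) ip (f b) x *: A (f b).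
  have : A (x - proj ip (gs ip (extend0 e) r) x) = 0.
    apply: eker => a.
    have ea : e a = proj ip (gs ip (extend0 e) r) (e a).
      by rewrite -{2}(extend0E e a) (proj_gs Hip)// extend0E.
    by rewrite ipBr -(proj_sym ip) -ea subrr.
  rewrite linearB => /eqP; rewrite subr_eq0 => /eqP ->.
  rewrite /proj big_gs linear_sum; apply: eq_bigr => b _.
  by rewrite linearZ.
have ran n : exists x, gsv ip z n = A x.
  have [m] := ubnP n; elim: m n => [//|m IH] n nm.
  have /choice[u uE] : forall i, exists x, (i < n)%N -> gsv ip z i = A x.
    move=> i; case: (ltnP i n) => ni; last by exists 0.
    have [x xE] := IH i (leq_trans ni nm); by exists x.
  exists (`|residual ip (gs ip z n) (z n)|^-1 *:
    (y n - \sum_(i < n) ip (gsv ip z i) (z n) *: u i)).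
  rewrite linearZ linearB linear_sum -zA /= [LHS]/gsv [LHS]/normalize; congr (_ *: _).
  rewrite residualE /proj big_gs; congr (_ - _); apply: eq_bigr => i _.
  by rewrite [RHS]linearZ /= -uE.
have /choice[x xE] := ran.
(* The r+1 indices in question: the first r, then j. *)
pose idx (a : 'I_r.+1) : nat := if (a < r)%N then nat_of_ord a else j.
have idx_inj a b : idx a = idx b -> a = b.
  have ar := ltn_ord a; have br := ltn_ord b.
  by rewrite /idx; case: ltnP => ?; case: ltnP => ?; move=> ab; apply/val_inj => /=; lia.
have idx_nz a : gsv ip z (idx a) != 0.
  rewrite /gsv /normalize scaler_eq0 invr_eq0 normr_eq0 orbb /idx.
  by case: ltnP => // ?; exact: nz.
pose C := \matrix_(a < r.+1, b < r) ip (f b) (x (idx a)).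
have [v v0 vC] := kernel_vec C.
have vd : \sum_a v 0 a *: gsv ip z (idx a) = 0.
  transitivity (\sum_b (v *m C) 0 b *: A (f b)); last first.
    by rewrite vC big1// => b _; rewrite mxE scale0r.
  under eq_bigr do rewrite xE AE scaler_sumr.
  rewrite exchange_big /=; apply: eq_bigr => b _.
  rewrite mxE scaler_suml; apply: eq_bigr => a _.
  by rewrite scalerA mxE.
case/negP: v0; apply/eqP/rowP => a; rewrite mxE.
have := congr1 (ip (gsv ip z (idx a))) vd; rewrite ip0r ip_sumr (bigD1 a)//= big1 ?addr0.
  by rewrite ipZr (gs_norm Hip) idx_nz mulr1.
move=> b ba; rewrite ipZr (gs_ortho Hip) ?mulr0//.
by apply: contra ba => /eqP/idx_inj ->.
Qed.

(* Beyond the rank of A, Gram-Schmidt yields 0 for the limit and, eventually, for the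
   approximants; before it, no residual of the limit vanishes. *)
Lemma cvg_gsv_range (k : nat) (z_ y_ : nat -> nat -> H) (z : nat -> H) :
  (forall n j, z_ n j = A (y_ n j)) ->
  (forall j, (j < k)%N -> z_ n j @[n --> \oo] --> z j) ->
  (forall j, (j < k)%N -> (forall i, (i <= j)%N -> rank_gt i) ->
     residual ip (gs ip z j) (z j) != 0) ->
  forall j, (j < k)%N -> gsv ip (z_ n) j @[n --> \oo] --> gsv ip z j.
Proof.
move=> zA zz nz; apply: cvg_gsv => // j jk.
have [rj|nrj] := pselect (forall i, (i <= j)%N -> rank_gt i); first by left; exact: nz.
right.
have {nrj} : exists i, `[< ~ rank_gt i >] && (i <= j)%N.
  by move/existsNP : nrj => [i /not_implyP[ij nr]]; exists i; rewrite ij andbT; apply/asboolP.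
(* With r the least index at which [rank_gt] fails, the limiting residuals below r are nonzero,
   hence eventually those of the approximants; [rank_gtN_residual] then annihilates the approximants
   at j. *)
move=> ex; case: (ex_minnP ex) => r /andP[/asboolP nr rj] rmin.
have rlt i : (i < r)%N -> rank_gt i.
  move=> ir; apply: contrapT => nri.
  have ij : (i <= j)%N by apply: leq_trans rj; exact: ltnW.
  have := rmin i; rewrite ij andbT leqNgt ir => /(_ (asboolT nri)).
  by [].
have rk : (r <= k)%N by apply: leq_trans rj (ltnW jk).
have nzr a : (a < r)%N -> residual ip (gs ip z a) (z a) != 0.
  move=> ar; apply: nz; first exact: leq_trans ar rk.
  by move=> i ia; apply: rlt; exact: leq_ltn_trans ia ar.
have cr a : (a < r)%N -> gsv ip (z_ n) a @[n --> \oo] --> gsv ip z a.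
  apply: cvg_gsv => // b br; first by apply: zz; exact: leq_trans br rk.
  by left; exact: nzr.
have near_nz a : (a < r)%N -> \forall n \near \oo, residual ip (gs ip (z_ n) a) (z_ n a) != 0.
  move=> ar.
  have rr : residual ip (gs ip (z_ n) a) (z_ n a) @[n --> \oo] --> residual ip (gs ip z a) (z a).
    apply: cvgB; first by apply: zz; exact: leq_trans ar rk.
    apply: cvg_proj_gs => //; last by apply: zz; exact: leq_trans ar rk.
    by move=> b ba; apply: cr; exact: ltn_trans ba ar.
  exact: (cvgr_neq0 _ rr (nzr a ar)).
have : \forall n \near \oo, forall a : 'I_r, residual ip (gs ip (z_ n) a) (z_ n a) != 0.
  by apply: filter_forall => a; exact: near_nz.
apply: filterS => n nzn.
apply: (@rank_gtN_residual r (y_ n)) => // a ar.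
exact: (nzn (Ordinal ar)).
Qed.

End range_rank.

Section sampled_projector.
Context {R : realType} (H : completeNormedModType R) (ip : {dot H for idfun}).
Hypothesis Hip : norm_induced_by ip.
Variable A : {linear H -> H}.
Variable k : nat.

Definition frame (z : 'I_k -> H) : seq H := gs ip (extend0 z) k.

Lemma frame_mem z v : v \in frame z -> proj ip (frame z) v = v.
Proof. exact: proj_gs_mem. Qed.

Lemma residual_sym Q x y : ip (residual ip Q x) y = ip x (residual ip Q y).
Proof. by rewrite !residualE ipBl ipBr proj_sym. Qed.

Lemma residual_idem z x :
  residual ip (frame z) (residual ip (frame z) x) = residual ip (frame z) x.
Proof.
have e : proj ip (frame z) (residual ip (frame z) x) = 0.
  rewrite residualE projD -scaleN1r projZ (proj_incl x (@frame_mem z)).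
  by rewrite scaleN1r subrr.
by rewrite [LHS]residualE e subr0.
Qed.

Lemma residual_frame_sq z x :
  ip x (residual ip (frame z) x) = ip (residual ip (frame z) x) (residual ip (frame z) x).
Proof. by rewrite residual_sym residual_idem. Qed.

Lemma residual_sq_le z x : ip (residual ip (frame z) x) (residual ip (frame z) x) <= ip x x.
Proof.
rewrite -residual_frame_sq residualE ipBr gerBl.
rewrite -(proj_incl x (@frame_mem z)) -proj_sym; exact: ip_ge0.
Qed.

Lemma residual_basis Q z : orthonormal_basis_of_span ip Q z ->
  residual ip Q =1 residual ip (frame z).
Proof.
move=> /(basis_of_span_gs Hip)[h1 h2] x.
by rewrite !residualE (eq_proj h1 h2).
Qed.

Lemma compressed_trace_basis Q z : orthonormal_basis_of_span ip Q z ->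
  compressed_trace ip A Q = compressed_trace ip A (frame z).
Proof. by move=> /(basis_of_span_gs Hip)[h1 h2]; exact: eq_compressed_trace. Qed.

Lemma compressed_trace_frame z :
  compressed_trace ip A (frame z) =
  \sum_(j < k) ip (A (gsv ip (extend0 z) j)) (gsv ip (extend0 z) j).
Proof. by rewrite /compressed_trace /frame gsE big_map -{1}(subn0 k) -/(index_iota 0 k) big_mkord. Qed.

Lemma gsv_norm_le1 z j : `|gsv ip z j| <= 1.
Proof.
rewrite -(@ler_pXn2r _ 2)// ?nnegrE// -(ip_norm Hip) (gs_norm Hip) expr1n.
by case: (_ != _); rewrite ?lexx ?ler01.
Qed.

Lemma compressed_trace_frame_le (M : R) z : 0 <= M -> (forall x, `|A x| <= M * `|x|) ->
  compressed_trace ip A (frame z) <= k%:R * M.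
Proof.
move=> M0 AM; rewrite compressed_trace_frame.
apply: (@le_trans _ _ (\sum_(j < k) M)); last by rewrite sumr_const card_ord mulr_natl.
apply: ler_sum => j _; apply: le_trans (ler_norm _) _.
apply: le_trans (ip_cauchy Hip _ _) _.
have e1 := gsv_norm_le1 (extend0 z) j.
rewrite -[leRHS]mulr1; apply: ler_pM => //.
by apply: le_trans (AM _) _; rewrite ler_piMr.
Qed.

Lemma compressed_trace_frame_ge0 z : (forall x, 0 <= ip (A x) x) ->
  0 <= compressed_trace ip A (frame z).
Proof. by move=> A0; rewrite compressed_trace_frame; apply: sumr_ge0. Qed.

End sampled_projector.

Lemma big_iota_ord (V : nmodType) n (F : nat -> V) :
  \sum_(i <- iota 0 n) F i = \sum_(i < n) F i.
Proof. by rewrite -(big_mkord xpredT F) /index_iota subn0. Qed.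

(** * Gaussian elements of H *)

Section gaussian_cf.
Context {R : realType} (H : completeNormedModType R) (ip : {dot H for idfun}).
Hypothesis Hip : norm_induced_by ip.

Lemma measurable_ip_borel h : measurable_fun setT (fun x : borel H => ip x h).
Proof.
apply: (measurability _ (RGenOInfty.measurableE R)) => _ [_ [x ->] <-].
rewrite setTI; apply: sub_sigma_algebra.
apply: open_comp; last exact: interval_open.
by move=> y _; exact: continuous_ipl.
Qed.

Lemma wmeasurable_rv d (O : measurableType d) (P : probability O R)
  (X : {RV P >-> borel H}) : wmeasurable ip (X : O -> H).
Proof.
move=> h; apply: (measurableT_comp (measurable_ip_borel h)).
exact: (@measurable_funP _ _ _ _ setT X).
Qed.

(** X is centred Gaussian with covariance form v: the phase b records the cosine and the sine part
    of the characteristic function at h in one real identity. *)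
Definition gauss_cf d (O : measurableType d) (P : probability O R)
    (X : O -> H) (v : H -> R) : Prop :=
  forall h b, \int[P]_t cos (ip (X t) h + b) = expR (- (v h / 2)) * cos b.

Let cos_le (x : R) : `|cos x| <= 1.
Proof. by rewrite ler_norml cos_geN1 cos_le1. Qed.

Let mcos : measurable_fun setT (@cos R).
Proof. by apply: continuous_measurable_fun; exact: continuous_cos. Qed.

Lemma gauss_cf_same_law d (O : measurableType d) (P : probability O R)
  d' (O' : measurableType d') (P' : probability O' R)
  (X : {RV P >-> borel H}) (Y : {RV P' >-> borel H}) v :
  same_law (distribution P X) (distribution P' Y) ->
  gauss_cf P' (Y : O' -> H) v -> gauss_cf P (X : O -> H) v.
Proof.
move=> XY cY h b; rewrite -cY.
have mc : measurable_fun setT (fun x : borel H => cos (ip x h + b)).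
  apply: measurableT_comp => //; apply: measurable_funD => //.
  exact: measurable_ip_borel.
have E d1 (O1 : measurableType d1) (P1 : probability O1 R) (Z : {RV P1 >-> borel H}) :
    \int[P1]_t cos (ip (Z t) h + b) = \int[distribution P1 Z]_x cos (ip x h + b).
  congr fine; rewrite integral_pushforward//; first exact/measurable_EFinP.
  apply: (@bounded_integrable _ _ _ P1 _ 1) => //.
  exact: (measurableT_comp mc (@measurable_funP _ _ _ _ setT Z)).
rewrite !E; congr fine; apply: eq_measure_integral => S mS _; exact: XY.
Qed.

Lemma gauss_cf_sum d (O : measurableType d) (P : probability O R) (I : choiceType)
  (w : I -> {RV P >-> R}) (a : I -> H) (l : seq I) :
  iid_std_normal w -> uniq l ->
  gauss_cf P (fun t => \sum_(i <- l) w i t *: a i)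
    (fun h => \sum_(i <- l) ip (a i) h ^+ 2).
Proof.
move=> iidw ul h b.
have := @Rintegral_cos_sum _ _ _ P _ _ _ w (fun i x => ip (a i) h * x)
  (fun i => expR (- (ip (a i) h ^+ 2 / 2))) iidw.1 _ _ l b ul.
rewrite -expR_sum sumrN -mulr_suml => <-.
- apply: eq_Rintegral => t _; rewrite ip_suml; congr (cos (_ + b)).
  by apply: eq_bigr => i _; rewrite ipZl mulrC.
- by move=> i; exact: measurable_funM.
- by move=> i c; exact: (Rintegral_cos_normal _ _ (iidw.2 i)).
Qed.

Lemma gauss_cf_truncated (q : nat -> H) n d (O : measurableType d) (P : probability O R)
  (X : {RV P >-> borel H}) : truncated_law q n X ->
  gauss_cf P (X : O -> H) (fun h => \sum_(j < n) ip (q j) h ^+ 2).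
Proof.
move=> [d' [Om' [P' [g [Y [iidg YE XY]]]]]].
apply: (gauss_cf_same_law XY) => h b.
have := gauss_cf_sum (fun j : 'I_n => q j) iidg (index_enum_uniq _) h b.
by move=> <-; apply: eq_Rintegral => t _; rewrite YE.
Qed.

Lemma gauss_cf_cvg d (O : measurableType d) (P : probability O R)
  (X_ : nat -> O -> H) (X : O -> H) (v_ : nat -> H -> R) v :
  (forall n, wmeasurable ip (X_ n)) -> wmeasurable ip X ->
  {ae P, forall t, X_ n t @[n --> \oo] --> X t} ->
  (forall n, gauss_cf P (X_ n) (v_ n)) ->
  (forall h, v_ n h @[n --> \oo] --> v h) -> gauss_cf P X v.
Proof.
move=> mX_ mX XX cX vv h b.
have mc (Y : O -> H) : wmeasurable ip Y -> measurable_fun setT (fun t => cos (ip (Y t) h + b)).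
  by move=> mY; apply: measurableT_comp => //; apply: measurable_funD => //; exact: mY.
have c1 : \int[P]_t cos (ip (X_ n t) h + b) @[n --> \oo] --> \int[P]_t cos (ip (X t) h + b).
  apply: (@Rintegral_dct _ _ _ P _ _ 1) => //.
  - by move=> n; exact: mc.
  - exact: mc.
  - apply: filterS XX => t Xt.
    apply: (cvg_comp (fun n => ip (X_ n t) h + b) cos); last exact: continuous_cos.
    apply: cvgD; last exact: cvg_cst.
    exact: (@cvg_ip _ _ _ Hip \oo _ _ _ _ _ Xt (cvg_cst h)).
have c2 : \int[P]_t cos (ip (X_ n t) h + b) @[n --> \oo] --> expR (- (v h / 2)) * cos b.
  under eq_fun do rewrite cX.
  apply: cvgM; last exact: cvg_cst.
  apply: (cvg_comp (fun n => - (v_ n h / 2)) expR); last exact: continuous_expR.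
  by apply: cvgN; apply: cvgM; [exact: vv|exact: cvg_cst].
exact: (cvg_unique _ c1 c2).
Qed.

(** The partial sums of the Karhunen-Loeve series have the forms sum_i s_i <u_i, h>^2, which tend to
    <B h, h> by the spectral decomposition. *)
Lemma gauss_cf_gaussian (B : H -> H) d (O : measurableType d) (P : probability O R)
  (X : {RV P >-> borel H}) : gaussian_law ip B X ->
  gauss_cf P (X : O -> H) (fun h => ip (B h) h).
Proof.
move=> [s [u [sd [d' [Om' [P' [w [Y [iidw YE XY]]]]]]]]].
apply: (gauss_cf_same_law XY).
pose X_ n t : H := \sum_(i <- iota 0 n) w i t *: (Num.sqrt (s i) *: u i).
have XE n t : X_ n t = \sum_(i < n) (w i t * Num.sqrt (s i)) *: u i.
  rewrite /X_ big_iota_ord.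
  by apply: eq_bigr => i _; rewrite scalerA.
have mw i : measurable_fun setT (w i) by exact: (@measurable_funP _ _ _ _ setT (w i)).
apply: (@gauss_cf_cvg _ _ _ X_ _ (fun n h => \sum_(i <- iota 0 n) ip (Num.sqrt (s i) *: u i) h ^+ 2)).
- by move=> n; apply: wmeasurable_sum => i; apply: wmeasurableZ => //; exact: wmeasurable_cst.
- exact: wmeasurable_rv.
- by apply: filterS YE => t Yt; under eq_fun do rewrite XE.
- by move=> n; apply: gauss_cf_sum => //; exact: iota_uniq.
- move=> h; apply: eq_cvgn (@cvg_ip _ _ _ Hip \oo _ _ _ _ _ (@sd_sum _ _ _ _ _ _ sd h) (cvg_cst h)) => n.
  rewrite big_iota_ord ip_suml.
  apply: eq_bigr => i _; rewrite !ipZl exprMn sqr_sqrtr; first by ring.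
  exact: sd_ge0 sd i.
Qed.

Lemma joint_cf d (O : measurableType d) (P : probability O R) (I : finType)
  (X : I -> {RV P >-> borel H}) (v : I -> H -> R) :
  mutually_independent X -> (forall i, gauss_cf P (X i : O -> H) (v i)) ->
  forall (h : I -> H) b,
  \int[P]_t cos (\sum_i ip (X i t : H) (h i) + b) = expR (- (\sum_i v i (h i) / 2)) * cos b.
Proof.
move=> indX cX h b.
have := @Rintegral_cos_sum _ _ _ P _ _ _ X (fun i (x : borel H) => ip x (h i))
  (fun i => expR (- (v i (h i) / 2))) indX _ _ (index_enum I) b (index_enum_uniq _).
rewrite -expR_sum sumrN => <- //.
- by move=> i; exact: measurable_ip_borel.
- by move=> i c; exact: cX.
Qed.

End gaussian_cf.

(** * Second moments and absence of atoms from cosine transforms *)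

Section sine_bounds.
Context {R : realType}.
Implicit Types x y : R.

Lemma norm_sin_le y : `|sin y| <= `|y|.
Proof.
wlog y0 : y / 0 <= y => [H|].
  have [y0|/ltW y0] := leP 0 y; first exact: H.
  by have := H (- y); rewrite oppr_ge0 sinN !normrN => /(_ y0).
have D x : x \in `]0, y[%R -> is_derive x 1 sin (cos x) by move=> _; exact: is_derive_sin.
have C : {within `[0, y], continuous sin} by apply: continuous_subspaceT => x; exact: continuous_sin.
have [c _] := MVT_segment y0 D C.
by rewrite sin0 !subr0 => ->; rewrite normrM ler_piMl// cos_max.
Qed.

(** By the mean value theorem and 1 - cos c = 2 sin(c/2)^2. The cubic order makes n sin(U/n) tend to
    U. *)
Lemma norm_sin_sub_le y : `|sin y - y| <= `|y| ^+ 3.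
Proof.
wlog y0 : y / 0 <= y => [H|].
  have [y0|/ltW y0] := leP 0 y; first exact: H.
  have := H (- y); rewrite oppr_ge0 => /(_ y0).
  rewrite sinN opprK (_ : - sin y + y = - (sin y - y)); last by ring.
  by rewrite !normrN.
have D x : is_derive x 1 (fun x => sin x - x) (cos x - 1) by apply: is_derive_eq.
have C : {within `[0, y], continuous (fun x => sin x - x)}.
  apply: continuous_subspaceT => x; apply: differentiable_continuous.
  by apply/derivable1_diffP; have [] := D x.
have [c] := MVT_segment y0 (fun x _ => D x) C.
rewrite in_itv/= sin0 !subr0 => /andP[c0 cy] ->.
rewrite normrM exprSr ler_wpM2r//.
have -> : cos c - 1 = - (sin (c / 2) ^+ 2 *+ 2).
  have -> : cos c = cos (c / 2 *+ 2) by congr cos; rewrite -mulr_natr; field.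
  by rewrite cos_mulr2n cos2sin2; ring.
rewrite normrN ger0_norm ?mulrn_wge0 ?sqr_ge0//.
have := norm_sin_le (c / 2); rewrite (ger0_norm y0) (ger0_norm (_ : 0 <= c / 2)) ?divr_ge0//.
rewrite -(real_normK (num_real (sin _))) mulr2n; have := normr_ge0 (sin (c / 2)).
set a := `|sin _| => a0 ac.
have h1 : a * a <= c / 2 * (c / 2) by rewrite ler_pM.
have h2 : c * c <= y * y by rewrite ler_pM.
by have := mulr_ge0 c0 c0; rewrite !expr2; lra.
Qed.

End sine_bounds.

Section second_moment.
Context {R : realType} d (O : measurableType d) (P : probability O R).
Variables (U : O -> R) (v : R).
Hypotheses (mU : measurable_fun setT U) (v0 : 0 <= v).
Hypothesis cosU : forall s : R, \int[P]_t cos (s * U t) = expR (- (s ^+ 2 * v / 2)).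

Let f n t : R := (n.+1%:R * sin (U t / n.+1%:R)) ^+ 2.

Let mf n : measurable_fun setT (f n).
Proof.
apply: measurable_funX; apply: measurable_funM => //.
apply: measurableT_comp; first by apply: continuous_measurable_fun; exact: continuous_sin.
exact: measurable_funM.
Qed.

Let fE n t : f n t = n.+1%:R ^+ 2 / 2 * (1 - cos (2 / n.+1%:R * U t)).
Proof.
have -> : 2 / n.+1%:R * U t = U t / n.+1%:R *+ 2 by rewrite -mulr_natr; ring.
by rewrite /f cos_mulr2n cos2sin2; field.
Qed.

Let If n : (\int[P]_t (f n t)%:E =
  (n.+1%:R ^+ 2 / 2 * (1 - expR (- (2 * v / n.+1%:R ^+ 2))))%:E)%E.
Proof.
have ic : P.-integrable setT (EFin \o (fun t => cos (2 / n.+1%:R * U t))).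
  apply: (@bounded_integrable _ _ _ P _ 1); last by move=> t; exact: cos_max.
  apply: measurableT_comp; first by apply: continuous_measurable_fun; exact: continuous_cos.
  exact: measurable_funM.
have i1 : P.-integrable setT (EFin \o cst 1) by exact: (finite_measure_integrable_cst P 1 measurableT).
have i2 : P.-integrable setT (EFin \o (fun t => 1 - cos (2 / n.+1%:R * U t))).
  by rewrite /comp; under eq_fun do rewrite EFinB; exact: integrableB.
under eq_integral do rewrite fE.
rewrite -EFin_Rintegral; last exact: integrable_scalel.
have I1 : \int[P]_t (1 : R) = 1.
  by rewrite Rintegral_cst// [X in fine X]probability_setT mul1r.
rewrite RintegralZl// RintegralB// cosU [X in _ * (X - _)]I1.
by congr (_ * (_ - expR (- _)))%:E; field.
Qed.

(* n sin(U/n) tends to U, and the mean of its square is given by the cosines. *)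
Lemma gauss_second_moment : (\int[P]_t (U t ^+ 2)%:E = v%:E)%E.
Proof.
have fU t : f n t @[n --> \oo] --> U t ^+ 2.
  have h : n.+1%:R * sin (U t / n.+1%:R) @[n --> \oo] --> U t.
    apply/subr_cvg0/norm_cvg0P.
    have ub : `|U t| ^+ 3 * n.+1%:R^-1 @[n --> \oo] --> (0 : R).
      by rewrite -[X in _ --> X](mulr0 (`|U t| ^+ 3)); apply: cvgM; [exact: cvg_cst|exact: cvg_harmonic].
    apply: (squeeze_cvgr _ (cvg_cst 0) ub); apply: nearW => n; rewrite normr_ge0/=.
    have n0 : 1 <= n.+1%:R :> R by rewrite ler1n.
    have n1 : n.+1%:R != 0 :> R by rewrite pnatr_eq0.
    have -> : n.+1%:R * sin (U t / n.+1%:R) - U t =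
      n.+1%:R * (sin (U t / n.+1%:R) - U t / n.+1%:R) by field.
    rewrite normrM ger0_norm//.
    apply: le_trans (ler_wpM2l _ (norm_sin_sub_le _)) _ => //.
    rewrite normrM exprMn normfV (ger0_norm (ler0n _ _)) mulrCA ler_wpM2l ?exprn_ge0//.
    rewrite exprVn exprS invfM mulrA divff// mul1r lef_pV2 ?posrE ?exprn_gt0//.
    by rewrite expr2 ler_peMl.
  by rewrite expr2; under eq_fun do rewrite /f expr2; exact: cvgM.
have f_le n t : f n t <= U t ^+ 2.
  rewrite /f exprMn -(real_normK (num_real (sin _))) -(real_normK (num_real (U t))).
  have := norm_sin_le (U t / n.+1%:R); rewrite normrM normfV (ger0_norm (ler0n _ _)) => h.
  by rewrite -exprMn lerXn2r ?nnegrE ?mulr_ge0// mulrC -ler_pdivlMr.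
have mU2 : measurable_fun setT (fun t => (U t ^+ 2)%:E).
  by apply/measurable_EFinP; exact: measurable_funX.
pose a n := n.+1%:R ^+ 2 / 2 * (1 - expR (- (2 * v / n.+1%:R ^+ 2))).
have n0 n : 0 < n.+1%:R ^+ 2 / 2 :> R by rewrite divr_gt0// exprn_gt0.
have x0 n : 0 <= 2 * v / n.+1%:R ^+ 2 by rewrite !mulr_ge0// invr_ge0 exprn_ge0.
have a_le n : a n <= v.
  have := expR_ge1Dx (- (2 * v / n.+1%:R ^+ 2)); set e := expR _ => he.
  have E : n.+1%:R ^+ 2 / 2 * (2 * v / n.+1%:R ^+ 2) = v by field.
  by rewrite -[leRHS]E /a -/e ler_wpM2l ?(ltW (n0 n))//; rewrite lerBlDr -lerBlDl.
have a_ge n : v / (1 + 2 * v / n.+1%:R ^+ 2) <= a n.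
  have := expR_ge1Dx (2 * v / n.+1%:R ^+ 2); rewrite /a expRN.
  have := x0 n; set x := 2 * v / _ => hx he.
  have -> : v / (1 + x) = n.+1%:R ^+ 2 / 2 * (x / (1 + x)).
    by rewrite mulrA (_ : _ * x = v)// /x; field.
  rewrite ler_wpM2l ?(ltW (n0 n))//.
  have -> : x / (1 + x) = 1 - (1 + x)^-1 by field; rewrite gt_eqF// ltr_wpDr.
  by rewrite lerD2l lerN2 lef_pV2 ?posrE ?expR_gt0// ltr_wpDr.
have av : a n @[n --> \oo] --> v.
  have lo : v / (1 + 2 * v / n.+1%:R ^+ 2) @[n --> \oo] --> v.
    rewrite -[X in _ --> X]divr1; apply: cvgM; first exact: cvg_cst.
    apply: cvgV; first exact: oner_neq0.
    rewrite -[X in _ --> X]addr0; apply: cvgD; first exact: cvg_cst.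
    rewrite -[X in _ --> X](mulr0 (2 * v)); apply: cvgM; first exact: cvg_cst.
    have h : n.+1%:R^-1 * n.+1%:R^-1 @[n --> \oo] --> (0 : R).
      by rewrite -[X in _ --> X](mulr0 0); apply: cvgM; exact: cvg_harmonic.
    by apply: eq_cvgn h => n; rewrite expr2 invfM.
  by apply: (squeeze_cvgr _ lo (cvg_cst v)); apply: nearW => n; rewrite a_ge a_le.
have aEv : (a n)%:E @[n --> \oo] --> v%:E by apply: cvg_EFin; [exact: nearW|exact: av].
(* Fatou's lemma bounds the second moment above by the limit v of the means [a n]; the pointwise
   inequality f_n <= U^2 gives the other direction. *)
apply/eqP; rewrite eq_le; apply/andP; split.
  have := @fatou _ _ _ P setT measurableT (fun n t => (f n t)%:E)
    (fun n => proj2 (measurable_EFinP _ _) (mf n)).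
  have -> : (\int[P]_t limn_einf (fun n => (f n t)%:E) = \int[P]_t (U t ^+ 2)%:E)%E.
    apply: eq_integral => t _; have c : (f n t)%:E @[n --> \oo] --> (U t ^+ 2)%:E.
      by apply: cvg_EFin; [exact: nearW|exact: fU].
    by rewrite is_cvg_limn_einfE; [exact: cvg_lim|apply/cvg_ex; eexists; exact: c].
  have f0 n t : [set: O] t -> (0 <= (f n t)%:E)%E by move=> _; rewrite lee_fin sqr_ge0.
  move=> /(_ f0)/le_trans; apply.
  under eq_fun do rewrite If.
  rewrite is_cvg_limn_einfE; last by apply/cvg_ex; eexists; exact: aEv.
  by rewrite (cvg_lim _ aEv).
rewrite -(cvg_lim _ aEv)//; apply: lime_le; first by apply/cvg_ex; eexists; exact: aEv.
apply: nearW => n; rewrite -If; apply: ge0_le_integral => //.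
- by move=> t _; rewrite lee_fin sqr_ge0.
- by apply/measurable_EFinP.
- by move=> t _; rewrite lee_fin.
Qed.

End second_moment.

Lemma integral_indic_preimage {R : realType} d (O : measurableType d)
    (P : probability O R) (V : O -> R) (S : set R) : measurable_fun setT V -> measurable S ->
  (\int[P]_t (\1_S (V t))%:E = P (V @^-1` S))%E.
Proof.
move=> mV mS; rewrite -(setIT (V @^-1` _)) -integral_indic//.
by rewrite -[X in measurable X]setTI; exact: mV.
Qed.

Section gauss_atomless.
Context {R : realType} d (O : measurableType d) (P : probability O R).
Variables (U : O -> R) (v : R).
Hypotheses (mU : measurable_fun setT U) (v0 : 0 < v).
Hypothesis cosU : forall s b : R,
  \int[P]_t cos (s * U t + b) = expR (- (s ^+ 2 * v / 2)) * cos b.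
Context d'' (O'' : measurableType d'') (P'' : probability O'' R).
Variable w : nat -> {RV P'' >-> R}.
Hypothesis iidw : iid_std_normal w.

(** By uniqueness with a single coordinate, U has the law of sqrt(v) w_0, and the law of w_0 has a
    density. *)
Lemma gauss_atomless : P (U @^-1` [set 0]) = 0%E.
Proof.
pose xi (_ : unit) (x : R) := x.
have mw : measurable_fun setT (w 0%N) by exact: (@measurable_funP _ _ _ _ setT (w 0%N)).
pose X' s := Num.sqrt v * w 0%N s.
have mX' : measurable_fun setT X' by exact: measurable_funM.
have lE (l : seq (unit * R)) x : \sum_(r <- l) r.2 * xi r.1 x = (\sum_(r <- l) r.2) * x.
  by rewrite mulr_suml.
pose F x : \bar R := (\1_[set (0 : R)] x)%:E.
have mF : measurable_fun setT (F : g_sigma_algebraType (cyl xi) -> \bar R).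
  apply/measurable_EFinP.
  exact: (measurableT_comp (measurable_indic (measurable_set1 _)) (@measurable_xi R _ unit xi tt)).
rewrite -integral_indic_preimage//; change (\int[P]_t F (U t) = 0)%E.
rewrite (@ge0_integral_eq_cos _ R unit tt xi _ _ P U _ _ P'' X' _ _ P'' w iidw)//.
- rewrite /F integral_indic_preimage//.
  have -> : X' @^-1` [set 0] = w 0%N @^-1` [set 0].
    apply/seteqP; split=> s /=; rewrite /X'; last by move=> ->; rewrite mulr0.
    by move=> /eqP; rewrite mulf_eq0 gt_eqF ?sqrtr_gt0//= => /eqP.
  have := iidw.2 0%N _ (measurable_set1 0); rewrite /distribution /pushforward => ->.
  by rewrite /normal_prob integral_set1.
- move=> l b; under eq_Rintegral do rewrite lE.
  under [RHS]eq_Rintegral do rewrite lE /X' mulrA.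
  by rewrite cosU (Rintegral_cos_normal _ _ (iidw.2 0%N)) exprMn sqr_sqrtr ?ltW.
- by move=> x; rewrite lee_fin.
Qed.

End gauss_atomless.

Section gauss_norm.
Context {R : realType} (H : completeNormedModType R) (ip : {dot H for idfun}).
Hypothesis Hip : norm_induced_by ip.
Variables (d : measure_display) (O : measurableType d) (P : probability O R).
Variables (X : O -> H) (v : H -> R).
Hypotheses (mX : wmeasurable ip X) (cX : gauss_cf ip P X v).
Hypotheses (v0 : forall h, 0 <= v h) (vZ : forall a h, v (a *: h) = a ^+ 2 * v h).

Lemma gauss_cf_cos h s b :
  \int[P]_t cos (s * ip (X t) h + b) = expR (- (s ^+ 2 * v h / 2)) * cos b.
Proof. by rewrite -vZ -cX; apply: eq_Rintegral => t _; rewrite ipZr. Qed.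

Lemma gauss_cf_moment2 h : (\int[P]_t (ip (X t) h ^+ 2)%:E = (v h)%:E)%E.
Proof.
apply: gauss_second_moment; [exact: mX|exact: v0|] => s.
have := gauss_cf_cos h s 0; rewrite cos0 mulr1 => <-.
by apply: eq_Rintegral => t _; rewrite addr0.
Qed.

(** Parseval pointwise, then termwise integration of a nonnegative series whose terms have mean
    [v (e j)]. *)
Lemma gauss_cf_sqnorm (e : nat -> H) : orthonormal_basis ip e ->
  (\int[P]_t (ip (X t) (X t))%:E = \sum_(0 <= j <oo) (v (e j))%:E)%E.
Proof.
move=> He; under eq_eseriesr do rewrite -gauss_cf_moment2.
rewrite -integral_nneseries//.
- apply: eq_integral => t _; apply/esym/cvg_lim => //.
  have := @parseval _ _ _ Hip e He (X t) (X t).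
  move=> h; apply: (@eq_cvgn _ (fun n => (\sum_(j < n) ip (X t) (e j) * ip (X t) (e j))%:E)).
    by move=> n; rewrite big_mkord sumEFin.
  by apply: cvg_EFin; [exact: nearW|exact: h].
- by move=> n; apply/measurable_EFinP; apply: measurable_funX; exact: mX.
- by move=> n t _; rewrite lee_fin sqr_ge0.
Qed.

End gauss_norm.

(** * Laws of finite families of random vectors *)

Section families.
Context {R : realType} (H : completeNormedModType R) (ip : {dot H for idfun}).
Hypothesis Hip : norm_induced_by ip.
Variables (q : nat -> H) (Hq : orthonormal_basis ip q).
Variables (K : finType) (c0 : K).

Definition coord (r : K * nat) (x : K -> H) : R := ip (x r.1) (q r.2).

Notation famT := (g_sigma_algebraType (cyl coord)).

Lemma wmeasurable_fam c : wmeasurable ip (fun x : famT => x c).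
Proof.
move=> h.
apply: (@measurable_fun_cvg _ _ _ _ (fun n (x : famT) => \sum_(j < n) ip (x c) (q j) * ip h (q j))).
  move=> n; apply: measurable_sum => j; apply: measurable_funM => //.
  exact: (@measurable_xi _ _ _ coord (c, nat_of_ord j)).
by move=> x _; exact: parseval.
Qed.

Context d (O : measurableType d) (P : probability O R) (X : O -> K -> H).
Context d' (O' : measurableType d') (P' : probability O' R) (X' : O' -> K -> H).
Context d'' (O'' : measurableType d'') (P'' : probability O'' R).
Variable w : nat -> {RV P'' >-> R}.
Hypothesis iidw : iid_std_normal w.
Hypotheses (mX : forall c, wmeasurable ip (X ^~ c)) (mX' : forall c, wmeasurable ip (X' ^~ c)).
Hypothesis cosE : forall (h : K -> H) b,
  \int[P]_t cos (\sum_c ip (X t c) (h c) + b) =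
  \int[P']_t cos (\sum_c ip (X' t c) (h c) + b).

(** Measurability of F is asked along all weakly measurable families, in particular along the
    identity of the sigma-algebra generated by the coordinates. A linear combination of coordinates
    is a sum of inner products with finite combinations of the q_j, so [cosE] yields the hypothesis
    of [ge0_integral_eq_cos]. *)
Lemma ge0_integral_fam (F : (K -> H) -> \bar R) :
  (forall d1 (O1 : measurableType d1) (z : O1 -> K -> H),
    (forall c, wmeasurable ip (z ^~ c)) -> measurable_fun setT (F \o z)) ->
  (forall x, (0 <= F x)%E) -> (\int[P]_t F (X t) = \int[P']_t F (X' t))%E.
Proof.
move=> /(_ _ famT id wmeasurable_fam) mF; move: mF.
apply: (@ge0_integral_eq_cos _ _ _ (c0, 0%N) coord _ _ P X _ _ P' X' _ _ P'' w iidw).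
- by move=> r; exact: mX.
- by move=> r; exact: mX'.
move=> l b.
have lE (x : K -> H) : \sum_(r <- l) r.2 * coord r.1 x =
    \sum_c ip (x c) (\sum_(r <- l | r.1.1 == c) r.2 *: q r.1.2).
  under [RHS]eq_bigr do rewrite ip_sumr.
  rewrite (exchange_big_dep xpredT)//=; apply: eq_bigr => r _.
  rewrite (big_pred1 r.1.1) ?ipZr// => c; by rewrite /= eq_sym.
under eq_Rintegral do rewrite lE.
under [RHS]eq_Rintegral do rewrite lE.
exact: cosE.
Qed.

End families.

Section iid_reindex.
Context {R : realType} d (O : measurableType d) (P : probability O R).
Context (I J : choiceType) (w : J -> {RV P >-> R}).
Hypothesis iidw : iid_std_normal w.

Lemma iid_std_normal_reindex (f : I -> J) (g : J -> option I) :
  pcancel f g -> iid_std_normal (fun i => w (f i)).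
Proof.
move=> fK; split=> [B S mS|i]; last exact: (iidw.2 (f i)).
pose S' j : set R := if g j is Some i then S i else setT.
have mS' j : measurable (S' j) by rewrite /S'; case: (g j) => *; [exact: mS|exact: measurableT].
have SE i : S' (f i) = S i by rewrite /S' fK.
have := @mutually_independent_seq _ _ _ P _ _ _ w iidw.1 (map f B) S' _ mS'.
rewrite (map_inj_uniq (pcan_inj fK)) => /(_ (fset_uniq B)).
rewrite big_map; under eq_bigr do rewrite SE.
move=> <-; congr (P _); apply/seteqP; split=> t /=.
  by move=> h _ /mapP[i iB ->]; rewrite SE; exact: h.
by move=> h i iB; rewrite -SE; apply: h => /=; exact: map_f.
Qed.

End iid_reindex.

Section gauss_family.
Context {R : realType} (H : completeNormedModType R) (ip : {dot H for idfun}).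
Hypothesis Hip : norm_induced_by ip.
Context d (O : measurableType d) (P : probability O R).
Variables (I : finType) (w : I * nat -> {RV P >-> R}) (a : nat -> H).
Hypothesis iidw : iid_std_normal w.

Lemma gauss_cf_family n (h : I -> H) b :
  \int[P]_t cos (\sum_c ip (\sum_(j < n) w (c, val j) t *: a j) (h c) + b) =
  expR (- (\sum_c (\sum_(j < n) ip (a j) (h c) ^+ 2) / 2)) * cos b.
Proof.
pose l := [seq (c, j) | c <- index_enum I, j <- iota 0 n].
have ul : uniq l.
  by apply: allpairs_uniq; [exact: index_enum_uniq|exact: iota_uniq|move=> [? ?] [? ?]].
have := @Rintegral_cos_sum _ _ _ P _ _ _ w (fun r x => ip (a r.2) (h r.1) * x)
  (fun r => expR (- (ip (a r.2) (h r.1) ^+ 2 / 2))) iidw.1 _ _ l b ul.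
rewrite -expR_sum sumrN /l !big_allpairs/= => E.
have -> : \sum_c (\sum_(j < n) ip (a j) (h c) ^+ 2) / 2 =
    \sum_c \sum_(j <- iota 0 n) ip (a j) (h c) ^+ 2 / 2.
  by apply: eq_bigr => c _; rewrite mulr_suml big_iota_ord.
rewrite -{}E.
- apply: eq_Rintegral => t _; rewrite big_allpairs/=; congr (cos (_ + b)).
  apply: eq_bigr => c _; rewrite ip_suml big_iota_ord.
  by apply: eq_bigr => j _; rewrite ipZl mulrC.
- by move=> r; exact: measurable_funM.
- by move=> r c; exact: (Rintegral_cos_normal _ _ (iidw.2 r)).
Qed.

End gauss_family.

Section positive_operator.
Context {R : realType} (H : completeNormedModType R) (ip : {dot H for idfun}).
Hypothesis Hip : norm_induced_by ip.
Variable A : {linear H -> H}.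
Hypothesis HA : positive_trace_class ip A.

(* Positivity of A at x - M^-1 A x, with M a bound of A. *)
Lemma psd_sqnorm_le : exists M : R, 0 < M /\ forall x, ip (A x) (A x) <= M * ip (A x) x.
Proof.
have [M0 M0P] := ptc_bounded HA.
pose M := `|M0| + 1; have Mgt : 0 < M by rewrite ltr_wpDl.
have MP x : `|A x| <= M * `|x|.
  by apply: le_trans (M0P x) _; rewrite ler_wpM2r// (le_trans (ler_norm _))// lerDl.
exists M; split=> // x.
have h := ptc_positive HA (x - M^-1 *: A x).
have AAle : ip (A (A x)) (A x) <= M * ip (A x) (A x).
  rewrite (ip_norm Hip (A x)) expr2 mulrA.
  apply: le_trans (ler_norm _) _; apply: le_trans (ip_cauchy Hip _ _) _.
  by rewrite ler_wpM2r.
have E : ip (A (x - M^-1 *: A x)) (x - M^-1 *: A x) =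
    ip (A x) x - 2 * (M^-1 * ip (A x) (A x)) + M^-1 * (M^-1 * ip (A (A x)) (A x)).
  rewrite (_ : A (_ - _) = A x - M^-1 *: A (A x)); last by rewrite linearB linearZ.
  rewrite !(ipBl, ipBr, ipZl, ipZr) (ptc_selfadjoint HA (A x) x).
  by ring.
have h2 : M^-1 * (M^-1 * ip (A (A x)) (A x)) <= M^-1 * ip (A x) (A x).
  by rewrite ler_pM2l ?invr_gt0// ler_pdivrMl.
by rewrite -ler_pdivrMl//; move: h h2; rewrite E; lra.
Qed.

End positive_operator.

(** * Almost sure convergence along fast subsequences *)

Section ae_summable.
Context {R : realType} d (O : measurableType d) (P : probability O R).

Lemma ae_summable (f : nat -> O -> R) :
  (forall p, measurable_fun setT (f p)) -> (forall p t, 0 <= f p t) ->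
  (forall p, \int[P]_t (f p t)%:E <= ((2^-1) ^+ p)%:E)%E ->
  {ae P, forall t, (\sum_(0 <= p <oo) (f p t)%:E < +oo)%E}.
Proof.
move=> mf f0 fle.
have geo : cvgn (series (fun p => (2^-1 : R) ^+ p)).
  have := @is_cvg_geometric_series R 1 2^-1.
  rewrite /geometric/=; under eq_fun do rewrite mul1r.
  by apply; rewrite ger0_norm// invf_lt1// ltr1n.
have mE p : measurable_fun setT (fun t => (f p t)%:E) by exact/measurable_EFinP.
have fE p t : (0 <= (f p t)%:E)%E by rewrite lee_fin.
have i1 : (P.-integrable setT (fun t => \sum_(0 <= p <oo) (f p t)%:E))%E.
  apply/integrableP; split; first exact: ge0_emeasurable_sum.
  under eq_integral do rewrite gee0_abs ?nneseries_ge0//.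
  rewrite integral_nneseries//; apply: (@le_lt_trans _ _ (\sum_(0 <= p <oo) ((2^-1) ^+ p)%:E)%E).
    by apply: lee_nneseries => p *; [exact: integral_ge0|exact: fle].
  have -> : (\sum_(0 <= p <oo) ((2^-1) ^+ p)%:E)%E = (limn (series (fun p => (2^-1 : R) ^+ p)))%:E.
    apply/cvg_lim => //.
    apply: (@eq_cvgn _ (fun n => (series (fun p => (2^-1 : R) ^+ p) n)%:E)).
      by move=> n; rewrite /= sumEFin.
    by apply: cvg_EFin; [exact: nearW|exact: geo].
  by rewrite ltry.
apply: filterS (integrable_ae measurableT i1) => t /(_ Logic.I) ft.
by rewrite ltey_eq ft.
Qed.

End ae_summable.

Section fast_subsequences.
Context {R : realType}.

Lemma subsequence_choice (Q : nat -> nat -> Prop) :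
  (forall p N, exists n, (N <= n)%N /\ Q p n) ->
  exists phi : nat -> nat, (forall p, (phi p < phi p.+1)%N) /\ forall p, Q p (phi p).
Proof.
move=> h0; have h p N := cid (h0 p N); pose next p N := sval (h p N).
pose phi := fix phi p := if p is p'.+1 then next p (phi p').+1 else next 0%N 0%N.
have nextP p N : (N <= next p N)%N /\ Q p (next p N) by exact: (svalP (h p N)).
have phiS p : phi p.+1 = next p.+1 (phi p).+1 by [].
exists phi; split=> [p|[|p]]; first by rewrite phiS; case: (nextP p.+1 (phi p).+1).
  by have [_] := nextP 0%N 0%N.
by rewrite phiS; case: (nextP p.+1 (phi p).+1).
Qed.

Lemma ltn_subsequence (phi : nat -> nat) : (forall p, (phi p < phi p.+1)%N) ->
  phi @ \oo --> \oo.
Proof.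
move=> inc; have le p : (p <= phi p)%N by elim: p => // p /leq_ltn_trans; exact.
apply/cvgnyPge => N; near=> p; apply: leq_trans (le p); near: p; exact: nbhs_infty_ge.
Unshelve. all: by end_near. Qed.

Lemma fast_subsequence (rho eps : nat -> R) : rho @ \oo --> 0 -> (forall p, 0 < eps p) ->
  exists phi : nat -> nat, (forall p, (phi p < phi p.+1)%N) /\ forall p, rho (phi p) <= eps p.
Proof.
move=> rho0 e0; apply: (@subsequence_choice (fun p n => rho n <= eps p)) => p N.
have /cvgrPdist_le /(_ _ (e0 p)) [M _ MP] := rho0.
exists (maxn N M); split; first exact: leq_maxl.
have := MP (maxn N M) (leq_maxr _ _); rewrite /= sub0r normrN; exact: le_trans (ler_norm _).
Qed.

(** If [alpha] stayed away from l infinitely often, indices could be chosen at which it is far from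
    l and [rho] is small at the same time, contrary to the hypothesis. *)
Lemma cvg_fast_subsequences (rho alpha : nat -> R) (l : R) : rho @ \oo --> 0 ->
  (forall phi : nat -> nat, (forall p, (phi p < phi p.+1)%N) ->
    (forall p, rho (phi p) <= 2^-1 ^+ p) -> alpha (phi p) @[p --> \oo] --> l) ->
  alpha @ \oo --> l.
Proof.
move=> rho0 h; apply/cvgrPdist_lt => e e0; apply: contrapT => far.
have [|phi [inc]] := @subsequence_choice (fun p n => rho n <= 2^-1 ^+ p /\ e <= `|l - alpha n|).
  move=> p N; apply: contrapT => bad; apply: far.
  have /cvgrPdist_le /(_ (2^-1 ^+ p)) := rho0; rewrite exprn_gt0// => /(_ isT)[M _ MP].
  exists (maxn N M) => // n /= nM; rewrite ltNge; apply/negP => far; apply: bad.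
  exists n; split; first exact: leq_trans (leq_maxl _ _) nM.
  split=> //; have := MP n (leq_trans (leq_maxr _ _) nM).
  rewrite /= sub0r normrN; exact: le_trans (ler_norm _).
move=> /all_and2[small farphi].
have /cvgrPdist_lt /(_ _ e0)[M _ /(_ M (leqnn _))] := h phi inc small.
by rewrite /= ltNge farphi.
Qed.

End fast_subsequences.

(** * Mean-square limits of Gaussian series in H *)

Section gaussian_series.
Context {R : realType} (H : completeNormedModType R) (ip : {dot H for idfun}).
Hypothesis Hip : norm_induced_by ip.
Variables (q : nat -> H) (Hq : orthonormal_basis ip q).
Context d (O : measurableType d) (P : probability O R).

Lemma fast_ae_cvg (Z_ : nat -> O -> H) (Z : O -> H) :
  (forall p, wmeasurable ip (Z_ p)) -> wmeasurable ip Z ->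
  (forall p, \int[P]_t (ip (Z_ p t - Z t) (Z_ p t - Z t))%:E <= ((2^-1) ^+ p)%:E)%E ->
  {ae P, forall t, Z_ p t @[p --> \oo] --> Z t}.
Proof.
move=> mZ_ mZ le.
apply: filterS (@ae_summable _ _ _ P (fun p t => ip (Z_ p t - Z t) (Z_ p t - Z t)) _ _ le).
- move=> t sm; have /cvg_series_cvg_0 c0 := nnseries_is_cvg (fun p => ip_ge0 ip (Z_ p t - Z t)) sm.
  apply/subr_cvg0/norm_cvg0P.
  have := cvg_comp _ _ c0 (@sqrt_continuous R 0); rewrite sqrtr0.
  by apply: eq_cvgn => p; rewrite /= (normE Hip).
- by move=> p; apply: (measurable_ip Hip Hq); exact: wmeasurableB.
- by move=> p t; exact: ip_ge0.
Qed.

Variable w : nat -> {RV P >-> R}.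
Hypothesis iidw : iid_std_normal w.
Variables (a : nat -> H) (L : R).
Hypothesis aL : \sum_(j < n) ip (a j) (a j) @[n --> \oo] --> L.

Let S n t := \sum_(j < n) w j t *: a j.
Let s n := \sum_(j < n) ip (a j) (a j).

Let mw j : measurable_fun setT (w j).
Proof. exact: (@measurable_funP _ _ _ _ setT (w j)). Qed.

Let mS n : wmeasurable ip (S n).
Proof. by apply: wmeasurable_sum => j; apply: wmeasurableZ => //; exact: wmeasurable_cst. Qed.

Let sq_ge0 p n : (p <= n)%N -> s p <= s n.
Proof.
move=> /subnKC <-; rewrite /s big_split_ord/= lerDl.
by apply: sumr_ge0 => j _; exact: ip_ge0.
Qed.

Let s_le n : s n <= L.
Proof.
have nd : nondecreasing_seq s by move=> *; exact: sq_ge0.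
have cs : cvgn s by exact: (cvgP _ aL).
by have := nondecreasing_cvgn_le nd cs n; rewrite (cvg_lim _ aL).
Qed.

(** The block from p to n is Gaussian with form sum_j <a_j, h>^2; summing this form over the basis
    gives sum_j |a_j|^2 by Parseval. *)
Let sqdist p n : (p <= n)%N ->
  (\int[P]_t (ip (S p t - S n t) (S p t - S n t))%:E = (s n - s p)%:E)%E.
Proof.
move=> pn; pose l := index_iota p n.
have split (V : zmodType) (u : nat -> V) :
    \sum_(j < n) u j = \sum_(j < p) u j + \sum_(j <- l) u j.
  by rewrite -!(big_mkord xpredT) -big_cat_nat.
have dE t : ip (S p t - S n t) (S p t - S n t) =
    ip (\sum_(j <- l) w j t *: a j) (\sum_(j <- l) w j t *: a j).
  by rewrite !(ip_norm Hip) /S (split _ (fun j => w j t *: a j)) opprD addNKr normrN.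
under eq_integral do rewrite dE.
have cS := gauss_cf_sum ip a iidw (iota_uniq p (n - p)).
rewrite (gauss_cf_sqnorm Hip _ cS _ _ Hq); last 3 first.
- by apply: wmeasurable_sum => j; apply: wmeasurableZ => //; exact: wmeasurable_cst.
- by move=> h; apply: sumr_ge0 => j _; exact: sqr_ge0.
- by move=> c h; rewrite mulr_sumr; apply: eq_bigr => j _; rewrite ipZr exprMn.
under eq_eseriesr do rewrite -sumEFin.
rewrite nneseries_sum; last by move=> *; rewrite lee_fin sqr_ge0.
have -> : s n - s p = \sum_(j <- l) ip (a j) (a j).
  by rewrite /s (split _ (fun j => ip (a j) (a j))) addrC addKr.
rewrite -sumEFin; apply: eq_bigr => j _; apply/cvg_lim => //.
apply: (@eq_cvgn _ (fun n => (\sum_(k < n) ip (a j) (q k) * ip (a j) (q k))%:E)).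
  by move=> N; rewrite big_mkord sumEFin.
by apply: cvg_EFin; [exact: nearW|exact: parseval].
Qed.

(* The limit is taken along a fast subsequence and set to 0 where that subsequence
   diverges, so that it is measurable; Fatou's lemma then controls the whole sequence. *)
Lemma gaussian_series_limit : exists X : O -> H, wmeasurable ip X /\
  forall n, (\int[P]_t (ip (S n t - X t) (S n t - X t))%:E <= (L - s n)%:E)%E.
Proof.
have rho0 : L - s n @[n --> \oo] --> (0 : R).
  by rewrite -(subrr L); apply: cvgB => //; exact: cvg_cst.
(* Squared increments of mean at most 4^-p may be weighted by 2^p and still have summable means. *)
have [|phi [inc small]] := @fast_subsequence _ _ (fun p => 4^-1 ^+ p) rho0.
  by move=> p; rewrite exprn_gt0.
pose D p t := S (phi p) t - S (phi p.+1) t.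
pose f p t := 2 ^+ p * ip (D p t) (D p t).
have f0 p t : 0 <= f p t by rewrite mulr_ge0 ?exprn_ge0 ?ip_ge0.
have mD p : measurable_fun setT (fun t => ip (D p t) (D p t)).
  by apply: (measurable_ip Hip Hq); exact: wmeasurableB.
have mf p : measurable_fun setT (f p) by exact: measurable_funM.
have fle p : (\int[P]_t (f p t)%:E <= ((2^-1) ^+ p)%:E)%E.
  under eq_integral do rewrite EFinM.
  rewrite ge0_integralZl//; [|exact/measurable_EFinP|by move=> *; rewrite lee_fin ip_ge0].
  rewrite /D sqdist ?(ltnW (inc p))// -EFinM lee_fin.
  have -> : 2^-1 ^+ p = 2 ^+ p * 4^-1 ^+ p :> R by rewrite -exprMn; congr (_ ^+ p); field.
  rewrite ler_pM2l ?exprn_gt0//; apply: le_trans (small p).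
  by rewrite lerB// s_le.
pose C := [set t | (\sum_(0 <= p <oo) (f p t)%:E < +oo)%E].
have mC : measurable C.
  rewrite -[C]setTI; apply: emeasurable_fun_infty_o => //.
  by apply: ge0_emeasurable_sum => [p t _ _|p _]; [rewrite lee_fin|exact/measurable_EFinP].
have cvgC t : C t -> cvgn (fun p => S (phi p) t).
  move=> Ct; have cf : cvgn (series (f ^~ t)) by exact: nnseries_is_cvg.
  have geo : cvgn (series (fun p => (2^-1 : R) ^+ p)).
    have := @is_cvg_geometric_series R 1 2^-1.
    rewrite /geometric/=; under eq_fun do rewrite mul1r.
    by apply; rewrite ger0_norm// invf_lt1// ltr1n.
  have cD : cvgn (series (D ^~ t)).
    (* Summability of 2^p |D_p|^2 implies that of |D_p|, since |D| <= 2^p |D|^2 + 2^-p. *)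
    apply: normed_cvg; apply: (@series_le_cvg _ _ (fun p => f p t + 2^-1 ^+ p)) => //.
    - by move=> p; exact: normr_ge0.
    - by move=> p; rewrite addr_ge0 ?exprn_ge0.
    - move=> p; rewrite /f (ip_norm Hip) exprVn /=.
      have y0 : 0 < (2 : R) ^+ p by rewrite exprn_gt0.
      rewrite -(ler_pM2l y0) mulrDr divff ?gt_eqF//.
      have z0 : 0 <= 2 ^+ p * `|D p t| by rewrite mulr_ge0// ltW.
      have -> : 2 ^+ p * (2 ^+ p * `|D p t| ^+ 2) = (2 ^+ p * `|D p t|) ^+ 2 by ring.
      by have := sqr_ge0 (2 ^+ p * `|D p t| - 1); rewrite sqrrB1; lra.
    - have -> : series (fun p => f p t + 2^-1 ^+ p) = series (f ^~ t) + series (fun p => 2^-1 ^+ p).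
        by apply/funext => n; rewrite /series/= big_split.
      exact: is_cvgD.
  have -> : (fun p => S (phi p) t) = (fun p => S (phi 0%N) t - series (D ^~ t) p).
    apply/funext => p; rewrite /series/= /D; under eq_bigr do rewrite -opprB.
    by rewrite sumrN opprK telescope_sumr// addrC subrK.
  by apply: is_cvgB => //; exact: is_cvg_cst.
pose X t : H := \1_C t *: limn (fun p => S (phi p) t).
have cX t : \1_C t *: S (phi p) t @[p --> \oo] --> X t.
  rewrite /X indicE; case: (boolP (t \in C)) => [/set_mem Ct|_].
    by rewrite scale1r; under eq_fun do rewrite scale1r; exact: cvgC.
  by rewrite scale0r; under eq_fun do rewrite scale0r; exact: cvg_cst.
have mX : wmeasurable ip X.
  move=> h; apply: (@measurable_fun_cvg _ _ _ _ (fun p t => ip (\1_C t *: S (phi p) t) h)).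
    by move=> p; apply: wmeasurableZ => //; exact: measurable_indic.
  by move=> t _; exact: (@cvg_ip _ _ _ Hip \oo _ _ _ _ _ (cX t) (cvg_cst h)).
exists X; split=> // n.
pose g p t := (ip (S n t - \1_C t *: S (phi p) t) (S n t - \1_C t *: S (phi p) t))%:E.
have mg p : measurable_fun setT (g p).
  apply/measurable_EFinP/(measurable_ip Hip Hq); apply: wmeasurableB => //;
  by apply: wmeasurableZ => //; exact: measurable_indic.
have g0 p t : (0 <= g p t)%E by rewrite lee_fin ip_ge0.
have gE p : (\int[P]_t g p t = \int[P]_t (ip (S n t - S (phi p) t) (S n t - S (phi p) t))%:E)%E.
  apply: ge0_ae_eq_integral => //.
  - by apply/measurable_EFinP/(measurable_ip Hip Hq); exact: wmeasurableB.
  - by move=> t _; rewrite lee_fin ip_ge0.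
  - apply: filterS (ae_summable mf f0 fle) => t Ct _.
    by rewrite /g indicE mem_set ?scale1r.
have -> : (\int[P]_t (ip (S n t - X t) (S n t - X t))%:E = \int[P]_t limn_einf (g ^~ t))%E.
  apply: eq_integral => t _; have gX : g ^~ t @ \oo --> (ip (S n t - X t) (S n t - X t))%:E.
    apply: cvg_EFin; first exact: nearW.
    have cd : S n t - \1_C t *: S (phi p) t @[p --> \oo] --> S n t - X t by apply: cvgB => //; exact: cvg_cst.
    exact: (@cvg_ip _ _ _ Hip \oo _ _ _ _ _ cd cd).
  by rewrite is_cvg_limn_einfE ?(cvg_lim _ gX)//; exact: (cvgP _ gX).
apply: le_trans (fatou P measurableT mg (fun p t _ => g0 p t)) _.
have gL : (\int[P]_t g p t @[p --> \oo] --> (L - s n)%:E)%E.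
  apply: (@cvg_trans _ ((fun p => (s (phi p) - s n)%:E) @ \oo)).
    apply: near_eq_cvg; near=> p; rewrite gE sqdist//.
    by near: p; move/cvgnyPge: (ltn_subsequence inc); exact.
  apply: cvg_EFin; first exact: nearW.
  apply: cvgB; last exact: cvg_cst.
  exact: (cvg_comp phi s (ltn_subsequence inc) aL).
by rewrite is_cvg_limn_einfE ?(cvg_lim _ gL)//; exact: (cvgP _ gL).
Unshelve. all: by end_near. Qed.

End gaussian_series.

Section product_cf.
Context {R : realType} d1 d2 (O1 : measurableType d1) (O2 : measurableType d2).
Variables (P1 : probability O1 R) (P2 : probability O2 R).

Let cos_le (x : R) : `|cos x| <= 1.
Proof. by rewrite ler_norml cos_geN1 cos_le1. Qed.

Let mcos : measurable_fun setT (@cos R).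
Proof. by apply: continuous_measurable_fun; exact: continuous_cos. Qed.

Lemma Rintegral_cos_prod (f1 : O1 -> R) (f2 : O2 -> R) (e1 e2 b : R) :
  measurable_fun setT f1 -> measurable_fun setT f2 ->
  (forall b, \int[P1]_t cos (f1 t + b) = e1 * cos b) ->
  (forall b, \int[P2]_t cos (f2 t + b) = e2 * cos b) ->
  \int[prodP P1 P2]_z cos (f1 z.1 + f2 z.2 + b) = e1 * e2 * cos b.
Proof.
move=> mf1 mf2 c1 c2; rewrite (@Rintegral_fubini1 _ _ _ _ _ P1 P2 _ 1)//; last first.
  apply: measurableT_comp => //; apply: measurable_funD => //; apply: measurable_funD.
    exact: (measurableT_comp mf1).
  exact: (measurableT_comp mf2).
under eq_Rintegral => x _.
  under eq_Rintegral do rewrite /= addrAC addrC.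
  rewrite c2.
  over.
rewrite RintegralZl//; last first.
  apply: (@bounded_integrable _ _ _ P1 _ 1) => //.
  by apply: measurableT_comp => //; exact: measurable_funD.
by rewrite c1; ring.
Qed.

End product_cf.

(** * Generic nondegeneracy of the limiting sketch *)

Section generic_rank.
Context {R : realType} (H : completeNormedModType R) (ip : {dot H for idfun}).
Hypothesis Hip : norm_induced_by ip.
Variables (q : nat -> H) (Hq : orthonormal_basis ip q).
Variables (A : {linear H -> H}) (k : nat).
Context d (O : measurableType d) (P : probability O R) (X : O -> 'I_k -> H).
Context d'' (O'' : measurableType d'') (P'' : probability O'' R).
Variable w : nat -> {RV P'' >-> R}.
Hypothesis iidw : iid_std_normal w.
Hypothesis mX : forall c, wmeasurable ip (X ^~ c).
Hypothesis cosX : forall (h : 'I_k -> H) b,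
  \int[P]_t cos (\sum_c ip (X t c) (h c) + b) =
  expR (- (\sum_c ip (A (h c)) (A (h c)) / 2)) * cos b.

Lemma eq_gs (z z' : nat -> H) n : (forall i, (i < n)%N -> z i = z' i) ->
  gs ip z n = gs ip z' n.
Proof.
elim: n => [//|n IH] zz /=; rewrite IH; last by move=> i /ltnW; exact: zz.
by rewrite zz.
Qed.

Lemma wmeasurable_extend0 d1 (O1 : measurableType d1) (z : O1 -> 'I_k -> H) j :
  (forall c, wmeasurable ip (z ^~ c)) -> wmeasurable ip (fun t => extend0 (z t) j).
Proof.
move=> mz; rewrite /extend0; case: insubP => [c _ _|_]; first exact: mz.
exact: wmeasurable_cst.
Qed.

(* The coordinate j may be replaced by an independent copy; its residual then has a
   nondegenerate Gaussian component along a vector orthogonal to the previous frame. *)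
Lemma generic_residual (j : 'I_k) : rank_gt ip A j ->
  {ae P, forall t, residual ip (gs ip (extend0 (X t)) j) (extend0 (X t) j) != 0}.
Proof.
move=> rj; pose r (x : 'I_k -> H) := residual ip (gs ip (extend0 x) j) (extend0 x j).
have mr d1 (O1 : measurableType d1) (z : O1 -> 'I_k -> H) :
    (forall c, wmeasurable ip (z ^~ c)) -> wmeasurable ip (r \o z).
  move=> mz; rewrite /comp /r; apply: wmeasurableB; first exact: wmeasurable_extend0.
  apply: (@wmeasurable_proj_gs _ _ _ Hip _ Hq _ _ (fun t => extend0 (z t)) j).
    by move=> i _; apply: (wmeasurable_gsv Hip Hq) => i'; exact: wmeasurable_extend0.
  exact: wmeasurable_extend0.
pose F (x : 'I_k -> H) : \bar R := (\1_[set (0 : R)] (ip (r x) (r x)))%:E.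
have mF d1 (O1 : measurableType d1) (z : O1 -> 'I_k -> H) :
    (forall c, wmeasurable ip (z ^~ c)) -> measurable_fun setT (F \o z).
  move=> mz; apply/measurable_EFinP.
  apply: (measurableT_comp (measurable_indic (measurable_set1 _))).
  by apply: (measurable_ip Hip Hq); exact: mr.
pose Z (s : O * O) c := if c == j then X s.2 c else X s.1 c.
have mZ c : wmeasurable ip (Z ^~ c).
  by move=> h; rewrite /Z; case: eqP => _; exact: (measurableT_comp (mX c h)).
have XZ : (\int[P]_t F (X t) = \int[prodP P P]_s F (Z s))%E.
  apply: (@ge0_integral_fam _ _ ip Hip q Hq _ j _ _ P X _ _ (prodP P P) Z _ _ P'' w iidw mX mZ _ F).
  - move=> h b; rewrite cosX.
    pose h1 c := if c == j then 0 else h c.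
    pose h2 c := if c == j then h c else 0.
    pose f h t := \sum_c ip (X t c) (h c).
    have mf h' : measurable_fun setT (f h') by apply: measurable_sum => c; exact: mX.
    have := Rintegral_cos_prod b (mf h1) (mf h2) (cosX h1) (cosX h2).
    rewrite -expRD -opprD -big_split/= => E.
    rewrite (eq_bigr (fun c => ip (A (h1 c)) (A (h1 c)) / 2 + ip (A (h2 c)) (A (h2 c)) / 2)); last first.
      by move=> c _; rewrite /h1 /h2; case: eqP; rewrite linear0 ip0l mul0r ?add0r ?addr0.
    rewrite -E; apply: eq_Rintegral => s _; rewrite /f -big_split/=; congr (cos (_ + b)).
    by apply: eq_bigr => c _; rewrite /Z /h1 /h2; case: eqP; rewrite ip0r ?add0r ?addr0.
  - exact: mF.
  - by move=> x; rewrite lee_fin.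
have Z0 : (\int[prodP P P]_s F (Z s) = 0)%E.
  rewrite (@fubini_tonelli1 _ _ _ _ _ P P (F \o Z) (mF _ _ Z mZ)); last by move=> x; rewrite lee_fin.
  apply: integral0_eq => t1 _; rewrite /fubini_F /=.
  (* With the first copy frozen, the rank condition yields h orthogonal to the previous frame with A
     h != 0. A vanishing residual forces <X_j, h> = 0 for the second copy, an event of probability 0
     because the variance |A h|^2 is positive. *)
  have [h [h0 Ah0]] := rj (fun a : 'I_j => gsv ip (extend0 (X t1)) a).
  apply/eqP; rewrite eq_le integral_ge0 ?andbT//; last by move=> s _; rewrite lee_fin.
  apply: (@le_trans _ _ (\int[P]_t2 (\1_[set 0%R] (ip (X t2 j) h))%:E)%E).
    apply: ge0_le_integral => //.
    - by move=> s _; rewrite lee_fin.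
    - by apply: (mF _ _ (fun t2 => Z (t1, t2))) => c h'; rewrite /Z/=; case: eqP => _; [exact: mX|].
    - apply/measurable_EFinP.
      by apply: (measurableT_comp (measurable_indic (measurable_set1 _))); exact: mX.
    move=> t2 _; rewrite lee_fin !indicE ler_nat.
    case: (boolP (_ \in _)) => // /set_mem /= r0.
    rewrite mem_set//=.
    have {}r0 : r (Z (t1, t2)) = 0.
      by apply: contrapT => /eqP/(ip_gt0 ip); rewrite r0 ltxx.
    have := ip0l ip h; rewrite -r0 /r extend0E /Z eqxx/= residualE ipBl.
    rewrite (eq_gs (z' := extend0 (X t1))).
      rewrite /proj ip_suml big_gs big1 ?subr0// => a _.
      by rewrite ipZl h0 mulr0.
    move=> i ij; have ik := ltn_trans ij (ltn_ord j).
    rewrite -[i]/(val (Ordinal ik)) !extend0E ifF//.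
    by apply/eqP => /(congr1 val)/= e; rewrite e ltnn in ij.
  rewrite integral_indic_preimage; [|exact: mX|exact: measurable_set1].
  rewrite (@gauss_atomless _ _ _ P _ (ip (A h) (A h)) _ _ _ _ _ _ w iidw)//.
  - exact: mX.
  - exact: ip_gt0.
  move=> s b; have := cosX (fun c => if c == j then s *: h else 0) b.
  rewrite (bigD1 j)//= eqxx big1 ?addr0; last first.
    by move=> c /negPf ->; rewrite linear0 ip0l mul0r.
  rewrite (_ : A (s *: h) = s *: A h); last exact: linearZ.
  rewrite ipZl ipZr mulrA -expr2 => <-; apply: eq_Rintegral => t _.
  rewrite (bigD1 j)//= eqxx big1 ?addr0 ?ipZr// => c /negPf ->.
  by rewrite ip0r.
have mV : measurable_fun setT (fun t => ip (r (X t)) (r (X t))).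
  by apply: (measurable_ip Hip Hq); exact: mr.
exists ((fun t => ip (r (X t)) (r (X t))) @^-1` [set 0]); split.
- by rewrite -[X in measurable X]setTI; exact: mV.
- by rewrite -integral_indic_preimage//; exact: etrans XZ Z0.
by move=> t /= /negP; rewrite negbK => /eqP; rewrite -/(r (X t)) => ->; rewrite ip0l.
Qed.

End generic_rank.

(** * Equality in law of real variables *)

Section equality_in_law.
Context {R : realType} d d' (O : measurableType d) (O' : measurableType d').
Variables (P : probability O R) (P' : probability O' R).
Variables (U : O -> R) (U' : O' -> R).
Hypotheses (mU : measurable_fun setT U) (mU' : measurable_fun setT U').

Definition equal_in_law : Prop :=
  forall S : set R, measurable S -> P (U @^-1` S) = P' (U' @^-1` S).

Let V : {RV P >-> R} := mfun_Sub (mem_set mU).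
Let V' : {RV P' >-> R} := mfun_Sub (mem_set mU').

Lemma equal_in_law_ge0_integral (F : R -> \bar R) : equal_in_law ->
  measurable_fun setT F -> (forall y, (0 <= F y)%E) ->
  (\int[P]_t F (U t) = \int[P']_t F (U' t))%E.
Proof.
move=> UU' mF F0.
have -> : (\int[P]_t F (U t) = \int[distribution P V]_y F y)%E.
  by rewrite ge0_integral_pushforward.
have -> : (\int[P']_t F (U' t) = \int[distribution P' V']_y F y)%E.
  by rewrite ge0_integral_pushforward.
by apply: eq_measure_integral => S mS _; exact: UU'.
Qed.

Lemma equal_in_law_Rintegral (f : R -> R) (M : R) : equal_in_law ->
  measurable_fun setT f -> (forall y, `|f y| <= M) ->
  \int[P]_t f (U t) = \int[P']_t f (U' t).
Proof.
move=> UU' mf fM; apply: (@EFin_inj R).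
have i1 : P.-integrable setT (EFin \o (f \o U)).
  by apply: bounded_integrable; [exact: measurableT_comp|move=> t; exact: fM].
have i2 : P'.-integrable setT (EFin \o (f \o U')).
  by apply: bounded_integrable; [exact: measurableT_comp|move=> t; exact: fM].
rewrite !EFin_Rintegral//.
have -> : (\int[P]_t (f (U t))%:E = \int[distribution P V]_y (f y)%:E)%E.
  by rewrite integral_pushforward//; exact/measurable_EFinP.
have -> : (\int[P']_t (f (U' t))%:E = \int[distribution P' V']_y (f y)%:E)%E.
  by rewrite integral_pushforward//; exact/measurable_EFinP.
by apply: eq_measure_integral => S mS _; exact: UU'.
Qed.

Lemma equal_in_law_tails (a : R) :
  (forall c, a < c -> P (U @^-1` `]c, +oo[) = P' (U' @^-1` `]c, +oo[)) ->
  (forall t, a < U t) -> (forall t, a < U' t) -> equal_in_law.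
Proof.
move=> tl Ua U'a S mS.
change (distribution P V S = distribution P' V' S).
apply: (measure_unique (@RGenOInfty.G R) (fun n => `]-(n%:R), +oo[%classic)) => //.
- exact: RGenOInfty.measurableE.
- move=> _ _ [x ->] [y ->]; exists (Num.max x y); apply/seteqP.
  split=> z /=; rewrite !in_itv/= !andbT gt_max; first by move=> [-> ->].
  by move=> /andP.
- by move=> n; exists (- n%:R).
- apply/seteqP; split=> // y _; exists (Num.truncn `|y|).+1 => //=.
  rewrite in_itv/= andbT ltrNl; apply: le_lt_trans (truncnS_gt _).
  by rewrite -normrN ler_norm.
- move=> _ [c ->]; have [ac|ca] := ltP a c; first exact: tl.
  have full d1 (O1 : measurableType d1) (Q : probability O1 R) (W : O1 -> R) :
      (forall t, a < W t) -> Q (W @^-1` `]c, +oo[) = 1%E.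
    move=> Wa; rewrite (_ : _ @^-1` _ = setT) ?probability_setT//.
    by apply/seteqP; split=> // t _; rewrite /= in_itv/= andbT; exact: le_lt_trans (Wa t).
  by change (P (U @^-1` `]c, +oo[) = P' (U' @^-1` `]c, +oo[)); rewrite !full.
- by move=> n; apply: le_lt_trans (ltry 1); exact: probability_le1.
Qed.

End equality_in_law.

(** [laplace_tail_weighted] reaches only positive thresholds, which would miss the mass at 0. Both
    variables are therefore shifted by 1, which gives all tails above -1. *)
Lemma equal_in_law_laplace {R : realType} d d' (O : measurableType d) (O' : measurableType d')
    (P : probability O R) (P' : probability O' R) (U : O -> R) (U' : O' -> R) :
  measurable_fun setT U -> measurable_fun setT U' ->
  (forall t, 0 <= U t) -> (forall t, 0 <= U' t) ->
  (forall l, 0 <= l -> \int[P]_t expR (- (l * U t)) = \int[P']_t expR (- (l * U' t))) ->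
  equal_in_law P P' U U'.
Proof.
move=> mU mU' U0 U'0 lap.
have tailE d1 (O1 : measurableType d1) (Q : probability O1 R) (W : O1 -> R) c :
    measurable_fun setT W -> 
    Q (W @^-1` `]c, +oo[) = (\int[Q]_t ((c + 1 < W t + 1)%R%:R * 1))%:E.
  move=> mW; have mS : measurable (W @^-1` `]c, +oo[).
    by rewrite -[X in measurable X]setTI; exact: mW.
  rewrite -[X in Q X]setIT -integral_indic// EFin_Rintegral; last first.
    apply: (@bounded_integrable _ _ _ Q _ 1).
      under eq_fun do rewrite mulr1 ltrD2r.
      rewrite (_ : (fun t => _) = \1_(W @^-1` `]c, +oo[)); first exact: measurable_indic.
      apply/funext => t; rewrite indicE; congr (nat_of_bool _)%:R.
      by apply/idP/idP; rewrite inE /= in_itv/= andbT.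
    by move=> t; case: (_ < _); rewrite ?(mul0r, mul1r, normr0, normr1)//.
  apply: eq_integral => t _; rewrite mulr1 indicE ltrD2r; congr (nat_of_bool _)%:R%:E.
  by apply/idP/idP; rewrite inE /= in_itv/= andbT.
apply: (@equal_in_law_tails _ _ _ _ _ _ _ _ _ mU mU' (-1)).
- move=> c c1; rewrite !tailE//; congr EFin.
  apply: (@laplace_tail_weighted _ _ _ P (fun t => U t + 1) (cst 1) _ _ P'
    (fun t => U' t + 1) (cst 1)) => //.
  + exact: measurable_funD.
  + by move=> t; rewrite addr_ge0.
  + by move=> t; rewrite /= ler01 lexx.
  + exact: measurable_funD.
  + by move=> t; rewrite addr_ge0.
  + by move=> t; rewrite /= ler01 lexx.
  + move=> l l0 /=.
    have E d1 (O1 : measurableType d1) (Q : probability O1 R) (W : O1 -> R) :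
        measurable_fun setT W -> (forall t, 0 <= W t) ->
        \int[Q]_t (expR (- (l * (W t + 1))) * 1) = expR (- l) * \int[Q]_t expR (- (l * W t)).
      move=> mW W0; rewrite -RintegralZl//; last first.
        apply: (@bounded_integrable _ _ _ Q _ 1); first exact: measurable_expR_scale.
        by move=> t; rewrite ger0_norm ?expR_ge0// -expR0 ler_expR oppr_le0 mulr_ge0.
      by apply: eq_Rintegral => t _; rewrite mulr1 -expRD mulrDr mulr1 opprD addrC.
    by rewrite !E// lap.
  + by rewrite -ltrBlDr sub0r.
- by move=> t; apply: lt_le_trans (U0 t); rewrite ltrN10.
- by move=> t; apply: lt_le_trans (U'0 t); rewrite ltrN10.
Qed.

(** * The estimators *)

Section estimator.
Context {R : realType} (H : completeNormedModType R) (ip : {dot H for idfun}).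
Hypothesis Hip : norm_induced_by ip.
Variables (q : nat -> H) (Hq : orthonormal_basis ip q).
Variable A : {linear H -> H}.
Hypothesis HA : positive_trace_class ip A.
Variables (k : nat) (kappa : R).
Hypothesis kappa0 : 0 <= kappa.

(** One formula for three estimators: f is [quad] for the truncated algorithm, [trunc_sq n] for its
    dual form and [sqnorm] for infHutch++; [kappa] stands for 3/m. *)
Definition estimate (f : H -> R) (Q : seq H) (x : 'I_k -> H) : R :=
  compressed_trace ip A Q + kappa * \sum_i f (residual ip Q (x i)).

Lemma estimate_ge0 f (z x : 'I_k -> H) : (forall u, 0 <= f u) ->
  0 <= estimate f (frame ip z) x.
Proof.
move=> f0; apply: addr_ge0; last by rewrite mulr_ge0 ?sumr_ge0.
exact: compressed_trace_frame_ge0 (ptc_positive HA).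
Qed.

Lemma wmeasurable_operator d (O : measurableType d) (U : O -> H) :
  wmeasurable ip U -> wmeasurable ip (fun t => A (U t)).
Proof. by move=> mU h; under eq_fun do rewrite (ptc_selfadjoint HA); exact: mU. Qed.

Lemma wmeasurable_residual d (O : measurableType d) (z : O -> 'I_k -> H) (U : O -> H) :
  (forall c, wmeasurable ip (z ^~ c)) -> wmeasurable ip U ->
  wmeasurable ip (fun t => residual ip (frame ip (z t)) (U t)).
Proof.
move=> mz mU; apply: wmeasurableB => //.
apply: (@wmeasurable_proj_gs _ _ _ Hip _ Hq _ _ (fun t => extend0 (z t)) k _ _ mU).
by move=> j _; apply: (wmeasurable_gsv Hip Hq) => i; exact: wmeasurable_extend0.
Qed.

Lemma measurable_estimate d (O : measurableType d) (f : H -> R) (z x : O -> 'I_k -> H) :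
  (forall d1 (O1 : measurableType d1) (U : O1 -> H),
    wmeasurable ip U -> measurable_fun setT (f \o U)) ->
  (forall c, wmeasurable ip (z ^~ c)) -> (forall c, wmeasurable ip (x ^~ c)) ->
  measurable_fun setT (fun t => estimate f (frame ip (z t)) (x t)).
Proof.
move=> mf mz mx; apply: measurable_funD.
  under eq_fun do rewrite compressed_trace_frame.
  apply: measurable_sum => j; apply: (measurable_ip Hip Hq).
    apply: wmeasurable_operator.
    by apply: (wmeasurable_gsv Hip Hq) => i; exact: wmeasurable_extend0.
  by apply: (wmeasurable_gsv Hip Hq) => i; exact: wmeasurable_extend0.
apply: measurable_funM => //; apply: measurable_sum => i.
by apply: (mf _ _ (fun t => residual ip (frame ip (z t)) (x t i))); exact: wmeasurable_residual.
Qed.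

Definition quad (u : H) : R := ip (A u) u.
(** Both the covariance form of the truncated normal vectors and the functional of the dual
    estimator; duality consists in this coincidence, with [quad] in the same two roles for the
    g_i. *)
Definition trunc_sq n (u : H) : R := \sum_(j < n) ip u (q j) ^+ 2.
Definition sqnorm (u : H) : R := ip u u.

Lemma measurable_quad d (O : measurableType d) (U : O -> H) :
  wmeasurable ip U -> measurable_fun setT (quad \o U).
Proof. by move=> mU; apply: (measurable_ip Hip Hq) => //; exact: wmeasurable_operator. Qed.

Lemma measurable_trunc_sq n d (O : measurableType d) (U : O -> H) :
  wmeasurable ip U -> measurable_fun setT (trunc_sq n \o U).
Proof. by move=> mU; apply: measurable_sum => j; apply: measurable_funX; exact: mU. Qed.

Lemma measurable_sqnorm d (O : measurableType d) (U : O -> H) :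
  wmeasurable ip U -> measurable_fun setT (sqnorm \o U).
Proof. by move=> mU; exact: (measurable_ip Hip Hq). Qed.

Lemma quad_ge0 u : 0 <= quad u. Proof. exact: ptc_positive HA u. Qed.
Lemma sqnorm_ge0 u : 0 <= sqnorm u. Proof. exact: ip_ge0. Qed.
Lemma trunc_sq_ge0 n u : 0 <= trunc_sq n u.
Proof. by apply: sumr_ge0 => j _; exact: sqr_ge0. Qed.

Context d1 (O1 : measurableType d1) (P1 : probability O1 R) (x : O1 -> 'I_k -> H).
Context d2 (O2 : measurableType d2) (P2 : probability O2 R) (g : O2 -> 'I_k -> H).
Hypotheses (mx : forall c, wmeasurable ip (x ^~ c)) (mg : forall c, wmeasurable ip (g ^~ c)).
Variable n : nat.
Hypothesis cosx : forall (h : 'I_k -> H) b,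
  \int[P1]_t cos (\sum_c ip (x t c) (h c) + b) =
  expR (- (\sum_c trunc_sq n (h c) / 2)) * cos b.
Hypothesis cosg : forall (h : 'I_k -> H) b,
  \int[P2]_t cos (\sum_c ip (g t c) (h c) + b) =
  expR (- (\sum_c quad (h c) / 2)) * cos b.

(* exp(-l <A r, r>) is the mean of cos(sqrt(2l) <g, r>) for g ~ N(0, A); after
   Fubini, x plays the same role for the covariance of the truncation. *)
Lemma laplace_duality (z : 'I_k -> H) l : 0 <= l ->
  \int[P1]_t expR (- (l * estimate quad (frame ip z) (x t))) =
  \int[P2]_t expR (- (l * estimate (trunc_sq n) (frame ip z) (g t))).
Proof.
move=> l0; pose r := residual ip (frame ip z).
(* Chosen so that s^2 / 2 = l * kappa, the coefficient in the Laplace exponent. *)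
pose s := Num.sqrt (2 * (l * kappa)).
have s2 : s ^+ 2 = 2 * (l * kappa) by rewrite sqr_sqrtr// mulr_ge0// mulr_ge0.
have rZ a u : r (a *: u) = a *: r u by rewrite /r !residualE projZ scalerBr.
pose phi (p : O1 * O2) := cos (\sum_c ip (g p.2 c) (s *: r (x p.1 c)) + 0).
have mr d (O : measurableType d) (U : O -> H) : wmeasurable ip U -> wmeasurable ip (r \o U).
  move=> mU; apply: (@wmeasurable_residual _ _ (fun=> z)) => // c; exact: wmeasurable_cst.
have mphi : measurable_fun setT phi.
  apply: (measurableT_comp (continuous_measurable_fun (@continuous_cos R))).
  apply: measurable_funD => //; apply: measurable_sum => c.
  apply: (measurable_ip Hip Hq); first by move=> h; exact: (measurableT_comp (mg c h)).
  apply: wmeasurableZ => //; apply: (mr _ _ (fun p : O1 * O2 => x p.1 c)) => h.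
  exact: (measurableT_comp (mx c h)).
have phi1 p : `|phi p| <= 1 by rewrite ler_norml cos_geN1 cos_le1.
have := Rintegral_fubini1 P1 P2 mphi phi1; rewrite (Rintegral_fubini2 P1 P2 mphi phi1) => E.
have e1 t : \int[P2]_t' phi (t, t') = expR (- (l * (kappa * \sum_c quad (r (x t c))))).
  rewrite /phi/= cosg cos0 mulr1; congr (expR (- _)).
  rewrite !mulr_sumr; apply: eq_bigr => c _; rewrite /quad.
  rewrite (_ : A (s *: _) = s *: A (r (x t c))); last exact: linearZ.
  by rewrite ipZl ipZr; apply: (@eq_trans _ _ (s ^+ 2 * ip (A (r (x t c))) (r (x t c)) / 2)); [ring|rewrite s2; field].
have e2 t' : \int[P1]_t phi (t, t') = expR (- (l * (kappa * \sum_c trunc_sq n (r (g t' c))))).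
  (* The residual map is self-adjoint, so the integrand can be read as a linear functional of x just
     as well as of g. *)
  have sw t : \sum_c ip (g t' c) (s *: r (x t c)) = \sum_c ip (x t c) (s *: r (g t' c)).
    by apply: eq_bigr => c _; rewrite !ipZr ipC residual_sym.
  rewrite /phi/=; under eq_Rintegral do rewrite sw.
  rewrite cosx cos0 mulr1; congr (expR (- _)).
  rewrite !mulr_sumr; apply: eq_bigr => c _; rewrite /trunc_sq.
  under eq_bigr do rewrite ipZl exprMn s2.
  by rewrite -mulr_sumr; field.
have split d (O : measurableType d) (P : probability O R) (f : H -> R) (y : O -> 'I_k -> H) :
    (forall d1 (O1 : measurableType d1) (U : O1 -> H),
      wmeasurable ip U -> measurable_fun setT (f \o U)) -> (forall u, 0 <= f u) ->
    (forall c, wmeasurable ip (y ^~ c)) ->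
    \int[P]_t expR (- (l * estimate f (frame ip z) (y t))) =
    expR (- (l * compressed_trace ip A (frame ip z))) *
    \int[P]_t expR (- (l * (kappa * \sum_c f (r (y t c))))).
  move=> mf f0 my; rewrite -RintegralZl//; last first.
    apply: (@bounded_integrable _ _ _ P _ 1).
      apply: measurable_expR_scale; apply: measurable_funM => //.
      by apply: measurable_sum => c; apply: (mf _ _ (r \o (y ^~ c))); exact: mr.
    move=> t; rewrite ger0_norm ?expR_ge0// -expR0 ler_expR oppr_le0.
    by rewrite mulr_ge0// mulr_ge0// sumr_ge0.
  by apply: eq_Rintegral => t _; rewrite /estimate mulrDr opprD expRD.
rewrite (split _ _ _ _ _ measurable_quad quad_ge0 mx).
rewrite (split _ _ _ _ _ (@measurable_trunc_sq n) (trunc_sq_ge0 n) mg); congr (_ * _).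
transitivity (\int[P1]_t \int[P2]_t' phi (t, t')).
  by apply: eq_Rintegral => t _; rewrite e1.
by rewrite -E; apply: eq_Rintegral => t' _; rewrite e2.
Qed.

End estimator.

Lemma ae_prod_fst {R : realType} d1 d2 (O1 : measurableType d1) (O2 : measurableType d2)
    (P1 : probability O1 R) (P2 : probability O2 R) (C : O1 -> Prop) :
  {ae P1, forall t, C t} -> {ae prodP P1 P2, forall s, C s.1}.
Proof.
move=> [N [mN N0 sN]]; exists (N `*` setT); split; first exact: measurableX.
  by rewrite /= /prodP product_measure1E// [X in (X * _)%E](_ : _ = 0)%E ?mul0e.
by move=> [a b] /= nC; split=> //; apply: sN.
Qed.

Section trace.
Context {R : realType} (H : completeNormedModType R) (ip : {dot H for idfun}).
Hypothesis Hip : norm_induced_by ip.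
Variable A : {linear H -> H}.
Hypothesis HA : positive_trace_class ip A.
Context d (O : measurableType d) (P : probability O R) (g : O -> H).
Hypotheses (mg : wmeasurable ip g) (cg : gauss_cf ip P g (quad ip A)).

Lemma quadZ a h : quad ip A (a *: h) = a ^+ 2 * quad ip A h.
Proof.
rewrite /quad (_ : A (a *: h) = a *: A h); last exact: linearZ.
by rewrite ipZl ipZr mulrA expr2.
Qed.

(** The right-hand side does not involve e: this is where the trace becomes independent of the
    basis, and finite for q as well. *)
Lemma optrace_sqnorm e : orthonormal_basis ip e ->
  optrace ip e A = (\int[P]_t (sqnorm ip (g t))%:E)%E.
Proof.
move=> He; rewrite [RHS](gauss_cf_sqnorm Hip mg cg _ _ He)//.
- by move=> h; exact: ptc_positive HA h.
- exact: quadZ.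
Qed.

Lemma sqnorm_integral_lty : (\int[P]_t (sqnorm ip (g t))%:E < +oo)%E.
Proof. by have [e [He]] := ptc_trace HA; rewrite (optrace_sqnorm He). Qed.

(** A is Hilbert-Schmidt, since |A q_j|^2 is at most a multiple of <A q_j, q_j>. This makes the
    series of w_j A q_j converge in mean square. *)
Lemma cvg_sqnorm_image q : orthonormal_basis ip q ->
  exists L : R, \sum_(j < n) ip (A (q j)) (A (q j)) @[n --> \oo] --> L.
Proof.
move=> Hq; have [M [M0 AM]] := psd_sqnorm_le Hip HA.
have cq : cvgn (series (fun j => ip (A (q j)) (q j))).
  apply: nnseries_is_cvg; first by move=> j; exact: ptc_positive HA _.
  by have := sqnorm_integral_lty; rewrite -(optrace_sqnorm Hq).
exists (limn (series (fun j => ip (A (q j)) (A (q j))))).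
apply: (@eq_cvgn _ (series (fun j => ip (A (q j)) (A (q j))))).
  by move=> n; rewrite /series/= big_mkord.
apply: (@series_le_cvg _ _ (M *: (fun j => ip (A (q j)) (q j)))) => [j|j|j|].
- exact: ip_ge0.
- by rewrite mulr_ge0 ?(ltW M0)//; exact: ptc_positive HA _.
- exact: AM.
- by apply: is_cvg_seriesZ.
Qed.

End trace.

(** * Sketches of all dimensions from the same normal variables *)

Section coupling.
Context {R : realType} (H : completeNormedModType R) (ip : {dot H for idfun}).
Hypothesis Hip : norm_induced_by ip.
Variables (q : nat -> H) (Hq : orthonormal_basis ip q).
Variable A : {linear H -> H}.
Hypothesis HA : positive_trace_class ip A.
Variable k : nat.
Context d' (O' : measurableType d') (P' : probability O' R).
Variable w : 'I_k * nat -> {RV P' >-> R}.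
Hypothesis iidw : iid_std_normal w.

Definition partial_sum n t (c : 'I_k) : H := \sum_(j < n) w (c, val j) t *: q j.

Local Notation Y := partial_sum.

Lemma wmeasurable_partial_sum n c : wmeasurable ip (fun t => Y n t c).
Proof.
apply: wmeasurable_sum => j; apply: wmeasurableZ; last exact: wmeasurable_cst.
exact: (@measurable_funP _ _ _ _ setT (w (c, val j))).
Qed.

Lemma image_partial_sum n t c : A (Y n t c) = \sum_(j < n) w (c, val j) t *: A (q j).
Proof. by rewrite linear_sum; apply: eq_bigr => j _; rewrite linearZ. Qed.

Lemma iid_row c : iid_std_normal (fun j => w (c, j)).
Proof. by apply: (@iid_std_normal_reindex _ _ _ _ _ _ _ iidw _ (fun p => Some p.2)). Qed.

Lemma coupling_limit (L : R) : \sum_(j < n) ip (A (q j)) (A (q j)) @[n --> \oo] --> L ->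
  exists X : O' -> 'I_k -> H, exists2 rho : nat -> R,
  (forall c, wmeasurable ip (X ^~ c)) /\ rho @ \oo --> 0 &
  forall n c, (\int[P']_t (ip (A (Y n t c) - X t c) (A (Y n t c) - X t c))%:E <= (rho n)%:E)%E.
Proof.
move=> aL.
have h c := cid (@gaussian_series_limit _ _ ip Hip q Hq _ _ P' _ (iid_row c) (fun j => A (q j)) L aL).
exists (fun t c => sval (h c) t); exists (fun n => L - \sum_(j < n) ip (A (q j)) (A (q j))).
  split; first by move=> c; exact: (svalP (h c)).1.
  by have := cvgB (cvg_cst L) aL; rewrite subrr; exact.
by move=> n c; under eq_integral do rewrite image_partial_sum; exact: (svalP (h c)).2.
Qed.

Variables (X : O' -> 'I_k -> H) (rho : nat -> R).
Hypotheses (mX : forall c, wmeasurable ip (X ^~ c)) (rho0 : rho @ \oo --> 0).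
Hypothesis distX : forall n c,
  (\int[P']_t (ip (A (Y n t c) - X t c) (A (Y n t c) - X t c))%:E <= (rho n)%:E)%E.

Let mAY n c : wmeasurable ip (fun t => A (Y n t c)).
Proof. by apply: (wmeasurable_operator HA); exact: wmeasurable_partial_sum. Qed.

Lemma coupling_fast_ae (phi : nat -> nat) : (forall p, rho (phi p) <= 2^-1 ^+ p) ->
  {ae P', forall t c, A (Y (phi p) t c) @[p --> \oo] --> X t c}.
Proof.
move=> small; apply: filter_forall => c.
apply: (@fast_ae_cvg _ _ _ Hip _ Hq _ _ P' (fun p t => A (Y (phi p) t c)) (X ^~ c)) => // p.
by apply: le_trans (distX _ _) _; rewrite lee_fin.
Qed.

(** The forms sum_j <q_j, A h>^2 of the truncated sketches tend to |A h|^2 = <A^2 h, h>, so the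
    components of X are independent copies of N(0, A^2). Dominated convergence along one fast
    subsequence is enough to identify this law. *)
Lemma coupling_cf (h : 'I_k -> H) b :
  \int[P']_t cos (\sum_c ip (X t c) (h c) + b) =
  expR (- (\sum_c ip (A (h c)) (A (h c)) / 2)) * cos b.
Proof.
have [|phi [inc small]] := @fast_subsequence _ _ (fun p => 2^-1 ^+ p) rho0.
  by move=> p; rewrite exprn_gt0.
have c1 : \int[P']_t cos (\sum_c ip (A (Y (phi p) t c)) (h c) + b) @[p --> \oo] -->
    \int[P']_t cos (\sum_c ip (X t c) (h c) + b).
  have mc (Z : O' -> 'I_k -> H) : (forall c, wmeasurable ip (Z ^~ c)) ->
      measurable_fun setT (fun t => cos (\sum_c ip (Z t c) (h c) + b)).
    move=> mZ; apply: (measurableT_comp (continuous_measurable_fun (@continuous_cos R))).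
    by apply: measurable_funD => //; apply: measurable_sum => c; exact: mZ.
  apply: (@Rintegral_dct _ _ _ P' _ _ 1).
  - by move=> p; apply: (mc (fun t c => A (Y (phi p) t c))).
  - exact: mc.
  - by move=> p t; rewrite ler_norml cos_geN1 cos_le1.
  - apply: filterS (coupling_fast_ae small) => t Xt.
    apply: (cvg_comp (fun p => \sum_c ip (A (Y (phi p) t c)) (h c) + b) cos); last exact: continuous_cos.
    apply: cvgD; last exact: cvg_cst.
    apply: cvg_big => [|c _]; first exact: add_continuous.
    exact: (@cvg_ip _ _ _ Hip \oo _ _ _ _ _ (Xt c) (cvg_cst (h c))).
have c2 : \int[P']_t cos (\sum_c ip (A (Y (phi p) t c)) (h c) + b) @[p --> \oo] -->
    expR (- (\sum_c ip (A (h c)) (A (h c)) / 2)) * cos b.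
  have E p : expR (- (\sum_c (\sum_(j < phi p) ip (q j) (A (h c)) ^+ 2) / 2)) * cos b =
      \int[P']_t cos (\sum_c ip (A (Y (phi p) t c)) (h c) + b).
    rewrite -(gauss_cf_family ip q iidw); apply: eq_Rintegral => t _; congr (cos (_ + b)).
    by apply: eq_bigr => c _; rewrite (ptc_selfadjoint HA).
  apply: eq_cvgn E _; apply: cvgM; last exact: cvg_cst.
  apply: (cvg_comp (fun p => - (\sum_c (\sum_(j < phi p) ip (q j) (A (h c)) ^+ 2) / 2)) expR); last exact: continuous_expR.
  apply: cvgN; apply: cvg_big => [|c _]; first exact: add_continuous.
  apply: cvgM; last exact: cvg_cst.
  apply: (cvg_comp phi (fun n => \sum_(j < n) ip (q j) (A (h c)) ^+ 2) (ltn_subsequence inc)).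
  apply: eq_cvgn (@parseval _ _ _ Hip q Hq (A (h c)) (A (h c))) => n.
  by apply: eq_bigr => j _; rewrite (ipC ip (q j)) expr2.
exact: (cvg_unique _ c1 c2).
Qed.

Context d'' (O'' : measurableType d'') (P'' : probability O'' R).
Variable w0 : nat -> {RV P'' >-> R}.
Hypothesis iidw0 : iid_std_normal w0.

Lemma coupling_generic : {ae P', forall t (j : 'I_k), (forall i, (i <= j)%N -> rank_gt ip A i) ->
  residual ip (gs ip (extend0 (X t)) j) (extend0 (X t) j) != 0}.
Proof.
apply: filter_forall => j.
have [rj|nr] := pselect (rank_gt ip A j); last by apply: aeW => t /(_ _ (leqnn j)).
by apply: filterS (generic_residual Hip Hq iidw0 mX coupling_cf rj).
Qed.

Lemma cvg_operator (x_ : nat -> H) x : x_ p @[p --> \oo] --> x -> A (x_ p) @[p --> \oo] --> A x.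
Proof.
have [M AM] := ptc_bounded HA => xx; apply/subr_cvg0/norm_cvg0P.
have u0 : M * `|x_ p - x| @[p --> \oo] --> (0 : R).
  rewrite -(mulr0 M); apply: cvgM; first exact: cvg_cst.
  by apply/norm_cvg0P/subr_cvg0.
apply: (squeeze_cvgr _ (cvg_cst 0) u0); apply: nearW => p.
by rewrite normr_ge0/= -linearB.
Qed.

Variable kappa : R.
Hypothesis kappa0 : 0 <= kappa.

(** The exceptional null set concerns the sketch alone and serves all x at once, so x may afterwards
    be the random family g on the other factor of a product. *)
Lemma coupling_estimate_cvg (phi : nat -> nat) :
  (forall p, (phi p < phi p.+1)%N) -> (forall p, rho (phi p) <= 2^-1 ^+ p) ->
  {ae P', forall t, forall x : 'I_k -> H,
    estimate ip A kappa (trunc_sq ip q (phi p)) (frame ip (fun c => A (Y (phi p) t c))) x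
      @[p --> \oo] --> estimate ip A kappa (sqnorm ip) (frame ip (X t)) x}.
Proof.
move=> inc small.
apply: filterS2 (coupling_fast_ae small) coupling_generic => t Xt gen x.
have gc : forall j, (j < k)%N ->
    gsv ip (extend0 (fun c => A (Y (phi p) t c))) j @[p --> \oo] --> gsv ip (extend0 (X t)) j.
  apply: (@cvg_gsv_range _ _ _ Hip A k _ (fun p => extend0 (Y (phi p) t))).
  - move=> p j; rewrite /extend0; case: insub => //=; by rewrite linear0.
  - move=> j jk; rewrite -[j]/(val (Ordinal jk)) extend0E.
    by under eq_fun do rewrite extend0E; exact: Xt.
  - by move=> j jk; exact: (gen (Ordinal jk)).
apply: cvgD.
  rewrite compressed_trace_frame; under eq_fun do rewrite compressed_trace_frame.
  apply: cvg_big => [|j _]; first exact: add_continuous.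
  have gj := gc _ (ltn_ord j).
  exact: (@cvg_ip _ _ _ Hip \oo _ _ _ _ _ (cvg_operator gj) gj).
apply: cvgM; first exact: cvg_cst.
apply: cvg_big => [|c _]; first exact: add_continuous.
apply: (cvg_trunc_sq Hip Hq (ltn_subsequence inc)).
apply: cvgB; first exact: cvg_cst.
by apply: cvg_proj_gs => //; exact: cvg_cst.
Qed.

End coupling.

(** * Mean of the limiting estimator for a frozen frame *)

Section means.
Context {R : realType} (H : completeNormedModType R) (ip : {dot H for idfun}).
Hypothesis Hip : norm_induced_by ip.
Variables (q : nat -> H) (Hq : orthonormal_basis ip q).
Variable A : {linear H -> H}.
Hypothesis HA : positive_trace_class ip A.
Variables (k : nat) (kappa : R).
Hypothesis kappak : kappa * k%:R = 1.
Context d (O : measurableType d) (P : probability O R) (g : O -> 'I_k -> H).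
Hypotheses (mg : forall c, wmeasurable ip (g ^~ c)).
Hypothesis cg : forall c, gauss_cf ip P (g ^~ c) (quad ip A).

Let msq c : measurable_fun setT (fun t => sqnorm ip (g t c)).
Proof. exact: (measurable_ip Hip Hq). Qed.

Lemma integrable_sqnorm c : P.-integrable setT (EFin \o (fun t => sqnorm ip (g t c))).
Proof.
apply/integrableP; split; first exact/measurable_EFinP.
under eq_integral do rewrite /= ger0_norm ?sqnorm_ge0//.
exact: (sqnorm_integral_lty Hip HA (mg c) (cg c)).
Qed.

Lemma Rintegral_moment2 c h : P.-integrable setT (EFin \o (fun t => ip (g t c) h ^+ 2)) /\
  \int[P]_t (ip (g t c) h ^+ 2) = quad ip A h.
Proof.
have E := gauss_cf_moment2 (mg c) (cg c) (quad_ge0 HA) (quadZ ip A) h.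
split; last by rewrite /Rintegral E.
apply/integrableP; split.
  by apply/measurable_EFinP; apply: measurable_funX; exact: mg.
by under eq_integral do rewrite /= ger0_norm ?sqr_ge0//; rewrite E ltry.
Qed.

Lemma Rintegral_sqnorm_residual c (z : 'I_k -> H) :
  P.-integrable setT (EFin \o (fun t => sqnorm ip (residual ip (frame ip z) (g t c)))) /\
  \int[P]_t sqnorm ip (residual ip (frame ip z) (g t c)) =
  \int[P]_t sqnorm ip (g t c) - compressed_trace ip A (frame ip z).
Proof.
have E t : sqnorm ip (residual ip (frame ip z) (g t c)) =
    sqnorm ip (g t c) - \sum_(v <- frame ip z) ip (g t c) v ^+ 2.
  rewrite /sqnorm -residual_frame_sq// residualE ipBr /proj ip_sumr.
  by congr (_ - _); apply: eq_bigr => v _; rewrite ipZr (ipC ip v) expr2.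
have [i1 i2] := @Rintegral_sum _ _ _ P _ (frame ip z) (fun v t => ip (g t c) v ^+ 2)
  (fun v => (Rintegral_moment2 c v).1).
split.
  by under eq_fun do rewrite E; exact: (integrableB measurableT (integrable_sqnorm c) i1).
under eq_Rintegral do rewrite E.
rewrite RintegralB//; last exact: integrable_sqnorm.
by rewrite i2; congr (_ - _); apply: eq_bigr => v _; rewrite (Rintegral_moment2 c v).2.
Qed.

(** Each residual square has mean E |g|^2 minus the compressed trace. Averaging k of them with kappa
    * k = 1, the compressed trace of the estimator cancels: it is unbiased already for a fixed
    sketch. *)
Lemma mean_estimate (z : 'I_k -> H) (c0 : 'I_k) :
  (forall c, \int[P]_t sqnorm ip (g t c) = \int[P]_t sqnorm ip (g t c0)) ->
  (\int[P]_t (estimate ip A kappa (sqnorm ip) (frame ip z) (g t))%:E =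
   \int[P]_t (sqnorm ip (g t c0))%:E)%E.
Proof.
move=> same; rewrite -[RHS](EFin_Rintegral (integrable_sqnorm c0)).
have [i1 i2] := @Rintegral_sum _ _ _ P _ (index_enum 'I_k)
  (fun c t => sqnorm ip (residual ip (frame ip z) (g t c)))
  (fun c => (Rintegral_sqnorm_residual c z).1).
have i3 := finite_measure_integrable_cst P (compressed_trace ip A (frame ip z)) measurableT.
have i4 := integrable_scalel kappa i1.
rewrite -EFin_Rintegral; last exact: (integrableD measurableT i3 i4).
congr EFin; rewrite /estimate RintegralD// Rintegral_cst// [X in fine X]probability_setT mulr1.
rewrite RintegralZl// i2.
under eq_bigr do rewrite (Rintegral_sqnorm_residual _ z).2 same.
by rewrite sumr_const card_ord -mulr_natl mulrA kappak mul1r addrC subrK.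
Qed.

End means.

(** * Transport of the two algorithms to a common product space *)

Section law_of_functional.
Context {R : realType} (H : completeNormedModType R) (ip : {dot H for idfun}).
Hypothesis Hip : norm_induced_by ip.
Variables (q : nat -> H) (Hq : orthonormal_basis ip q).
Variables (K : finType) (c0 : K).
Context d (O : measurableType d) (P : probability O R) (Z : O -> K -> H).
Context d' (O' : measurableType d') (P' : probability O' R) (Z' : O' -> K -> H).
Context d'' (O'' : measurableType d'') (P'' : probability O'' R).
Variable w : nat -> {RV P'' >-> R}.
Hypothesis iidw : iid_std_normal w.
Hypotheses (mZ : forall c, wmeasurable ip (Z ^~ c)) (mZ' : forall c, wmeasurable ip (Z' ^~ c)).
Hypothesis cosE : forall (h : K -> H) b,
  \int[P]_t cos (\sum_c ip (Z t c) (h c) + b) =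
  \int[P']_t cos (\sum_c ip (Z' t c) (h c) + b).

Lemma equal_in_law_functional (Phi : (K -> H) -> R) :
  (forall d1 (O1 : measurableType d1) (z : O1 -> K -> H),
    (forall c, wmeasurable ip (z ^~ c)) -> measurable_fun setT (Phi \o z)) ->
  equal_in_law P P' (Phi \o Z) (Phi \o Z').
Proof.
move=> mPhi S mS.
rewrite -!integral_indic_preimage//; [|exact: mPhi|exact: mPhi].
apply: (@ge0_integral_fam _ _ ip Hip q Hq _ c0 _ _ P Z _ _ P' Z' _ _ P'' w iidw mZ mZ' cosE
  (fun z => (\1_S (Phi z))%:E)) => [d1 O1 z mz|z]; last by rewrite lee_fin.
apply/measurable_EFinP.
by apply: (measurableT_comp (measurable_indic mS)); exact: mPhi.
Qed.

End law_of_functional.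

Section joined_families.
Context {R : realType} (H : completeNormedModType R) (ip : {dot H for idfun}) (I J : finType).
Variables (v1 v2 : H -> R).
Context d1 (O1 : measurableType d1) (P1 : probability O1 R) (y : O1 -> I -> H).
Context d2 (O2 : measurableType d2) (P2 : probability O2 R) (x : O2 -> J -> H).
Hypotheses (my : forall c, wmeasurable ip (y ^~ c)) (mx : forall c, wmeasurable ip (x ^~ c)).
Hypothesis cosy : forall (h : I -> H) b,
  \int[P1]_t cos (\sum_c ip (y t c) (h c) + b) = expR (- (\sum_c v1 (h c) / 2)) * cos b.
Hypothesis cosx : forall (h : J -> H) b,
  \int[P2]_t cos (\sum_c ip (x t c) (h c) + b) = expR (- (\sum_c v2 (h c) / 2)) * cos b.

Lemma joined_cf (h : I + J -> H) b :
  \int[prodP P1 P2]_s cos (\sum_c ip (join_families (y s.1) (x s.2) c) (h c) + b) =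
  expR (- (\sum_c join_families (fun=> v1) (fun=> v2) c (h c) / 2)) * cos b.
Proof.
have := Rintegral_cos_prod b _ _ (cosy (fun i => h (inl i))) (cosx (fun j => h (inr j))).
rewrite big_sumType/= opprD expRD => <-.
- by apply: eq_Rintegral => s _; rewrite big_sumType.
- by apply: measurable_sum => c; exact: my.
- by apply: measurable_sum => c; exact: mx.
Qed.

End joined_families.

Lemma joint_cf_inr {R : realType} (H : completeNormedModType R) (ip : {dot H for idfun})
    (Hip : norm_induced_by ip) d (O : measurableType d) (P : probability O R) (I J : finType)
    (y : I -> {RV P >-> borel H}) (x : J -> {RV P >-> borel H}) (v1 v2 : H -> R) :
  v1 0 = 0 -> mutually_independent (join_families y x) ->
  (forall i, gauss_cf ip P (y i : O -> H) v1) -> (forall j, gauss_cf ip P (x j : O -> H) v2) ->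
  forall (h : J -> H) b, \int[P]_t cos (\sum_j ip (x j t : H) (h j) + b) =
    expR (- (\sum_j v2 (h j) / 2)) * cos b.
Proof.
move=> v10 ind cy cx h b.
have cJ c : gauss_cf ip P (join_families y x c : O -> H)
    (join_families (fun=> v1) (fun=> v2) c) by case: c => [i|j]; [exact: cy|exact: cx].
have := joint_cf Hip ind cJ (join_families (fun=> 0) h) b.
rewrite big_sumType/= big1 ?add0r => [<-|i _]; last by rewrite v10 mul0r.
apply: eq_Rintegral => t _; congr (cos (_ + b)); rewrite big_sumType/=.
by rewrite [X in _ = X + _]big1 ?add0r// => i _; rewrite ip0r.
Qed.

Section estimator_law.
Context {R : realType} (H : completeNormedModType R) (ip : {dot H for idfun}).
Hypothesis Hip : norm_induced_by ip.
Variables (q : nat -> H) (Hq : orthonormal_basis ip q).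
Variable A : {linear H -> H}.
Hypothesis HA : positive_trace_class ip A.
Variables (k : nat) (kappa : R).
Hypotheses (kappa0 : 0 <= kappa) (k0 : 'I_k).
Context d' (O' : measurableType d') (P' : probability O' R).
Context d (O : measurableType d) (P : probability O R) (g : O -> 'I_k -> H).
Hypotheses (mg : forall c, wmeasurable ip (g ^~ c)).
Hypothesis cosg : forall (h : 'I_k -> H) b,
  \int[P]_t cos (\sum_c ip (g t c) (h c) + b) =
  expR (- (\sum_c quad ip A (h c) / 2)) * cos b.
Context d'' (O'' : measurableType d'') (P'' : probability O'' R).
Variable w : nat -> {RV P'' >-> R}.
Hypothesis iidw : iid_std_normal w.
Context d1 (O1 : measurableType d1) (P1 : probability O1 R).

Lemma limit_estimate_law (X : O' -> 'I_k -> H) (s g1 : 'I_k -> {RV P1 >-> borel H}) :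
  (forall c, wmeasurable ip (X ^~ c)) ->
  (forall (h : 'I_k -> H) b, \int[P']_t cos (\sum_c ip (X t c) (h c) + b) =
    expR (- (\sum_c ip (A (h c)) (A (h c)) / 2)) * cos b) ->
  mutually_independent (join_families s g1) ->
  (forall c, gauss_cf ip P1 (s c : O1 -> H) (fun h => ip (A h) (A h))) ->
  (forall c, gauss_cf ip P1 (g1 c : O1 -> H) (quad ip A)) ->
  equal_in_law P1 (prodP P' P)
    (fun t => estimate ip A kappa (sqnorm ip) (frame ip (fun c => s c t : H)) (fun c => g1 c t : H))
    (fun u => estimate ip A kappa (sqnorm ip) (frame ip (X u.1)) (g u.2)).
Proof.
move=> mX cosX ind cs cg1.
pose Phi (z : 'I_k + 'I_k -> H) := estimate ip A kappa (sqnorm ip)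
  (frame ip (fun c => z (inl c))) (fun c => z (inr c)).
apply: (@equal_in_law_functional _ _ ip Hip q Hq _ (inl k0) _ _ P1
  (fun t c => join_families s g1 c t : H) _ _ (prodP P' P)
  (fun u => join_families (X u.1) (g u.2)) _ _ P'' w iidw _ _ _ Phi).
- by move=> c; exact: wmeasurable_rv.
- by move=> [c|c] h; [exact: (measurableT_comp (mX c h))|exact: (measurableT_comp (mg c h))].
- move=> h b; rewrite (@joined_cf _ _ ip _ _ (fun h => ip (A h) (A h)) (quad ip A) _ _ P' X _ _ P g mX mg cosX cosg).
  by apply: (@joint_cf _ _ ip Hip _ _ P1 _ _ (join_families (fun=> fun h => ip (A h) (A h)) (fun=> quad ip A)) ind) => -[c|c]; [exact: cs|exact: cg1].
- move=> d2 O2 z mz.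
  apply: (measurable_estimate Hip Hq HA kappa _ (z := fun t c => z t (inl c)) (x := fun t c => z t (inr c))) => //.
  by move=> *; exact: (measurable_sqnorm Hip Hq).
Qed.

Variable w' : 'I_k * nat -> {RV P' >-> R}.
Hypothesis iidw' : iid_std_normal w'.

(** Two moves. Independence allows the sketch y to be replaced by the coupled one on P', the x
    staying on P1; then, for each fixed value of the sketch, [laplace_duality] replaces x by g, and
    Fubini assembles the Laplace transforms. *)
Lemma truncated_estimate_law n (y x : 'I_k -> {RV P1 >-> borel H}) :
  mutually_independent (join_families y x) ->
  (forall c, gauss_cf ip P1 (y c : O1 -> H) (trunc_sq ip q n)) ->
  (forall c, gauss_cf ip P1 (x c : O1 -> H) (trunc_sq ip q n)) ->
  equal_in_law P1 (prodP P' P)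
    (fun t => estimate ip A kappa (quad ip A) (frame ip (fun c => A (y c t))) (fun c => x c t : H))
    (fun u => estimate ip A kappa (trunc_sq ip q n)
       (frame ip (fun c => A (partial_sum q w' n u.1 c))) (g u.2)).
Proof.
move=> ind cy cx.
have mY : forall c, wmeasurable ip (fun t => partial_sum q w' n t c).
  by move=> c; exact: wmeasurable_partial_sum.
have mx c : wmeasurable ip (fun t => x c t : H) by exact: wmeasurable_rv.
have my c : wmeasurable ip (fun t => y c t : H) by exact: wmeasurable_rv.
have cosY (h : 'I_k -> H) b :
    \int[P']_t cos (\sum_c ip (partial_sum q w' n t c) (h c) + b) =
    expR (- (\sum_c trunc_sq ip q n (h c) / 2)) * cos b.
  rewrite (gauss_cf_family ip q iidw'); congr (expR (- _) * _).
  by apply: eq_bigr => c _; congr (_ / 2); apply: eq_bigr => j _; rewrite ipC.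
have cosJ h b : \int[P1]_t cos (\sum_c ip (join_families y x c t : H) (h c) + b) =
    expR (- (\sum_c trunc_sq ip q n (h c) / 2)) * cos b.
  by apply: (@joint_cf _ _ ip Hip _ _ P1 _ _ (fun=> trunc_sq ip q n) ind) => -[c|c]; [exact: cy|exact: cx].
have cosx (h : 'I_k -> H) b : \int[P1]_t cos (\sum_c ip (x c t : H) (h c) + b) =
    expR (- (\sum_c trunc_sq ip q n (h c) / 2)) * cos b.
  apply: (joint_cf_inr Hip _ ind cy cx).
  by rewrite /trunc_sq big1// => j _; rewrite ip0l expr0n.
pose Phi (z : 'I_k + 'I_k -> H) := estimate ip A kappa (quad ip A)
  (frame ip (fun c => A (z (inl c)))) (fun c => z (inr c)).
have mPhi d2 (O2 : measurableType d2) (z : O2 -> 'I_k + 'I_k -> H) :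
    (forall c, wmeasurable ip (z ^~ c)) -> measurable_fun setT (Phi \o z).
  move=> mz; apply: (measurable_estimate Hip Hq HA kappa _
    (z := fun t c => A (z t (inl c))) (x := fun t c => z t (inr c))) => //.
    by move=> *; exact: (measurable_quad Hip Hq HA).
  by move=> c; exact: (wmeasurable_operator HA).
have law : equal_in_law P1 (prodP P' P1)
    (Phi \o (fun t c => join_families y x c t : H))
    (Phi \o (fun u => join_families (partial_sum q w' n u.1) (fun c => x c u.2 : H))).
  apply: (@equal_in_law_functional _ _ ip Hip q Hq _ (inl k0) _ _ P1 _ _ _ (prodP P' P1) _ _ _ P'' w iidw).
  - by move=> c; exact: wmeasurable_rv.
  - by move=> [c|c] h; [exact: (measurableT_comp (mY c h))|exact: (measurableT_comp (mx c h))].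
  - move=> h b; rewrite cosJ.
    rewrite (@joined_cf _ _ ip _ _ (trunc_sq ip q n) (trunc_sq ip q n) _ _ P' _ _ _ P1 _ mY mx cosY cosx).
    by congr (expR (- _) * _); apply: eq_bigr => -[c|c].
  - exact: mPhi.
have m1 : measurable_fun setT (Phi \o (fun t c => join_families y x c t : H)).
  by apply: mPhi => c; exact: wmeasurable_rv.
have m2 : measurable_fun setT
    (Phi \o (fun u => join_families (partial_sum q w' n u.1) (fun c => x c u.2 : H))).
  apply: mPhi => -[c|c] h; first exact: (measurableT_comp (mY c h)).
  exact: (measurableT_comp (mx c h)).
have mY1 c : wmeasurable ip (fun u : O' * O => A (partial_sum q w' n u.1 c)).
  by apply: (wmeasurable_operator HA) => h; exact: (measurableT_comp (mY c h)).
have mT : measurable_fun setT (fun u : O' * O => estimate ip A kappa (trunc_sq ip q n)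
    (frame ip (fun c => A (partial_sum q w' n u.1 c))) (g u.2)).
  apply: (measurable_estimate Hip Hq HA kappa _
    (z := fun u c => A (partial_sum q w' n u.1 c)) (x := fun u c => g u.2 c)) => //.
    by move=> *; exact: measurable_trunc_sq.
  by move=> c h; exact: (measurableT_comp (mg c h)).
apply: equal_in_law_laplace => //.
- by move=> t; apply: estimate_ge0 => //; exact: quad_ge0.
- by move=> u; apply: estimate_ge0 => //; exact: trunc_sq_ge0.
move=> l l0.
(* [equal_in_law_Rintegral] needs a function bounded on the whole line; the absolute value provides
   one without changing the values at nonnegative estimates. *)
have abs (a : R) : 0 <= a -> expR (- (l * a)) = expR (- (l * `|a|)) by move=> a0; rewrite ger0_norm.
have lnorm (a : R) : 0 <= a -> `|expR (- (l * a))| <= 1.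
  by move=> a0; rewrite ger0_norm ?expR_ge0// -expR0 ler_expR oppr_le0 mulr_ge0.
have Phi0 z : 0 <= Phi z by apply: estimate_ge0 => //; exact: quad_ge0.
transitivity (\int[prodP P' P1]_u expR (- (l * Phi (join_families (partial_sum q w' n u.1) (fun c => x c u.2 : H))))).
  transitivity (\int[P1]_t expR (- (l * `|(Phi \o (fun t c => join_families y x c t : H)) t|))).
    by apply: eq_Rintegral => t _; rewrite -abs//; exact: Phi0.
  rewrite (@equal_in_law_Rintegral _ _ _ _ _ _ _ _ _ _ _ (fun a => expR (- (l * `|a|))) 1 law).
  - by apply: eq_Rintegral => u _; rewrite -abs//; exact: Phi0.
  - exact: m1.
  - exact: m2.
  - by apply: measurable_expR_scale; exact: normr_measurable.
  - by move=> a; exact: lnorm.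
rewrite (Rintegral_fubini1 P' P1 (M := 1)); last 2 first.
- exact: (measurable_expR_scale l m2).
- by move=> u; exact: lnorm.
rewrite (Rintegral_fubini1 P' P (M := 1)); last 2 first.
- exact: measurable_expR_scale.
- by move=> u; apply: lnorm; apply: estimate_ge0 => //; exact: trunc_sq_ge0.
apply: eq_Rintegral => t _.
exact: (laplace_duality Hip Hq HA kappa0 mx mg cosx cosg (fun c => A (partial_sum q w' n t c)) l0).
Qed.

End estimator_law.

(** * Convergence of the coupled estimators and of their means *)

Section estimator_limit.
Context {R : realType} (H : completeNormedModType R) (ip : {dot H for idfun}).
Hypothesis Hip : norm_induced_by ip.
Variables (q : nat -> H) (Hq : orthonormal_basis ip q).
Variable A : {linear H -> H}.
Hypothesis HA : positive_trace_class ip A.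
Variables (k : nat) (kappa : R).
Hypotheses (kappa0 : 0 <= kappa) (kappak : kappa * k%:R = 1) (k0 : 'I_k).
Context d' (O' : measurableType d') (P' : probability O' R).
Variable w : 'I_k * nat -> {RV P' >-> R}.
Hypothesis iidw : iid_std_normal w.
Context d'' (O'' : measurableType d'') (P'' : probability O'' R).
Variable w0 : nat -> {RV P'' >-> R}.
Hypothesis iidw0 : iid_std_normal w0.
Context d (O : measurableType d) (P : probability O R) (g : O -> 'I_k -> H).
Hypotheses (mg : forall c, wmeasurable ip (g ^~ c)).
Hypothesis cg : forall c, gauss_cf ip P (g ^~ c) (quad ip A).
Variables (X : O' -> 'I_k -> H) (rho : nat -> R).
Hypotheses (mX : forall c, wmeasurable ip (X ^~ c)) (rho0 : rho @ \oo --> 0).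
Hypothesis distX : forall n c, (\int[P']_t
  (ip (A (partial_sum q w n t c) - X t c) (A (partial_sum q w n t c) - X t c))%:E <= (rho n)%:E)%E.

Let T_ n (u : O' * O) := estimate ip A kappa (trunc_sq ip q n)
  (frame ip (fun c => A (partial_sum q w n u.1 c))) (g u.2).
Let T u := estimate ip A kappa (sqnorm ip) (frame ip (X u.1)) (g u.2).

Let mT_ n : measurable_fun setT (T_ n).
Proof.
apply: (measurable_estimate Hip Hq HA kappa _
  (z := fun u c => A (partial_sum q w n u.1 c)) (x := fun u c => g u.2 c)).
- by move=> *; exact: measurable_trunc_sq.
- move=> c; apply: (wmeasurable_operator HA) => h.
  exact: (measurableT_comp (wmeasurable_partial_sum ip q w n c h)).
- by move=> c h; exact: (measurableT_comp (mg c h)).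
Qed.

Let mT : measurable_fun setT T.
Proof.
apply: (measurable_estimate Hip Hq HA kappa _
  (z := fun u c => X u.1 c) (x := fun u c => g u.2 c)).
- by move=> *; exact: (measurable_sqnorm Hip Hq).
- by move=> c h; exact: (measurableT_comp (mX c h)).
- by move=> c h; exact: (measurableT_comp (mg c h)).
Qed.

Let aeT (phi : nat -> nat) :
  (forall p, (phi p < phi p.+1)%N) -> (forall p, rho (phi p) <= 2^-1 ^+ p) ->
  {ae prodP P' P, forall u, T_ (phi p) u @[p --> \oo] --> T u}.
Proof.
move=> inc small.
have := coupling_estimate_cvg Hip Hq HA iidw mX rho0 distX iidw0 kappa inc small.
by move=> /(ae_prod_fst P); apply: filterS => u; exact.
Qed.

Lemma coupled_bounded_cvg (f : R -> R) (M : R) : continuous f -> (forall x, `|f x| <= M) ->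
  \int[prodP P' P]_u f (T_ n u) @[n --> \oo] --> \int[prodP P' P]_u f (T u).
Proof.
move=> cf fM; apply: (cvg_fast_subsequences rho0) => phi inc small.
have mf := continuous_measurable_fun cf.
apply: (@Rintegral_dct _ _ _ (prodP P' P) (fun p u => f (T_ (phi p) u)) _ M) => //.
- by move=> p; exact: (measurableT_comp mf).
- exact: (measurableT_comp mf).
- by apply: filterS (aeT inc small) => u Tu; apply: (cvg_comp _ _ Tu); exact: cf.
Qed.

Lemma coupled_mean (e : nat -> H) : orthonormal_basis ip e ->
  (\int[prodP P' P]_u (T u)%:E)%E = optrace ip e A.
Proof.
move=> He.
rewrite (@fubini_tonelli1 _ _ _ _ _ P' P (fun u => (T u)%:E)); last 2 first.
- exact/measurable_EFinP.
- by move=> u; rewrite lee_fin; apply: (estimate_ge0 HA) => // v; exact: sqnorm_ge0.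
have tr c : (\int[P]_t (sqnorm ip (g t c))%:E = optrace ip e A)%E.
  by rewrite (optrace_sqnorm Hip HA (mg c) (cg c) He).
under eq_integral => t _.
  rewrite /fubini_F /T/= (mean_estimate Hip Hq HA kappak mg cg _ (c0 := k0)); last first.
    by move=> c; rewrite /Rintegral !tr.
  rewrite tr.
  over.
by rewrite integral_cst// [X in (_ * X)%E]probability_setT mule1.
Qed.

Let M := sval (cid (ptc_bounded HA)).
(** Dominates every [T_ n]: the k frame vectors have norm at most 1, and the truncated squares of a
    residual are bounded by |g|^2 through Bessel's inequality. *)
Let D (u : O' * O) : R := k%:R * `|M| + kappa * \sum_c sqnorm ip (g u.2 c).

Let T_le n u : T_ n u <= D u.
Proof.
apply: lerD.
  apply: compressed_trace_frame_le => // x.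
  apply: le_trans (svalP (cid (ptc_bounded HA)) x) _.
  by rewrite ler_wpM2r// ler_norm.
rewrite ler_wpM2l//; apply: ler_sum => c _.
apply: le_trans (bessel Hq n _) _; exact: residual_sq_le.
Qed.

Let iD : (prodP P' P).-integrable setT (EFin \o D).
Proof.
have D0 u : 0 <= D u.
  rewrite addr_ge0 ?mulr_ge0 ?sumr_ge0// => c _; exact: sqnorm_ge0.
have mD : measurable_fun setT D.
  apply: measurable_funD => //; apply: measurable_funM => //.
  apply: measurable_sum => c; apply: (measurable_ip Hip Hq);
  by move=> h; exact: (measurableT_comp (mg c h)).
apply/integrableP; split; first exact/measurable_EFinP.
under eq_integral do rewrite /= ger0_norm//.
rewrite (@fubini_tonelli1 _ _ _ _ _ P' P (fun u => (D u)%:E)); last 2 first.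
- exact/measurable_EFinP.
- by move=> u; rewrite lee_fin.
have i1 := (@Rintegral_sum _ _ _ P _ (index_enum 'I_k) (fun c t => sqnorm ip (g t c))
  (fun c => integrable_sqnorm Hip Hq HA mg cg c)).1.
have i2 := finite_measure_integrable_cst P (k%:R * `|M|) measurableT.
have := integrable_lty measurableT (integrableD measurableT i2 (integrable_scalel kappa i1)).
set c := (X in (X < _)%E) => cfin.
rewrite (_ : (\int[P']_x _)%E = (\int[P']_x cst c x)%E)//.
by rewrite integral_cst// [X in (_ * X)%E]probability_setT mule1.
Qed.

Lemma coupled_mean_cvg (e : nat -> H) : orthonormal_basis ip e ->
  (\int[prodP P' P]_u (T_ n u)%:E @[n --> \oo] --> optrace ip e A)%E.
Proof.
move=> He.
have T_ge0 n u : 0 <= T_ n u by apply: (estimate_ge0 HA) => // v; exact: trunc_sq_ge0.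
have iT n : (prodP P' P).-integrable setT (EFin \o T_ n).
  apply: le_integrable iD => //; first exact/measurable_EFinP.
  move=> u _; rewrite lee_fin !ger0_norm//; last exact: le_trans (T_le n u).
have trfin : optrace ip e A \is a fin_num.
  rewrite (optrace_sqnorm Hip HA (mg k0) (cg k0) He) ge0_fin_numE.
    exact: (sqnorm_integral_lty Hip HA (mg k0) (cg k0)).
  by apply: integral_ge0 => t _; rewrite lee_fin; exact: sqnorm_ge0.
rewrite -(fineK trfin).
apply: (@eq_cvgn _ (fun n => (\int[prodP P' P]_u T_ n u)%:E)).
  by move=> n; rewrite EFin_Rintegral.
apply: cvg_EFin; first exact: nearW.
apply: (cvg_fast_subsequences rho0) => phi inc small.
have [|||||_ _] := @dominated_convergence _ _ _ (prodP P' P) setT measurableT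
  (fun p u => (T_ (phi p) u)%:E) (fun u => (T u)%:E) (EFin \o D).
- by move=> p; exact/measurable_EFinP.
- exact/measurable_EFinP.
- apply: filterS (aeT inc small) => u Tu _; apply: cvg_EFin; [exact: nearW|exact: Tu].
- exact: iD.
- by apply: aeW => u p _; rewrite lee_fin ger0_norm.
rewrite (coupled_mean He) -(fineK trfin) => /fine_cvgP[_].
by apply: eq_cvgn => p; rewrite /=.
Qed.

End estimator_limit.
Theorem proposition9 (R : realType) (H : completeNormedModType R)
  (ip : {dot H for idfun}) (Hip : norm_induced_by ip)
  (q : nat -> H) (Hq : orthonormal_basis ip q)
  (A : {linear H -> H}) (HA : positive_trace_class ip A)
  (m : nat) (m_gt0 : (0 < m)%N) (m_dvd3 : (3 %| m)%N)
  (d : measure_display) (O : measurableType d) (P : probability O R)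
  (That : O -> R) (HT : infHutchpp ip A m P That)
  (dn : nat -> measure_display) (On : forall n, measurableType (dn n))
  (Pn : forall n, probability (On n) R)
  (Thatn : forall n, On n -> R)
  (HTn : forall n, truncated_infHutchpp ip q A m n.+1 (Pn n) (Thatn n)) :
  cvg_in_distribution Pn Thatn P That /\
  (forall e : nat -> H, orthonormal_basis ip e ->
    'E_(Pn n)[Thatn n]%E @[n --> \oo] --> optrace ip e A).
Proof.
have [s [g [Q [gs gg ind bs ThatE]]]] := HT.
pose k := (m %/ 3)%N; pose kappa : R := 3 / m%:R.
have mk : m = (k * 3)%N by rewrite divnK.
have kgt : (0 < k)%N by rewrite -(ltn_pmul2r (isT : (0 < 3)%N)) mul0n -mk.
pose k0 : 'I_k := Ordinal kgt.
have kappa0 : 0 <= kappa by rewrite divr_ge0.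
have kappak : kappa * k%:R = 1.
  have kn0 : k%:R != 0 :> R by rewrite pnatr_eq0 -lt0n.
  by rewrite /kappa mk natrM; field.
(* A space with infinitely many independent normal variables comes from the Karhunen-Loeve
   representation of one g; pairing indices through [pickle] then provides k independent rows. *)
have [_ [_ [_ [d' [Om' [P' [w0 [_ [iidw0 _ _]]]]]]]]] := gg k0.
pose w (r : 'I_k * nat) := w0 (choice.pickle r).
have iidw : iid_std_normal w by exact: (iid_std_normal_reindex iidw0 choice.pickleK).
pose gt t c : H := g c t.
have mg c : wmeasurable ip (gt ^~ c) by exact: wmeasurable_rv.
have cg c : gauss_cf ip P (gt ^~ c) (quad ip A) by exact: gauss_cf_gaussian (gg c).
have cs c : gauss_cf ip P (s c : O -> H) (fun h => ip (A h) (A h)).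
  move=> h b; rewrite (gauss_cf_gaussian Hip (gs c)) /=.
  by rewrite (ptc_selfadjoint HA).
have cosg (h : 'I_k -> H) b : \int[P]_t cos (\sum_c ip (gt t c) (h c) + b) =
    expR (- (\sum_c quad ip A (h c) / 2)) * cos b.
  apply: (joint_cf_inr Hip (v1 := fun h => ip (A h) (A h)) _ ind cs cg).
  by rewrite linear0 ip0l.
have [L aL] := cvg_sqnorm_image Hip HA (mg k0) (cg k0) Hq.
have [X [rho [mX rho0] distX]] := coupling_limit Hip Hq iidw aL.
have cosX := coupling_cf Hip Hq HA iidw mX rho0 distX.
pose T_ n (u : Om' * O) := estimate ip A kappa (trunc_sq ip q n)
  (frame ip (fun c => A (partial_sum q w n u.1 c))) (gt u.2).
pose T (u : Om' * O) := estimate ip A kappa (sqnorm ip) (frame ip (X u.1)) (gt u.2).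
(* Replaces the chosen basis by the Gram-Schmidt frame and, the residual map being an orthogonal
   projector, <g, r g> by |r g|^2. *)
have TE : That = fun t => estimate ip A kappa (sqnorm ip) (frame ip (fun c => s c t : H)) (gt t).
  apply/funext => t; rewrite ThatE /estimate (compressed_trace_basis Hip A (bs t)); congr (_ + _ * _).
  by apply: eq_bigr => i _; rewrite (residual_basis Hip (bs t)) residual_frame_sq.
have lawT : equal_in_law P (prodP P' P) That T.
  rewrite TE.
  exact: (limit_estimate_law Hip Hq HA kappa k0 mg cosg iidw0 mX cosX ind cs cg).
have mThat : measurable_fun setT That.
  rewrite TE; apply: (measurable_estimate Hip Hq HA kappa _ (z := fun t c => s c t) (x := gt)) => //.
    by move=> *; exact: (measurable_sqnorm Hip Hq).
  by move=> c; exact: wmeasurable_rv.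
have /all_and3[mThatn Thatn0 lawTn] n : [/\ measurable_fun setT (@Thatn n),
    forall t, 0 <= @Thatn n t & equal_in_law (Pn n) (prodP P' P) (@Thatn n) (T_ n.+1)].
  have [y [x [Qn [ys xs indn bsn ThatnE]]]] := HTn n.
  have -> : @Thatn n = fun t => estimate ip A kappa (quad ip A)
      (frame ip (fun c => A (y c t))) (fun c => x c t : H).
    apply/funext => t; rewrite ThatnE /estimate (compressed_trace_basis Hip A (bsn t)).
    by congr (_ + _ * _); apply: eq_bigr => i _; rewrite !(residual_basis Hip (bsn t)) residual_sym.
  split; last 1 first.
  - have cf (z : 'I_k -> {RV (Pn n) >-> borel H}) : (forall i, truncated_law q n.+1 (z i)) ->
        forall c, gauss_cf ip (Pn n) (z c : On n -> H) (trunc_sq ip q n.+1).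
      move=> zs c h b; rewrite (gauss_cf_truncated Hip (zs c)); congr (expR (- (_ / 2)) * _).
      by apply: eq_bigr => j _; rewrite ipC.
    exact: (truncated_estimate_law Hip Hq HA kappa0 k0 mg cosg iidw0 iidw indn (cf _ ys) (cf _ xs)).
  - apply: (measurable_estimate Hip Hq HA kappa _ (z := fun t c => A (y c t)) (x := fun t c => x c t)).
    + by move=> *; exact: (measurable_quad Hip Hq HA).
    + by move=> c; apply: (wmeasurable_operator HA); exact: wmeasurable_rv.
    + by move=> c; exact: wmeasurable_rv.
  - by move=> t; apply: (estimate_ge0 HA) => //; exact: quad_ge0.
have mT_ n : measurable_fun setT (T_ n).
  apply: (measurable_estimate Hip Hq HA kappa _
    (z := fun u c => A (partial_sum q w n u.1 c)) (x := fun u c => gt u.2 c)).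
  - by move=> *; exact: measurable_trunc_sq.
  - move=> c; apply: (wmeasurable_operator HA) => h.
    exact: (measurableT_comp (wmeasurable_partial_sum ip q w n c h)).
  - by move=> c h; exact: (measurableT_comp (mg c h)).
have mT : measurable_fun setT T.
  apply: (measurable_estimate Hip Hq HA kappa _
    (z := fun u c => X u.1 c) (x := fun u c => gt u.2 c)).
  - by move=> *; exact: (measurable_sqnorm Hip Hq).
  - by move=> c h; exact: (measurableT_comp (mX c h)).
  - by move=> c h; exact: (measurableT_comp (mg c h)).
split; last first.
  move=> e He.
  have := coupled_mean_cvg Hip Hq HA kappa0 kappak k0 iidw iidw0 mg cg mX rho0 distX He.
  (* The output on [Pn n] uses dimension n + 1, hence the shift. *)
  rewrite -cvg_shiftS; apply: eq_cvgn => n; rewrite unlock.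
  (* Equality in law is applied to |y|, nonnegative on the whole line, and both estimators are
     nonnegative, so this computes their means. *)
  have mabs : measurable_fun setT (fun y : R => (`|y|)%:E) by exact/measurable_EFinP.
  have := equal_in_law_ge0_integral (mThatn n) (mT_ _) (lawTn n) mabs (fun y => normr_ge0 y).
  under eq_integral do rewrite ger0_norm ?Thatn0//.
  under [X in _ = X]eq_integral => u _.
    rewrite ger0_norm; last by apply: (estimate_ge0 HA) => // v; exact: trunc_sq_ge0.
    over.
  by move=> E; exact: esym E.
split=> // f cf [B fB].
have mf := continuous_measurable_fun cf.
have expE (d1 : measure_display) (O1 : measurableType d1) (P1 : probability O1 R) (U : O1 -> R) :
    measurable_fun setT U -> ('E_P1[f \o U] = (\int[P1]_t f (U t))%:E)%E.
  move=> mU; rewrite unlock EFin_Rintegral//.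
  by apply: (@bounded_integrable _ _ _ P1 _ B); [exact: measurableT_comp|move=> t; exact: fB].
rewrite expE// (equal_in_law_Rintegral mThat mT lawT mf fB).
apply: (@eq_cvgn _ (fun n => (\int[prodP P' P]_u f (T_ n.+1 u))%:E)).
  by move=> n; rewrite expE// (equal_in_law_Rintegral (mThatn n) (mT_ _) (lawTn n) mf fB).
apply: cvg_EFin; first exact: nearW.
rewrite (cvg_shiftS (fun n => \int[prodP P' P]_u f (T_ n u))).
exact: (coupled_bounded_cvg Hip Hq HA (kappa := kappa) iidw iidw0 mg mX rho0 distX cf fB).
Qed.
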